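(* Let $\Omega\subset\mathbb{C}^n$ be a bounded starlike circular domain with $0\in\Omega$ whose Minkowski functional $\rho$ is of class $C^1$ on $\mathbb{C}^n\setminus\{0\}$. Let $\Phi:\mathbb{U}\to\mathbb{C}$ be biholomorphic onto its image with $\Phi(0)=1$, $\Phi'(0)>0$, $\Phi''(0)\in\mathbb{R}$ and $\operatorname{Re}\Phi(\zeta)>0$ for $\zeta\in\mathbb{U}$, and suppose that $$2\Phi'(0)-2(\Phi'(0))^2\ \le\ \Phi''(0)\ \le\ 6(\Phi'(0))^2-2\Phi'(0).$$ Let $g:\Omega\to\mathbb{C}$ be holomorphic with $g(0)=1$, and let $G:\Omega\to\mathbb{C}^n$, $G(z)=z\,g(z)$. Suppose that $J_G(z)$ is invertible for every $z\in\Omega$ and that the mapping $z\mapsto J_G^{-1}(z)G(z)$ belongs to $\mathscr{M}_\Phi$. For $z\in\Omega\setminus\{0\}$ put $$b_3=2\frac{\partial\rho}{\partial z}\frac{D^3G(0)(z^3)}{3!\,\rho^3(z)},\qquad b_2=2\frac{\partial\rho}{\partial z}\frac{D^2G(0)(z^2)}{2!\,\rho^2(z)}.$$ Then for all $z\in\Omega\setminus\{0\}$ $$|2b_2^2b_3-b_3^2-2b_2^2+1|\ \le\ 1+2(\Phi'(0))^2+\frac{(\Phi'(0))^2}{4}\left(3\Phi'(0)-\frac{\Phi''(0)}{2\Phi'(0)}\right)\left(\frac{\Phi''(0)}{2\Phi'(0)}+\Phi'(0)\right).$$ The bound is sharp: for every such $\Omega$ and $\Phi$ there exist a holomorphic function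 $g:\Omega\to\mathbb{C}$ with $g(0)=1$, such that for $G(z)=z\,g(z)$ the matrix $J_G(z)$ is invertible for every $z\in\Omega$ and the mapping $z\mapsto J_G^{-1}(z)G(z)$ belongs to $\mathscr{M}_\Phi$, and a point $z\in\Omega\setminus\{0\}$ for which equality holds.
   Context: $\mathbb{U}$ is the open unit disk in $\mathbb{C}$. Points $z=(z_1,\dots,z_n)'$ of $\mathbb{C}^n$ are column vectors. The Minkowski functional of a bounded starlike circular domain $\Omega$ is the unique continuous function $\rho:\mathbb{C}^n\to\mathbb{R}$ with $\rho(z)\ge 0$, $\rho(z)=0\Leftrightarrow z=0$, $\rho(tz)=|t|\rho(z)$ for $t\in\mathbb{C}$, and $\Omega=\{z:\rho(z)<1\}$. The expression $\frac{\partial\rho}{\partial z}=\frac{\partial\rho(z)}{\partial z}=\left(\frac{\partial\rho(z)}{\partial z_1},\dots,\frac{\partial\rho(z)}{\partial z_n}\right)$ is the row vector of Wirtinger derivatives of $\rho$ at $z$; juxtaposed with a column vector it denotes the matrix product (a complex number). For a holomorphic mapping $G=(G_1,\dots,G_n)'$, $J_G(z)$ is the complex Jacobian matrix at $z$, $J_G^{-1}(z)$ its inverse, and $D^kG(0)(z^k)\in\mathbb{C}^n$ is the $k$-th Fréchet derivative of $G$ at $0$ evaluated at $(z,\dots,z)$; its $j$-th component is $\sum_{p_1,\dots,p_k=1}^n\frac{\partial^kG_j(0)}{\partial z_{p_1}\cdots\partial z_{p_k}}z_{p_1}\cdots z_{p_k}$. $\mathcal{H}(\Omega)$ is the set of holomorphic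 mappings $\Omega\to\mathbb{C}^n$, $I$ is the identity matrix, and $$\mathscr{M}_\Phi=\left\{p\in\mathcal{H}(\Omega):p(0)=0,\ J_p(0)=I,\ \frac{\rho(z)}{2\frac{\partial\rho}{\partial z}p(z)}\in\Phi(\mathbb{U})\ \text{for all } z\in\Omega\setminus\{0\}\right\}.$$ *)

(* Defs.v *)
From HB Require Import structures.
From mathcomp Require Import all_boot all_order all_algebra.
From mathcomp Require Import complex.
From mathcomp Require Import all_classical all_reals.
From mathcomp Require Import topology normedtype derive.

Set Implicit Arguments.
Unset Strict Implicit.
Unset Printing Implicit Defensive.

Import Order.TTheory GRing.Theory Num.Theory numFieldNormedType.Exports.

Local Open Scope classical_set_scope.
Local Open Scope ring_scope.
Local Open Scope complex_scope.

(* The complex field seen as a normed space over itself: the bare [R[i]]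
   carries no topology in the library, its regular module [R[i]^o] does. *)
Notation Cplx R := (R[i]^o).

Section Holomorphy.
Variable R : realType.
Local Notation C := (Cplx R).

Definition unit_disk : set C := [set z | `|z| < 1].

(* [differentiable] is Fréchet differentiability over the scalar field of the
   two normed modules, here [R[i]]: complex differentiability. *)
Definition holomorphic_on (V W : normedModType R[i]) (A : set V) (f : V -> W) :=
  forall z, A z -> differentiable f z.

Definition biholomorphic_onto_image (A : set C) (f : C -> C) :=
  holomorphic_on A f /\
  exists h : C -> C, [/\ open (f @` A), holomorphic_on (f @` A) h &
    forall z, A z -> h (f z) = z].

Variable n : nat.
Local Notation Cn := 'cV[C]_n.

Definition partial (j : 'I_n) (f : Cn -> C) : Cn -> C :=
  fun z => 'D_(delta_mx j 0) f z.

Definition cjacobian (F : Cn -> Cn) (z : Cn) : 'M[C]_n :=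
  \matrix_(i, j) partial j (fun w => F w i 0) z.

(* The vector D^k F(0)(z^k), given componentwise by the sum of
   d^k F_i(0) / dz_(p_1)...dz_(p_k) * z_(p_1)...z_(p_k) over all p. *)
Definition frechet0 (k : nat) (F : Cn -> Cn) (z : Cn) : Cn :=
  \col_i \sum_(p : k.-tuple 'I_n)
    foldr partial (fun w => F w i 0) p 0 * \prod_(j <- p) z j 0.

End Holomorphy.

Section Domain.
Variables (R : realType) (n : nat).
Local Notation C := (Cplx R).
Local Notation Cn := 'cV[C]_n.

Definition bounded_starlike_circular_domain (Omega : set Cn) :=
  [/\ open Omega, connected Omega, bounded_set Omega,
      (forall (t : R) z, 0 <= t <= 1 -> Omega z -> Omega (t%:C *: z)) &
      (forall (u : C) z, `|u| = 1 -> Omega z -> Omega (u *: z))].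

Definition minkowski_functional (Omega : set Cn) (rho : Cn -> R) :=
  [/\ continuous rho,
      (forall z, 0 <= rho z),
      (forall z, rho z = 0 <-> z = 0),
      (forall (t : C) z, (rho (t *: z))%:C = `|t| * (rho z)%:C) &
      Omega = [set z | rho z < 1]].

Definition real_deriv (v : Cn) (rho : Cn -> R) (z : Cn) : R :=
  derive1 (fun t : R => rho (z + t%:C *: v)) 0.

Definition C1_along (v : Cn) (rho : Cn -> R) (z : Cn) :=
  derivable (fun t : R => rho (z + t%:C *: v)) 0 1 /\
  {for z, continuous (real_deriv v rho)}.

(* The real coordinates of C^n are x_j (direction e_j) and y_j (direction
   i e_j). *)
Definition C1_off_origin (rho : Cn -> R) :=
  forall z, z != 0 -> forall j : 'I_n,
    C1_along (delta_mx j 0) rho z /\ C1_along ('i *: delta_mx j 0) rho z.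

Definition wirtinger (rho : Cn -> R) (z : Cn) : 'rV[C]_n :=
  \row_j (((real_deriv (delta_mx j 0) rho z)%:C
           - 'i * (real_deriv ('i *: delta_mx j 0) rho z)%:C) / 2).

(* A vanishing denominator gives the quotient 0, which is not in the range
   of Phi when Re Phi > 0. *)
Definition class_M (Omega : set Cn) (rho : Cn -> R) (Phi : C -> C)
    (p : Cn -> Cn) :=
  [/\ holomorphic_on Omega p, p 0 = 0, cjacobian p 0 = 1%:M &
      forall z, Omega z -> z != 0 ->
        (Phi @` @unit_disk R)
          ((rho z)%:C / (2 * (wirtinger rho z *m p z) 0 0))].

Definition radial (g : Cn -> C) : Cn -> Cn := fun z => g z *: z.

Definition admissible (Omega : set Cn) (rho : Cn -> R) (Phi : C -> C)
    (g : Cn -> C) :=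
  [/\ holomorphic_on Omega g, g 0 = 1,
      (forall z, Omega z -> cjacobian (radial g) z \in unitmx) &
      class_M Omega rho Phi
        (fun z => invmx (cjacobian (radial g) z) *m radial g z)].

Definition coef_b (rho : Cn -> R) (G : Cn -> Cn) (k : nat) (z : Cn) : C :=
  2 * (wirtinger rho z *m frechet0 k G z) 0 0 / (k`!%:R * (rho z)%:C ^+ k).

End Domain.

(* Main.v *)
Require Import Defs.
From HB Require Import structures.
From mathcomp Require Import all_boot all_order all_algebra.
From mathcomp Require Import complex.
From mathcomp Require Import all_classical all_reals.
From mathcomp Require Import topology normedtype derive.
From mathcomp Require Import ring lra.
From mathcomp Require Import landau sequences exp trigo.
From mathcomp Require Import measure lebesgue_measure lebesgue_integral ftc.
Import Order.TTheory GRing.Theory Num.Theory numFieldNormedType.Exports.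
Local Open Scope classical_set_scope.
Local Open Scope ring_scope.
Local Open Scope complex_scope.

Set Implicit Arguments.
Unset Strict Implicit.
Unset Printing Implicit Defensive.

(** The mapping [G z = g z *: z] is controlled by the scalar function [g].
    Since [J_G(z) z = (g(z) + Dg(z) z) z], the vector [J_G^-1(z) G(z)] is a
    multiple of [z], and Euler's identity [2 (d rho / dz) z = rho(z)] turns
    membership in the class into the condition that [1 + Dg(z) z / g(z)] lies
    in the range of [Phi] ([admissible_log_derivative]).

    Fix [u] with [rho u = 1] and let [gam q = g (q u)]. Then
    [gam + q gam' = Phi(om(q)) gam] for a holomorphic self-map [om] of the
    disk with [om(0) = 0]. Put [B1 = Phi'(0)], [B2 = Phi''(0) / 2], and let
    [c1], [c2] be the coefficients of order 1 and 2 of [om]. The numbers [b_2],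
    [b_3] are those of [gam] ([coef_b_slice]), so comparing coefficients
    ([log_derivative_coef]) gives
    [b_2 = B1 c1] and [b_3 = (B1 c2 + (B2 + B1^2) c1^2) / 2]. The quantity to
    be estimated is [1 - 2 b_2^2 + b_3 (2 b_2^2 - b_3)]. The hypotheses on
    [Phi''(0)] say that [B1 <= B2 + B1^2] and [B1 <= 3 B1^2 - B2]; together
    with [|c2| <= 1 - |c1|^2] ([schwarz_coef]) they bound [b_3] and
    [2 b_2^2 - b_3] separately ([determinant_bound]).

    For sharpness, a suitable multiple [T] of a coordinate function satisfies
    [|T| <= rho], with [T u = 1] at some [u] such that [rho u = 1]
    ([supporting_functional]). Take [g = E o T], where [E(0) = 1] and
    [w E'(w) = (Phi(i w) - 1) E(w)]. This corresponds to [om(q) = i q], for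
    which [b_2 = i B1], [b_3 = - (B2 + B1^2) / 2], and every estimate above is
    an equality ([extremal_admissible], [extremal_value]).

    The function theory behind this is derived from complex differentiability
    alone. Goursat's theorem on rectangles, read in the coordinate [log z],
    gives the mean value property on circles even when the function is only
    continuous at the centre ([mean_value]); hence Cauchy's formulas for the
    coefficients of order 1 and 2 ([cauchy_coef1], [cauchy_coef2]). Averaging
    [f(x + r e^(it) e) e^(-it)] then shows that the directional derivatives of
    a holomorphic function on an open set of a normed space are holomorphic
    ([holomorphic_derive]). The estimate of [c2] is Bessel's inequality on
    circles for the products [om(z) (x + y z)]. *)

(** * A real-valued modulus on complex normed spaces *)

Section Modulus.
Context {R : realType}.
Implicit Types z w : Cplx R.

(** The norm of a complex normed space as a real number. Norms live in
    [R[i]], where the order is partial; estimates are carried out in [R]. *)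
Definition nrm {V : normedModType R[i]} (x : V) : R := complex.Re `|x|.

Section Nrm.
Context {V : normedModType R[i]}.
Implicit Types x y : V.

Lemma nrmE x : `|x| = (nrm x)%:C.
Proof. by rewrite /nrm RRe_real // normr_real. Qed.

Lemma nrm_ge0 x : 0 <= nrm x.
Proof. by move: (normr_ge0 x); rewrite nrmE ler0c. Qed.

Lemma nrmD x y : nrm (x + y) <= nrm x + nrm y.
Proof. by rewrite -lecR rmorphD /= -!nrmE ler_normD. Qed.

Lemma nrmN x : nrm (- x) = nrm x.
Proof. by rewrite /nrm normrN. Qed.

Lemma nrmB x y : nrm (x - y) <= nrm x + nrm y.
Proof. by rewrite -(nrmN y) nrmD. Qed.

Lemma nrmBC x y : nrm (x - y) = nrm (y - x).
Proof. by rewrite -nrmN opprB. Qed.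

Lemma nrm0 : nrm (0 : V) = 0.
Proof. by rewrite /nrm normr0. Qed.

Lemma nrm0_eq0 x : nrm x = 0 -> x = 0.
Proof. by move=> h; apply/normr0_eq0; rewrite nrmE h. Qed.

Lemma nrm_gt0 x : (0 < nrm x) = (x != 0).
Proof.
rewrite lt0r nrm_ge0 andbT; congr (~~ _); apply/eqP/eqP => [/nrm0_eq0 //|->].
exact: nrm0.
Qed.

Lemma nrmZ (c : Cplx R) x : nrm (c *: x) = nrm c * nrm x.
Proof. by apply: complexI; rewrite rmorphM /= -!nrmE normrZ. Qed.

Lemma nrm_le x (e : R) : (`|x| <= e%:C) = (nrm x <= e).
Proof. by rewrite nrmE lecR. Qed.

Lemma nrm_lt x (e : R) : (`|x| < e%:C) = (nrm x < e).
Proof. by rewrite nrmE ltcR. Qed.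

End Nrm.

Lemma nrmM z w : nrm (z * w) = nrm z * nrm w.
Proof. exact: (nrmZ z w). Qed.

Lemma nrmX z n : nrm (z ^+ n) = nrm z ^+ n.
Proof. by apply: complexI; rewrite rmorphXn /= -!nrmE normrX. Qed.

Lemma nrmV z : nrm z^-1 = (nrm z)^-1.
Proof. by apply: complexI; rewrite fmorphV /= -!nrmE normfV. Qed.

Lemma nrm1 : nrm (1 : Cplx R) = 1.
Proof. by rewrite /nrm normr1. Qed.

Lemma nrmR (t : R) : nrm (t%:C : Cplx R) = `|t|.
Proof. by rewrite /nrm normc_def /= expr0n addr0 sqrtr_sqr. Qed.

Lemma nrm_sqr z : nrm z ^+ 2 = complex.Re z ^+ 2 + complex.Im z ^+ 2.
Proof.
by rewrite /nrm normc_def /= sqr_sqrtr // addr_ge0 // sqr_ge0.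
Qed.

Lemma imaginaryE : 'i%R = (0 +i* 1)%C :> Cplx R.
Proof. by []. Qed.

Lemma nrmi : nrm ('i%R : Cplx R) = 1.
Proof.
by rewrite imaginaryE /nrm normc_def /= expr0n add0r expr1n sqrtr1.
Qed.

Lemma imaginary_neq0 : ('i%R : Cplx R) != 0.
Proof. by rewrite -nrm_gt0 nrmi. Qed.

Lemma Re_le_nrm z : `|complex.Re z| <= nrm z.
Proof.
rewrite -(@ler_pXn2r _ 2) ?nnegrE ?nrm_ge0 // nrm_sqr.
by rewrite real_normK ?num_real // lerDl sqr_ge0.
Qed.

Lemma Im_le_nrm z : `|complex.Im z| <= nrm z.
Proof.
rewrite -(@ler_pXn2r _ 2) ?nnegrE ?nrm_ge0 // nrm_sqr.
by rewrite real_normK ?num_real // lerDr sqr_ge0.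
Qed.

Lemma nrm_le_ReIm z : nrm z <= `|complex.Re z| + `|complex.Im z|.
Proof.
rewrite -(@ler_pXn2r _ 2) ?nnegrE ?nrm_ge0 ?addr_ge0 // nrm_sqr.
rewrite sqrrD !real_normK ?num_real //.
by rewrite addrAC lerDl mulrn_wge0 // mulr_ge0.
Qed.

Lemma ReB z w : complex.Re (z - w) = complex.Re z - complex.Re w.
Proof. by case: z; case: w. Qed.
Lemma ImB z w : complex.Im (z - w) = complex.Im z - complex.Im w.
Proof. by case: z; case: w. Qed.
Lemma ReD z w : complex.Re (z + w) = complex.Re z + complex.Re w.
Proof. by case: z; case: w. Qed.
Lemma ImD z w : complex.Im (z + w) = complex.Im z + complex.Im w.
Proof. by case: z; case: w. Qed.
Lemma ReRM (t : R) z : complex.Re ((t%:C : Cplx R) * z) = t * complex.Re z.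
Proof. by case: z => a b /=; rewrite mul0r subr0. Qed.
Lemma ImRM (t : R) z : complex.Im ((t%:C : Cplx R) * z) = t * complex.Im z.
Proof. by case: z => a b /=; rewrite mul0r addr0. Qed.

Lemma gt0_real (e : R[i]) : 0 < e -> exists2 d : R, 0 < d & e = d%:C.
Proof.
case: e => a b; rewrite ltcE /= => /andP[/eqP -> h]; by exists a.
Qed.

End Modulus.

(** * Differentiability with explicit error terms *)

Section EpsDelta.
Context {K : numFieldType} {V W : normedModType K}.
(** Differentiability as an explicit bound of the remainder. *)
Lemma differentiable_eps (f : V -> W) x : differentiable f x ->
  forall e, 0 < e -> exists2 d, 0 < d & forall h, `|h| < d ->
    `|f (x + h) - f x - 'd f x h| <= e * `|h|.
Proof.
move=> df e e0; have /eqaddoP /(_ e e0) := diff_locally df.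
move=> /nbhs_normP [d /= d0 H]; exists d => // h hd.
have := H h; rewrite /= sub0r normrN => /(_ hd).
by rewrite !fctE /= opprD addrA [h + x]addrC.
Qed.

(** Converse: a continuous linear map with a small remainder is the
    differential. *)
Lemma eps_differentiable (f : V -> W) (L : {linear V -> W}) x : continuous L ->
  (forall e, 0 < e -> exists2 d, 0 < d & forall h, `|h| < d ->
    `|f (x + h) - f x - L h| <= e * `|h|) ->
  differentiable f x /\ 'd f x = L :> (V -> W).
Proof.
move=> cL H.
have E : f \o shift x = cst (f x) + L +o_ 0 id.
  apply/eqaddoP => e e0; have [d d0 Hd] := H e e0.
  apply/nbhs_normP; exists d => // h /=; rewrite sub0r normrN => hd.
  by have := Hd h hd; rewrite !fctE /= opprD addrA [x + h]addrC.
have dE := diff_unique cL E; split => //.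
by apply/diff_locallyP; rewrite dE.
Qed.
End EpsDelta.

(** * Curves in the complex plane and the mean value inequality *)

Section Curves.
Context {R : realType}.
Local Notation C := (Cplx R).
Local Notation RC t := (t%:C : C).

(** Continuity on the segment [[a, b]], relative to the segment. *)
Definition cont_on (f : R -> C) (a b : R) :=
  forall t, a <= t <= b -> forall e : R, 0 < e -> exists2 d : R, 0 < d &
    forall u, a <= u <= b -> `|u - t| < d -> nrm (f u - f t) <= e.

(** [f] is the derivative of [F] on [[a, b]], one-sided at the end points. *)
Definition der_on (F f : R -> C) (a b : R) :=
  forall t, a <= t <= b -> forall e : R, 0 < e -> exists2 d : R, 0 < d &
    forall u, a <= u <= b -> `|u - t| < d ->
      nrm (F u - F t - RC (u - t) * f t) <= e * `|u - t|.

Lemma halves_small (d : R) : 0 < d -> exists n, (2^-1) ^+ n < d.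
Proof.
move=> d0.
have : (fun n => (2^-1 : R) ^+ n) @ \oo --> (0 : R).
  by apply: cvg_expr; rewrite ger0_norm ?invf_lt1 ?ltr1n // invr_ge0.
move=> /cvgrPdist_lt /(_ d d0) [N _ /(_ N (leqnn N))] /=.
rewrite sub0r normrN ger0_norm; first by exists N.
by rewrite exprn_ge0 // invr_ge0.
Qed.

(** Compactness of a rectangle with sides [lx] and [ly], in the form of a
    bisection principle. [P x y k] speaks of the rectangle with corner
    [(x, y)] and sides [k lx], [k ly]. If [P] passes from the four quarters of
    a rectangle to the whole, and holds for all small rectangles around any
    given point, then it holds for the full rectangle. With [ly = 0] this is
    a principle for segments. *)
Lemma subdivision (P : R -> R -> R -> Prop) (x0 y0 lx ly : R) :
  0 <= lx -> 0 <= ly ->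
  (forall x y k : R, 0 < k -> x0 <= x -> x + k * lx <= x0 + lx ->
     y0 <= y -> y + k * ly <= y0 + ly ->
     P x y (k / 2) -> P (x + k / 2 * lx) y (k / 2) ->
     P x (y + k / 2 * ly) (k / 2) ->
     P (x + k / 2 * lx) (y + k / 2 * ly) (k / 2) -> P x y k) ->
  (forall x y, x0 <= x <= x0 + lx -> y0 <= y <= y0 + ly ->
     exists2 d : R, 0 < d & forall u v k : R, 0 < k -> k < d ->
       u <= x <= u + k * lx -> v <= y <= v + k * ly ->
       x0 <= u -> u + k * lx <= x0 + lx ->
       y0 <= v -> v + k * ly <= y0 + ly -> P u v k) ->
  P x0 y0 1.
Proof.
move=> lx0 ly0 Hs Hl; apply: contrapT => nP.
(* Otherwise nested rectangles of sides [2^-n lx], [2^-n ly] on which [P]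
   fails shrink to a point. *)
pose kk n : R := (2^-1) ^+ n.
have kk0 n : 0 < kk n by rewrite exprn_gt0 // invr_gt0.
have kkS n : kk n.+1 = kk n / 2 by rewrite /kk exprSr.
pose good n (p : R * R) := [/\ x0 <= p.1, p.1 + kk n * lx <= x0 + lx,
  y0 <= p.2, p.2 + kk n * ly <= y0 + ly & ~ P p.1 p.2 (kk n)].
pose near n (p q : R * R) := [/\ p.1 <= q.1, q.1 + kk n.+1 * lx <= p.1 + kk n * lx,
  p.2 <= q.2 & q.2 + kk n.+1 * ly <= p.2 + kk n * ly].
have step n p : good n p -> exists q, good n.+1 q /\ near n p q.
  case: p => x y [/= h1 h2 h3 h4 hP].
  have kl : 0 <= kk n / 2 * lx by rewrite mulr_ge0 // divr_ge0 // ltW.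
  have km : 0 <= kk n / 2 * ly by rewrite mulr_ge0 // divr_ge0 // ltW.
  have e1 : kk n * lx = kk n / 2 * lx + kk n / 2 * lx by field.
  have e2 : kk n * ly = kk n / 2 * ly + kk n / 2 * ly by field.
  apply: contrapT => nq; apply: hP; apply: Hs => //.
  - apply: contrapT => h; apply: nq; exists (x, y); rewrite /good /near /= !kkS.
    by split; split=> //; lra.
  - apply: contrapT => h; apply: nq; exists (x + kk n / 2 * lx, y).
    by rewrite /good /near /= !kkS; split; split=> //; lra.
  - apply: contrapT => h; apply: nq; exists (x, y + kk n / 2 * ly).
    by rewrite /good /near /= !kkS; split; split=> //; lra.
  - apply: contrapT => h; apply: nq.
    exists (x + kk n / 2 * lx, y + kk n / 2 * ly).
    by rewrite /good /near /= !kkS; split; split=> //; lra.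
have /choice [nxt nxtP] : forall np : nat * (R * R), exists q,
    good np.1 np.2 -> good np.1.+1 q /\ near np.1 np.2 q.
  case=> n p; have [/step [q hq]|h] := pselect (good n p).
    by exists q.
  by exists p.
pose s := fix s n := if n is m.+1 then nxt (m, s m) else (x0, y0).
have gs n : good n (s n).
  elim: n => [|n IH]; first by rewrite /good /= /kk expr0 !mul1r.
  by have [] := nxtP (n, s n) IH.
have ns n : near n (s n) (s n.+1) by have [] := nxtP (n, s n) (gs n).
have up n m : (s n).1 <= (s (n + m)%N).1 /\
   (s (n + m)%N).1 + kk (n + m)%N * lx <= (s n).1 + kk n * lx.
  elim: m => [|m [IH1 IH2]]; first by rewrite addn0.
  have [h1 h2 _ _] := ns (n + m)%N; rewrite addnS; split.
    exact: le_trans IH1 h1.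
  exact: le_trans h2 IH2.
have vp n m : (s n).2 <= (s (n + m)%N).2 /\
   (s (n + m)%N).2 + kk (n + m)%N * ly <= (s n).2 + kk n * ly.
  elim: m => [|m [IH1 IH2]]; first by rewrite addn0.
  have [_ _ h1 h2] := ns (n + m)%N; rewrite addnS; split.
    exact: le_trans IH1 h1.
  exact: le_trans h2 IH2.
have [x hx] : exists x, forall n, (s n).1 <= x <= (s n).1 + kk n * lx.
  have ub n m : (s m).1 <= (s n).1 + kk n * lx.
    have [_ h] := up n m; have [h' _] := up m n; rewrite addnC in h'.
    apply: le_trans h' (le_trans _ h); rewrite lerDl mulr_ge0 // ltW //.
  exists (sup (range (fun n => (s n).1))) => n; apply/andP; split.
    apply: ub_le_sup; last by exists n.
    by exists ((s 0%N).1 + kk 0%N * lx) => _ [m _ <-].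
  apply: ge_sup; first by exists (s 0%N).1; exists 0%N.
  by move=> _ [m _ <-].
have [y hy] : exists y, forall n, (s n).2 <= y <= (s n).2 + kk n * ly.
  have ub n m : (s m).2 <= (s n).2 + kk n * ly.
    have [_ h] := vp n m; have [h' _] := vp m n; rewrite addnC in h'.
    apply: le_trans h' (le_trans _ h); rewrite lerDl mulr_ge0 // ltW //.
  exists (sup (range (fun n => (s n).2))) => n; apply/andP; split.
    apply: ub_le_sup; last by exists n.
    by exists ((s 0%N).2 + kk 0%N * ly) => _ [m _ <-].
  apply: ge_sup; first by exists (s 0%N).2; exists 0%N.
  by move=> _ [m _ <-].
have := hx 0%N; have := hy 0%N; rewrite /kk expr0 !mul1r /= => hy0 hx0.
have [d d0 Hd] := Hl x y hx0 hy0.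
have [n hn] := halves_small d0.
by have [h1 h2 h3 h4 h5] := gs n; apply: h5; apply: Hd => //; apply: kk0.
Qed.

Lemma der_onD (F f G g : R -> C) a b : der_on F f a b -> der_on G g a b ->
  der_on (fun t => F t + G t) (fun t => f t + g t) a b.
Proof.
move=> dF dG t tab e e0.
have e20 : 0 < e / 2 by rewrite divr_gt0.
have [d1 d10 H1] := dF t tab _ e20; have [d2 d20 H2] := dG t tab _ e20.
exists (Num.min d1 d2); first by rewrite lt_min d10.
move=> u uab; rewrite lt_min => /andP[u1 u2].
have := lerD (H1 u uab u1) (H2 u uab u2); rewrite -mulrDl -splitr.
apply: le_trans; apply: le_trans (nrmD _ _); rewrite le_eqVlt; apply/orP; left.
by apply/eqP; congr nrm; ring.
Qed.

Lemma der_onZ (F f : R -> C) (c : C) a b : der_on F f a b ->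
  der_on (fun t => c * F t) (fun t => c * f t) a b.
Proof.
move=> dF t tab e e0.
have e20 : 0 < e / (nrm c + 1) by rewrite divr_gt0 // ltr_wpDl // nrm_ge0.
have [d1 d10 H1] := dF t tab _ e20.
exists d1 => // u uab u1.
have -> : c * F u - c * F t - RC (u - t) * (c * f t) =
  c * (F u - F t - RC (u - t) * f t) by ring.
rewrite nrmM; apply: (le_trans (ler_wpM2l (nrm_ge0 _) (H1 u uab u1))).
rewrite mulrA ler_wpM2r // mulrCA -[leRHS]mulr1 ler_wpM2l // ?(ltW e0) //.
by rewrite ler_pdivrMr ?mul1r ?lerDl // ltr_wpDl // nrm_ge0.
Qed.

Lemma der_on_sub F f a b a' b' : a <= a' -> b' <= b -> der_on F f a b ->
  der_on F f a' b'.
Proof.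
move=> aa bb dF t /andP[h1 h2] e e0.
have [|d d0 H] := dF t _ e e0; first by rewrite (le_trans aa h1) (le_trans h2 bb).
exists d => // u /andP[h3 h4]; apply: H.
by rewrite (le_trans aa h3) (le_trans h4 bb).
Qed.

Lemma eq_der_on F f g a b : (forall t, a <= t <= b -> f t = g t) ->
  der_on F f a b -> der_on F g a b.
Proof. by move=> fg dF t tab; rewrite -fg //; apply: dF. Qed.

(** A function whose derivative has nonnegative real part has a nondecreasing
    real part; no continuity of the derivative is needed. *)
Lemma der_on_Re_ge0 (F f : R -> C) a b : a <= b -> der_on F f a b ->
  (forall t, a <= t <= b -> 0 <= complex.Re (f t)) ->
  complex.Re (F a) <= complex.Re (F b).
Proof.
move=> ab dF f0.
(* Allow a loss of [e] per unit of length; this is inherited by bisection. *)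
suff main (e : R) : 0 < e -> - (e * (b - a)) <= complex.Re (F b) - complex.Re (F a).
  rewrite -subr_ge0; have [->|ba] := eqVneq b a; first by rewrite subrr.
  have ba0 : 0 < b - a by rewrite subr_gt0 lt_neqAle eq_sym ba ab.
  apply/ler_addgt0Pr => e e0.
  have := main (e / (b - a)) (divr_gt0 e0 ba0).
  by rewrite divfK ?gt_eqF // => h; lra.
move=> e0.
pose P (x y k : R) :=
  - (e * (k * (b - a))) <= complex.Re (F (x + k * (b - a))) - complex.Re (F x).
have := @subdivision P a 0 (b - a) 0; rewrite /P mul1r subrKC; apply => //.
- by rewrite subr_ge0.
- move=> x y k k0 _ _ _ _ h1 h2 _ _.
  have -> : x + k * (b - a) = x + k / 2 * (b - a) + k / 2 * (b - a) by field.
  have -> : - (e * (k * (b - a))) = - (e * (k / 2 * (b - a))) +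
      - (e * (k / 2 * (b - a))) by field.
  by have := lerD h2 h1; rewrite addrA subrK.
- move=> x y xab _.
  have [d d0 Hd] := dF x xab e e0.
  exists (d / (b - a + 1)); first by rewrite divr_gt0 // ltr_wpDl // subr_ge0.
  move=> u v k k0; rewrite ltr_pdivlMr; last by rewrite ltr_wpDl // subr_ge0.
  move=> kd /andP[ux xv] _ au vb _ _.
  have kba : k * (b - a) < d.
    by apply: le_lt_trans kd; rewrite ler_wpM2l ?lerDl // ltW.
  set v' := u + _ in xv vb *.
  have h1 := Hd u; have h2 := Hd v'.
  have {}h1 : nrm (F u - F x - RC (u - x) * f x) <= e * `|u - x|.
    apply: h1; first by rewrite au (le_trans ux (le_trans xv vb)).
    rewrite distrC ger0_norm ?subr_ge0 //; apply: le_lt_trans kba.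
    by rewrite lerBlDl.
  have {}h2 : nrm (F v' - F x - RC (v' - x) * f x) <= e * `|v' - x|.
    apply: h2; first by rewrite vb (le_trans au (le_trans ux xv)).
    rewrite ger0_norm ?subr_ge0 //; apply: le_lt_trans kba.
    by rewrite lerBlDl /v' lerD2r.
  have hfx : 0 <= complex.Re (f x).
    by apply: f0; rewrite (le_trans au ux) (le_trans xv vb).
  have {}h1 := le_trans (ler_norm _) (le_trans (Re_le_nrm _) h1).
  have {}h2 := lerNnormlW (le_trans (Re_le_nrm _) h2).
  move: h1 h2; rewrite !ReB !ReRM.
  rewrite -(_ : v' - u = k * (b - a)); last by rewrite /v'; ring.
  have huv : 0 <= (v' - u) * complex.Re (f x).
    by rewrite mulr_ge0 // subr_ge0 (le_trans ux).
  have -> : `|u - x| = x - u by rewrite distrC ger0_norm ?subr_ge0.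
  have -> : `|v' - x| = v' - x by rewrite ger0_norm ?subr_ge0.
  move: huv; rewrite !mulrBl !mulrBr; lra.
Qed.

Lemma der_on_lin (z w : C) a b : der_on (fun t => z + RC t * w) (fun=> w) a b.
Proof.
move=> t _ e e0; exists 1 => // u _ _.
have -> : z + RC u * w - (z + RC t * w) - RC (u - t) * w = 0.
  by rewrite rmorphB /=; ring.
by rewrite nrm0 mulr_ge0 // ltW.
Qed.

Lemma polar (w : C) : exists2 p : C, nrm p = 1 & w = RC (nrm w) * p.
Proof.
have [->|w0] := eqVneq w 0; first by exists 1; rewrite ?nrm1 // nrm0 mul0r.
have n0 : nrm w != 0 by rewrite gt_eqF // nrm_gt0.
have rn0 : RC (nrm w) != 0 by rewrite -nrm_gt0 nrmR normr_gt0.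
exists (w / RC (nrm w)); last by rewrite mulrC divfK.
by rewrite nrmM nrmV nrmR ger0_norm ?nrm_ge0 // divff.
Qed.

(** The mean value inequality. *)
Lemma der_on_bound (F f : R -> C) a b M : a <= b -> der_on F f a b ->
  (forall t, a <= t <= b -> nrm (f t) <= M) -> nrm (F b - F a) <= M * (b - a).
Proof.
(* Rotate so that the increment is real and apply monotonicity to
   [M t - Re (F t / p)]. *)
move=> ab dF fM; have [p p1 pE] := polar (F b - F a).
have pn0 : p != 0 by rewrite -nrm_gt0 p1.
have dG := der_onD (@der_on_lin 0 (RC M) a b) (der_onZ (- p^-1) dF).
have := der_on_Re_ge0 ab dG; rewrite !add0r !ReD !ReRM /= => H.
suff -> : nrm (F b - F a) = complex.Re (- p^-1 * F a) - complex.Re (- p^-1 * F b).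
  rewrite -(mulrC (b - a)) mulrBl.
  suff : a * M + complex.Re (- p^-1 * F a) <= b * M + complex.Re (- p^-1 * F b) by lra.
  apply: H => t /fM ft; rewrite ReD /= -lerBlDl sub0r.
  apply: lerNnormlW; apply: le_trans (Re_le_nrm _) _.
  by rewrite nrmM nrmN nrmV p1 invr1 mul1r.
rewrite -ReB -mulrBr mulNr -mulrN opprB pE mulrCA mulVf // mulr1.
by rewrite nrmM nrmR p1 mulr1 ger0_norm // nrm_ge0.
Qed.

Lemma der_on_const (F f : R -> C) a b : a <= b -> der_on F f a b ->
  (forall t, a <= t <= b -> f t = 0) -> F b = F a.
Proof.
move=> ab dF f0; apply/eqP; rewrite -subr_eq0; apply/eqP/nrm0_eq0/eqP.
rewrite eq_le nrm_ge0 andbT -(mul0r (b - a)).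
by apply: der_on_bound dF _ => // t /f0 ->; rewrite nrm0.
Qed.

End Curves.

(** * Integrals of complex-valued functions of a real variable *)

Section Integral.
Context {R : realType}.
Local Notation C := (Cplx R).
Local Notation RC t := (t%:C : C).

Implicit Types (f g F G : R -> C) (a b : R).

(** A continuous real function has a primitive on every half-line. *)
Lemma real_primitive (f : R -> R) (a : R) : continuous f ->
  exists F : R -> R, forall t, a < t -> forall e : R, 0 < e ->
    exists2 d : R, 0 < d & forall u, `|u - t| < d ->
      `|F u - F t - (u - t) * f t| <= e * `|u - t|.
Proof.
move=> cf; pose mu := @lebesgue_measure R.
exists (fun x => \int[mu]_(t in `[a, x]) f t) => t at_ e e0.
(* Integrate up to [t + 1], so that [t] is an interior point. *)
have [] := @continuous_FTC1_closed R f a t (t + 1) _ _ at_ (cf t).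
- by rewrite ltrDl.
- apply: continuous_compact_integrable; first exact: segment_compact.
  exact: continuous_subspaceT.
move=> /derivable1_diffP dF dE.
have [d d0 H] := differentiable_eps dF e0.
exists d => // u /H; rewrite diff1E // dE subrKC; exact.
Qed.

(** The retraction of the real line onto [[a, b]]. *)
Definition clamp (a b t : R) : R := Num.max a (Num.min t b).

Lemma clamp_in a b t : a <= b -> a <= clamp a b t <= b.
Proof. by move=> ab; rewrite /clamp le_max lexx ge_max ab ge_min lexx orbT. Qed.

Lemma clamp_id a b t : a <= t <= b -> clamp a b t = t.
Proof. by move=> /andP[h1 h2]; rewrite /clamp min_l // max_r. Qed.

Lemma clamp_dist a b u t : a <= b -> `|clamp a b u - clamp a b t| <= `|u - t|.
Proof.
move=> ab; rewrite /clamp.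
have := ler_norm (u - t); have := lerNnormlW (lexx `|u - t|).
case: (leP u b) => h1; case: (leP t b) => h2;
case: (leP a u) => h3; case: (leP a t) => h4; case: (leP a b) => h6;
rewrite ler_norml => h7 h8; lra.
Qed.

Lemma primitive_exists (f : R -> C) a b : a <= b -> cont_on f a b ->
  exists F, der_on F f a b.
Proof.
move=> ab cf.
have key (p : C -> R) : (forall z w, `|p z - p w| <= nrm (z - w)) ->
    continuous (fun t => p (f (clamp a b t))).
  move=> hp t; apply/cvgrPdist_le => e e0.
  have [d d0 H] := cf _ (clamp_in t ab) e e0.
  apply/nbhs_normP; exists d => // u /= ud.
  apply: le_trans (hp _ _) _; rewrite nrmBC; apply: H; first exact: clamp_in.
  by apply: le_lt_trans (clamp_dist _ _ ab) _; rewrite distrC.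
have hRe (z w : C) : `|complex.Re z - complex.Re w| <= nrm (z - w).
  by rewrite -ReB Re_le_nrm.
have hIm (z w : C) : `|complex.Im z - complex.Im w| <= nrm (z - w).
  by rewrite -ImB Im_le_nrm.
(* Extend [f] by constants outside [[a, b]] and start the primitive at
   [a - 1], so that both end points are interior. *)
have [F1 H1] := @real_primitive (fun t => complex.Re (f (clamp a b t))) (a - 1)
  (key _ hRe).
have [F2 H2] := @real_primitive (fun t => complex.Im (f (clamp a b t))) (a - 1)
  (key _ hIm).
exists (fun t => F1 t +i* F2 t) => t tab e e0.
have at1 : a - 1 < t by case/andP: tab => h _; rewrite ltrBlDr ltr_pwDr.
have e20 : 0 < e / 2 by rewrite divr_gt0.
have [d1 d10 {}H1] := H1 t at1 _ e20; have [d2 d20 {}H2] := H2 t at1 _ e20.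
exists (Num.min d1 d2); first by rewrite lt_min d10.
move=> u _; rewrite lt_min => /andP[/H1 u1 /H2 u2].
apply: le_trans (nrm_le_ReIm _) _.
have -> : e * `|u - t| = e / 2 * `|u - t| + e / 2 * `|u - t| by field.
rewrite !ReB !ImB ReRM ImRM /=.
by rewrite clamp_id // in u1, u2; apply: lerD.
Qed.

(** The integral of [f] over [[a, b]], defined as the increment of any
    primitive, and 0 when there is none. Continuous functions have primitives
    ([primitive_exists]), so all rules reduce to rules for derivatives. *)
Definition intg (f : R -> C) (a b : R) : C :=
  xget 0 [set I | exists2 F, der_on F f a b & I = F b - F a].

Lemma intgE F f a b : a <= b -> der_on F f a b -> intg f a b = F b - F a.
Proof.
move=> ab dF; rewrite /intg; case: xgetP => [_ -> [G dG ->]|h]; last first.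
  by exfalso; apply: (h (F b - F a)); exists F.
have := @der_on_const R (fun t => F t + -1 * G t) _ a b ab
   (der_onD dF (der_onZ (-1) dG)).
rewrite !mulN1r => h; have {}h : F b - G b = F a - G a.
  by apply: h => t _; rewrite mulN1r subrr.
have -> : G b - G a = F b - F a - (F b - G b) + (F a - G a) by ring.
by rewrite h subrK.
Qed.

Lemma intg_bound f a b M : a <= b -> cont_on f a b ->
  (forall t, a <= t <= b -> nrm (f t) <= M) -> nrm (intg f a b) <= M * (b - a).
Proof.
by move=> ab /(primitive_exists ab)[F dF] h; rewrite (intgE ab dF); apply: der_on_bound dF h.
Qed.

Lemma intgD f g a b : a <= b -> cont_on f a b -> cont_on g a b ->
  intg (fun t => f t + g t) a b = intg f a b + intg g a b.
Proof.
move=> ab /(primitive_exists ab)[F dF] /(primitive_exists ab)[G dG].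
rewrite (intgE ab dF) (intgE ab dG) (intgE ab (der_onD dF dG)); ring.
Qed.

Lemma intgZ c f a b : a <= b -> cont_on f a b ->
  intg (fun t => c * f t) a b = c * intg f a b.
Proof.
move=> ab /(primitive_exists ab)[F dF].
rewrite (intgE ab dF) (intgE ab (der_onZ c dF)); ring.
Qed.

Lemma intg_split f a c b : a <= c -> c <= b -> cont_on f a b ->
  intg f a b = intg f a c + intg f c b.
Proof.
move=> ac cb cf; have ab := le_trans ac cb.
have [F dF] := primitive_exists ab cf.
rewrite (intgE ab dF) (intgE ac (der_on_sub (lexx _) cb dF)).
rewrite (intgE cb (der_on_sub ac (lexx _) dF)); ring.
Qed.

Lemma eq_intg f g a b : a <= b -> (forall t, a <= t <= b -> f t = g t) ->
  intg f a b = intg g a b.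
Proof.
move=> ab fg; have [[F dF]|h] := pselect (exists F, der_on F f a b).
  by rewrite (intgE ab dF) (intgE ab (eq_der_on fg dF)).
rewrite /intg; case: xgetP => [I _ [F dF _]|_]; first by case: h; exists F.
case: xgetP => [I _ [F dF _]|_ //]; case: h; exists F.
by apply: eq_der_on dF => t tab; rewrite fg.
Qed.

Lemma intg_cst (c : C) a b : a <= b -> intg (fun=> c) a b = RC (b - a) * c.
Proof.
by move=> ab; rewrite (intgE ab (@der_on_lin R 0 c a b)) rmorphB /=; ring.
Qed.

Lemma cont_on_cst (c : C) a b : cont_on (fun=> c) a b.
Proof. by move=> t _ e e0; exists 1 => // u _ _; rewrite subrr nrm0 ltW. Qed.

Lemma cont_onD f g a b : cont_on f a b -> cont_on g a b ->
  cont_on (fun t => f t + g t) a b.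
Proof.
move=> dF dG t tab e e0.
have e20 : 0 < e / 2 by rewrite divr_gt0.
have [d1 d10 H1] := dF t tab _ e20; have [d2 d20 H2] := dG t tab _ e20.
exists (Num.min d1 d2); first by rewrite lt_min d10.
move=> u uab; rewrite lt_min => /andP[u1 u2].
have := lerD (H1 u uab u1) (H2 u uab u2); rewrite -splitr.
apply: le_trans; apply: le_trans (nrmD _ _); rewrite le_eqVlt; apply/orP; left.
by apply/eqP; congr nrm; ring.
Qed.

Lemma cont_onM f g a b : cont_on f a b -> cont_on g a b ->
  cont_on (fun t => f t * g t) a b.
Proof.
move=> dF dG t tab e e0.
set A := nrm (f t) + 1; set B := nrm (g t) + 1.
have A0 : 0 < A by rewrite ltr_wpDl // nrm_ge0.
have B0 : 0 < B by rewrite ltr_wpDl // nrm_ge0.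
have e20 : 0 < Num.min 1 (e / (A + B)) by rewrite lt_min ltr01 divr_gt0 // addr_gt0.
have [d1 d10 H1] := dF t tab _ e20; have [d2 d20 H2] := dG t tab _ e20.
exists (Num.min d1 d2); first by rewrite lt_min d10.
move=> u uab; rewrite lt_min => /andP[u1 u2].
have {H1}:= H1 u uab u1; have {H2}:= H2 u uab u2.
rewrite !le_min => /andP[g1 g2] /andP[f1 f2].
have -> : f u * g u - f t * g t = (f u - f t) * g u + f t * (g u - g t) by ring.
have gB : nrm (g u) <= B.
  have -> : g u = (g u - g t) + g t by ring.
  by apply: le_trans (nrmD _ _) _; rewrite /B addrC lerD2l.
apply: le_trans (nrmD _ _) _; rewrite !nrmM.
have -> : e = (e / (A + B)) * B + A * (e / (A + B)).
  by field; rewrite gt_eqF // addr_gt0.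
by apply: lerD; apply: ler_pM => //; rewrite ?nrm_ge0 // /A lerDl.
Qed.

Lemma cont_onZ (c : C) f a b : cont_on f a b -> cont_on (fun t => c * f t) a b.
Proof. by move=> cf; apply: cont_onM cf; apply: cont_on_cst. Qed.

Lemma der_on_cont F f a b : der_on F f a b -> cont_on F a b.
Proof.
move=> dF t tab e e0; have [d d0 H] := dF t tab 1 ltr01.
have A0 : 0 < 1 + nrm (f t) by rewrite ltr_pwDl // nrm_ge0.
exists (Num.min d (e / (1 + nrm (f t)))); first by rewrite lt_min d0 divr_gt0.
move=> u uab; rewrite lt_min => /andP[/(H u uab) h]; rewrite ltr_pdivlMr // => h2.
have -> : F u - F t = (F u - F t - RC (u - t) * f t) + RC (u - t) * f t by ring.
apply: le_trans (nrmD _ _) _; apply: le_trans (ltW h2).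
by rewrite mulrDr nrmM nrmR mulr1 lerD2r; rewrite mul1r in h.
Qed.
End Integral.

(** * Complex derivatives *)

Section ComplexDerivative.
Context {R : realType}.
Local Notation C := (Cplx R).
Local Notation RC t := (t%:C : C).

(** Continuity at a point, in terms of the real-valued modulus. *)
Definition contc {V : normedModType R[i]} (f : V -> C) (z : V) :=
  forall e : R, 0 < e -> exists2 d : R, 0 < d & forall h, nrm h < d ->
    nrm (f (z + h) - f z) <= e.

(** [f] has the complex derivative [l] at [z]. *)
Definition hasd (f : C -> C) (z l : C) :=
  forall e : R, 0 < e -> exists2 d : R, 0 < d & forall h, nrm h < d ->
    nrm (f (z + h) - f z - h * l) <= e * nrm h.

Lemma contcP {V : normedModType R[i]} (f : V -> C) z :
  contc f z <-> {for z, continuous f}.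
Proof.
split=> [cf|cf e e0].
  apply/cvgrPdist_le => _ /gt0_real[e e0 ->].
  have [d d0 H] := cf e e0; apply/nbhs_normP; exists d%:C; rewrite /= ?ltcR //.
  move=> w /=; rewrite nrm_lt nrm_le nrmBC => /H; rewrite nrmBC.
  by rewrite subrKC.
have : (0 : R[i]) < e%:C by rewrite ltcR.
move=> /(proj1 (cvgrPdist_le _ _) cf) /nbhs_normP[_ /= /gt0_real[d d0 ->] H].
exists d => // h hd; have := H (z + h).
by rewrite /= nrm_lt nrm_le opprD addNKr nrmN nrmBC; apply.
Qed.

Lemma hasd_contc f z l : hasd f z l -> contc f z.
Proof.
move=> H e e0; have [d d0 {}H] := H 1 ltr01.
have A0 : 0 < 1 + nrm l by rewrite ltr_pwDl // nrm_ge0.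
exists (Num.min d (e / (1 + nrm l))); first by rewrite lt_min d0 divr_gt0.
move=> h; rewrite lt_min => /andP[/H {}H]; rewrite ltr_pdivlMr // => h2.
have -> : f (z + h) - f z = (f (z + h) - f z - h * l) + h * l by ring.
apply: le_trans (nrmD _ _) _; apply: le_trans (ltW h2).
by rewrite mulrDr nrmM mulr1 lerD2r; rewrite mul1r in H.
Qed.

Lemma hasd_differentiable f z l : hasd f z l ->
  differentiable f z /\ 'D_1 f z = l.
Proof.
move=> H.
pose L (h : C) : C := h *: l.
have linL : linear L by move=> a x y; rewrite /L scalerDl scalerA.
pose LM := GRing.isLinear.Build _ _ _ _ _ linL.
pose LL : {linear C -> C} := HB.pack L LM.
have [df dE] : differentiable f z /\ 'd f z = LL :> (C -> C).
  apply: eps_differentiable; first exact: scalel_continuous.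
  move=> _ /gt0_real[e e0 ->]; have [d d0 {}H] := H e e0.
  exists d%:C; first by rewrite ltcR.
  by move=> h; rewrite nrm_lt => /H h1; rewrite !nrmE -rmorphM /= lecR.
by split => //; rewrite deriveE // dE /= /L scale1r.
Qed.

Lemma differentiable_hasd f z : differentiable f z -> hasd f z ('D_1 f z).
Proof.
move=> df e e0.
have [|_ /gt0_real[d d0 ->] H] := differentiable_eps df (_ : 0 < e%:C).
  by rewrite ltcR.
exists d => // h; rewrite -nrm_lt => /H.
by rewrite diff1E // derive1E !nrmE -rmorphM /= lecR.
Qed.

Lemma hasd_unique f z l l' : hasd f z l -> hasd f z l' -> l = l'.
Proof. by move=> /hasd_differentiable[_ <-] /hasd_differentiable[_ <-]. Qed.

Lemma hasd_cst (c z : C) : hasd (fun=> c) z 0.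
Proof.
move=> e e0; exists 1 => // h _.
by rewrite subrr sub0r mulr0 oppr0 nrm0 mulr_ge0 ?nrm_ge0 // ltW.
Qed.

Lemma hasd_id (z : C) : hasd id z 1.
Proof.
move=> e e0; exists 1 => // h _ /=.
have -> : z + h - z - h * 1 = 0 by ring.
by rewrite nrm0 mulr_ge0 ?nrm_ge0 // ltW.
Qed.

Lemma hasdE f z l : hasd f z l <-> is_derive z 1 f l.
Proof.
split=> [/hasd_differentiable[df <-]|[df <-]].
  by split => //; apply: diff_derivable.
by apply: differentiable_hasd; apply/derivable1_diffP.
Qed.

Lemma hasdD f g z l m : hasd f z l -> hasd g z m ->
  hasd (fun x => f x + g x) z (l + m).
Proof. by move=> /hasdE h1 /hasdE h2; apply/hasdE; apply: is_deriveD. Qed.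

Lemma hasdM f g z l m : hasd f z l -> hasd g z m ->
  hasd (fun x => f x * g x) z (l * g z + f z * m).
Proof.
move=> /hasdE h1 /hasdE h2; apply/hasdE.
apply: (@is_derive_eq _ _ _ _ _ _ _ (f z *: m + g z *: l)).
rewrite addrC; congr (_ + _); exact: mulrC.
Qed.

Lemma hasdZ (c : C) f z l : hasd f z l -> hasd (fun x => c * f x) z (c * l).
Proof.
move=> h; have := hasdM (hasd_cst c z) h.
by rewrite mul0r add0r.
Qed.

Lemma hasd_comp f g z l m : hasd f z l -> hasd g (f z) m ->
  hasd (fun x => g (f x)) z (l * m).
Proof.
move=> hf hg e e0; set A := 1 + nrm l; set B := 1 + nrm m.
have A0 : 0 < A by rewrite ltr_pwDl // nrm_ge0.
have B0 : 0 < B by rewrite ltr_pwDl // nrm_ge0.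
have eA0 : 0 < e / (2 * A) by rewrite divr_gt0 // mulr_gt0.
have eB0 : 0 < e / (2 * B) by rewrite divr_gt0 // mulr_gt0.
have [d1 d10 H1] := hg _ eA0; have [d2 d20 H2] := hf _ eB0.
have [d3 d30 H3] := hf 1 ltr01.
exists (Num.min (d1 / A) (Num.min d2 d3)).
  by rewrite !lt_min d20 d30 divr_gt0.
move=> h; rewrite !lt_min => /andP[hd1 /andP[/H2 hd2 /H3 hd3]].
set k := f (z + h) - f z in hd2 hd3.
have kA : nrm k <= nrm h * A.
  have -> : k = (k - h * l) + h * l by ring.
  by apply: le_trans (nrmD _ _) _; rewrite mulrDr mulr1 nrmM lerD2r; rewrite mul1r in hd3.
have : nrm k < d1 by apply: le_lt_trans kA _; rewrite -ltr_pdivlMr.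
move=> /H1; rewrite /k subrKC -/k => hk.
have -> : g (f (z + h)) - g (f z) - h * (l * m) =
  (g (f (z + h)) - g (f z) - k * m) + (k - h * l) * m by ring.
apply: le_trans (nrmD _ _) _; rewrite nrmM.
have -> : e * nrm h = e / (2 * A) * (nrm h * A) + (e / (2 * B) * nrm h) * B.
  by field; rewrite !gt_eqF.
apply: lerD; first by apply: le_trans hk _; rewrite ler_wpM2l // ltW.
by apply: ler_pM; rewrite ?nrm_ge0 // /B lerDr.
Qed.

Lemma hasdV f z l : f z != 0 -> hasd f z l ->
  hasd (fun x => (f x)^-1) z (- l / f z ^+ 2).
Proof.
move=> h0 /hasdE h1; apply/hasdE; split.
  by apply: derivableV.
rewrite deriveV // (@derive_val _ _ _ _ _ _ _ h1).
by rewrite mulNr mulrC; exact: scaleNr.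
Qed.

Lemma eq_hasd f g z l (d : R) : 0 < d -> (forall h, nrm h < d -> f (z + h) = g (z + h)) ->
  hasd f z l -> hasd g z l.
Proof.
move=> d0 fg hf e /hf[d' d'0 H]; exists (Num.min d d'); first by rewrite lt_min d0.
move=> h; rewrite lt_min => /andP[h1 /H].
have fgz : f z = g z by have := fg 0; rewrite nrm0 addr0; apply.
by rewrite -fg // -fgz.
Qed.

Lemma cont_on_comp (phi : C -> C) gam a b : cont_on gam a b ->
  (forall t, a <= t <= b -> contc phi (gam t)) ->
  cont_on (fun t => phi (gam t)) a b.
Proof.
move=> cg cphi t tab e /(cphi t tab)[d d0 H].
have [d' d'0 H'] := cg t tab (d / 2) (divr_gt0 d0 (ltr0Sn _ _)).
exists d' => // u uab /(H' u uab) h; have := H (gam u - gam t).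
rewrite subrKC; apply; apply: le_lt_trans h _; lra.
Qed.

Lemma der_on_comp (P : C -> C) p gam gam' a b : der_on gam gam' a b ->
  (forall t, a <= t <= b -> hasd P (gam t) (p t)) ->
  der_on (fun t => P (gam t)) (fun t => p t * gam' t) a b.
Proof.
move=> hf hg t tab e e0; set l := gam' t; set m := p t; set A := 1 + nrm l; set B := 1 + nrm m.
have A0 : 0 < A by rewrite ltr_pwDl // nrm_ge0.
have B0 : 0 < B by rewrite ltr_pwDl // nrm_ge0.
have eA0 : 0 < e / (2 * A) by rewrite divr_gt0 // mulr_gt0.
have eB0 : 0 < e / (2 * B) by rewrite divr_gt0 // mulr_gt0.
have [d1 d10 H1] := hg t tab _ eA0; have [d2 d20 H2] := hf t tab _ eB0.
have [d3 d30 H3] := hf t tab 1 ltr01.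
exists (Num.min (d1 / A) (Num.min d2 d3)).
  by rewrite !lt_min d20 d30 divr_gt0.
move=> u uab; rewrite !lt_min => /andP[hd1 /andP[/(H2 u uab) hd2 /(H3 u uab) hd3]].
set k := gam u - gam t in hd2 hd3.
have kA : nrm k <= `|u - t| * A.
  have -> : k = (k - RC (u - t) * l) + RC (u - t) * l by ring.
  by apply: le_trans (nrmD _ _) _; rewrite mulrDr mulr1 nrmM nrmR lerD2r; rewrite mul1r in hd3.
have : nrm k < d1 by apply: le_lt_trans kA _; rewrite -ltr_pdivlMr.
move=> /H1; rewrite /k subrKC -/k => hk.
have -> : P (gam u) - P (gam t) - RC (u - t) * (m * l) =
  (P (gam u) - P (gam t) - k * m) + (k - RC (u - t) * l) * m by ring.
apply: le_trans (nrmD _ _) _; rewrite nrmM.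
have -> : e * `|u - t| = e / (2 * A) * (`|u - t| * A) + (e / (2 * B) * `|u - t|) * B.
  by field; rewrite !gt_eqF.
apply: lerD; first by apply: le_trans hk _; rewrite ler_wpM2l // ltW.
by apply: ler_pM; rewrite ?nrm_ge0 // /B lerDr.
Qed.

End ComplexDerivative.

(** * The complex exponential *)

Section ComplexExp.
Context {R : realType}.
Local Notation C := (Cplx R).
Local Notation RC t := (t%:C : C).

(** The complex exponential. *)
Definition cexp (z : C) : C :=
  RC (expR (complex.Re z)) * (cos (complex.Im z) +i* sin (complex.Im z)).

Lemma cexpD z w : cexp (z + w) = cexp z * cexp w.
Proof.
rewrite /cexp ReD ImD expRD cosD sinD rmorphM /=.
apply/eqP; rewrite eq_complex /=; apply/andP; split; apply/eqP; ring.
Qed.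

Lemma cexp0 : cexp 0 = 1.
Proof. by rewrite /cexp /= expR0 cos0 sin0 mul1r. Qed.

Lemma cexpN_mul z : cexp (- z) * cexp z = 1.
Proof. by rewrite -cexpD addNr cexp0. Qed.

Lemma cexp_neq0 z : cexp z != 0.
Proof.
apply/eqP => h; have := cexpN_mul z; rewrite h mulr0 => /esym/eqP.
by rewrite oner_eq0.
Qed.

Lemma cexpN z : cexp (- z) = (cexp z)^-1.
Proof. by rewrite -[LHS]mulr1 -(mulfV (cexp_neq0 z)) mulrA cexpN_mul mul1r. Qed.

Lemma nrm_cexp z : nrm (cexp z) = expR (complex.Re z).
Proof.
rewrite /cexp nrmM nrmR ger0_norm ?expR_ge0 //.
rewrite (_ : nrm _ = 1) ?mulr1 //.
apply/eqP; rewrite -(@eqrXn2 _ 2) ?nrm_ge0 // nrm_sqr /= cos2Dsin2 expr1n //.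
Qed.

Lemma derive_at0_eps (f : R -> R) (l : R) : is_derive (0 : R) (1 : R) f l ->
  forall e : R, 0 < e -> exists2 d : R, 0 < d & forall h, `|h| < d ->
    `|f h - f 0 - h * l| <= e * `|h|.
Proof.
move=> [/derivable1_diffP df dE] e e0.
have [d d0 H] := differentiable_eps df e0; exists d => // h /H.
by rewrite add0r diff1E // derive1E dE.
Qed.

Lemma hasd_cexp z : hasd cexp z (cexp z).
Proof.
suff main : hasd cexp 0 1.
  have h1 : hasd (fun w => w - z) z 1.
    by have := hasdD (hasd_id z) (hasd_cst (- z) z); rewrite addr0.
  have := hasdZ (cexp z) (@hasd_comp _ _ _ z 1 1 h1 _).
  rewrite subrr => /(_ _ main); rewrite mulr1 mulr1.
  by apply: (eq_hasd ltr01) => h _; rewrite -cexpD; congr cexp; ring.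
move=> e e0; have e80 : 0 < e / 8 by rewrite divr_gt0.
have hx : is_derive (0 : R) (1 : R) expR 1 by rewrite -[X in is_derive _ _ _ X]expR0; exact: is_derive_expR.
have hc : is_derive (0 : R) (1 : R) cos 0
  by rewrite -[X in is_derive _ _ _ X]oppr0 -[X in - X]sin0; exact: is_derive_cos.
have hs : is_derive (0 : R) (1 : R) sin 1 by rewrite -[X in is_derive _ _ _ X]cos0; exact: is_derive_sin.
have [d1 d10 H1] := derive_at0_eps hx e80.
have [d2 d20 H2] := derive_at0_eps hc e80.
have [d3 d30 H3] := derive_at0_eps hs e80.
exists (Num.min (Num.min d1 d2) (Num.min (Num.min d3 1) (e / 8))).
  by rewrite !lt_min d10 d20 d30 ltr01.
move=> h; rewrite !lt_min => /andP[/andP[g1 g2] /andP[/andP[g3 g4] g5]].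
have Re_h := Re_le_nrm h; have Im_h := Im_le_nrm h.
rewrite add0r cexp0 mulr1; apply: le_trans (nrm_le_ReIm _) _.
have -> : complex.Re (cexp h - 1 - h) = expR (complex.Re h) * cos (complex.Im h) - 1 - complex.Re h.
  by rewrite !ReB /cexp ReRM.
have -> : complex.Im (cexp h - 1 - h) = expR (complex.Re h) * sin (complex.Im h) - complex.Im h.
  by rewrite !ImB /cexp ImRM /= subr0.
set a := complex.Re h in Re_h *; set b := complex.Im h in Im_h *.
have {}H1 := H1 a (le_lt_trans Re_h g1).
have {}H2 := H2 b (le_lt_trans Im_h g2).
have {}H3 := H3 b (le_lt_trans Im_h g3).
rewrite expR0 mulr1 in H1; rewrite cos0 mulr0 subr0 in H2.
rewrite sin0 mulr1 subr0 in H3.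
have a1 : `|1 + a| <= 2.
  by apply: le_trans (ler_normD _ _) _; rewrite normr1; have := le_lt_trans Re_h g4; lra.
have -> : expR a * cos b - 1 - a = (expR a - 1 - a) * cos b + (1 + a) * (cos b - 1) by ring.
have -> : expR a * sin b - b = (expR a - 1 - a) * sin b + (1 + a) * (sin b - b) + a * b by ring.
have cb : `|cos b| <= 1 by rewrite ler_norml cos_geN1 cos_le1.
have sb : `|sin b| <= 1 by rewrite ler_norml sin_geN1 sin_le1.
have i1 : `|(expR a - 1 - a) * cos b| <= e / 8 * nrm h.
  rewrite normrM -[leRHS]mulr1; apply: ler_pM => //.
  by apply: le_trans H1 _; rewrite ler_wpM2l // ltW.
have i2 : `|(expR a - 1 - a) * sin b| <= e / 8 * nrm h.
  rewrite normrM -[leRHS]mulr1; apply: ler_pM => //.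
  by apply: le_trans H1 _; rewrite ler_wpM2l // ltW.
have i3 : `|(1 + a) * (cos b - 1)| <= 2 * (e / 8 * nrm h).
  rewrite normrM; apply: ler_pM => //.
  by apply: le_trans H2 _; rewrite ler_wpM2l // ltW.
have i4 : `|(1 + a) * (sin b - b)| <= 2 * (e / 8 * nrm h).
  rewrite normrM; apply: ler_pM => //.
  by apply: le_trans H3 _; rewrite ler_wpM2l // ltW.
have i5 : `|a * b| <= e / 8 * nrm h.
  by rewrite normrM; apply: ler_pM => //; apply: le_trans Re_h (ltW g5).
apply: le_trans (lerD (ler_normD _ _) (le_trans (ler_normD _ _) (lerD (ler_normD _ _) (lexx _)))) _.
have := lerD (lerD i1 i3) (lerD (lerD i2 i4) i5).
move=> /le_trans; apply.
have : 0 <= e * nrm h by rewrite mulr_ge0 ?nrm_ge0 // ltW.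
lra.
Qed.

(** The point of argument [t] on the unit circle. *)
Definition cis (t : R) : C := cexp (RC t * 'i).

Lemma cisE t : cis t = cos t +i* sin t.
Proof.
rewrite /cis /cexp ReRM ImRM /= mulr0 expR0 mulr1.
by rewrite mul1r.
Qed.

Lemma nrm_cis t : nrm (cis t) = 1.
Proof. by rewrite /cis nrm_cexp ReRM /= mulr0 expR0. Qed.

Lemma cis_neq0 t : cis t != 0. Proof. exact: cexp_neq0. Qed.

Lemma der_on_cexp (c : C) a b : der_on (fun t => cexp (RC t * c))
  (fun t => cexp (RC t * c) * c) a b.
Proof.
apply: (@der_on_comp R cexp (fun t => cexp (RC t * c)) (fun t => RC t * c) (fun=> c)).
  apply: (@eq_der_on _ _ (fun=> c)) => //.
  have := @der_on_lin R 0 c a b; by under eq_fun do rewrite add0r.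
by move=> t _; apply: hasd_cexp.
Qed.

Lemma cont_on_cexp (c : C) a b : cont_on (fun t => cexp (RC t * c)) a b.
Proof. exact: der_on_cont (@der_on_cexp c a b). Qed.

Lemma intg_cexp (c : C) : c != 0 -> cexp (RC (2 * pi) * c) = 1 ->
  intg (fun t => cexp (RC t * c)) 0 (2 * pi) = 0.
Proof.
move=> c0 h.
have pi0 : 0 <= 2 * pi :> R by rewrite mulr_ge0 // pi_ge0.
have := der_onZ (c^-1) (@der_on_cexp c 0 (2 * pi)).
move=> dd; have : der_on (fun t => c^-1 * cexp (RC t * c)) (fun t => cexp (RC t * c)) 0 (2 * pi).
  by apply: eq_der_on dd => t _; field.
by move=> /(intgE pi0) ->; rewrite h /= mul0r cexp0 subrr.
Qed.

Lemma cexp2pi : cexp (RC (2 * pi) * 'i) = 1.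
Proof. by rewrite -/(cis _) cisE mulr_natl cos2pi sin2pi. Qed.

End ComplexExp.

(** * Goursat's theorem on rectangles *)

Section Goursat.
Context {R : realType}.
Local Notation C := (Cplx R).
Local Notation RC t := (t%:C : C).
Local Notation "x +I* y" := ((x +i* y)%C : C) (at level 50).

Lemma complex_ReIm (x y : R) : (x +I* y) = RC x + RC y * 'i.
Proof. by apply/eqP; rewrite eq_complex /=; apply/andP; split; apply/eqP; ring. Qed.

Lemma der_on_horizontal (y a b : R) : der_on (fun s => s +I* y) (fun=> 1) a b.
Proof.
have := @der_on_lin R (RC y * 'i) 1 a b.
by under eq_fun do rewrite mulr1 addrC -complex_ReIm.
Qed.

Lemma der_on_vertical (x a b : R) : der_on (fun s => x +I* s) (fun=> 'i) a b.
Proof.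
have := @der_on_lin R (RC x) 'i a b.
by under eq_fun do rewrite -complex_ReIm.
Qed.

(** The integral of [f] over the positively oriented boundary of the rectangle
    [[x0, x1] x [y0, y1]]. *)
Definition rect_intg (f : C -> C) (x0 x1 y0 y1 : R) : C :=
  intg (fun s => f (s +I* y0)) x0 x1 + 'i * intg (fun t => f (x1 +I* t)) y0 y1
  - intg (fun s => f (s +I* y1)) x0 x1 - 'i * intg (fun t => f (x0 +I* t)) y0 y1.

Lemma rect_intg_primitive (f P : C -> C) (x0 x1 y0 y1 : R) : x0 <= x1 -> y0 <= y1 ->
  (forall z, hasd P z (f z)) -> rect_intg f x0 x1 y0 y1 = 0.
Proof.
move=> hx hy dP.
have h1 y : intg (fun s => f (s +I* y)) x0 x1 = P (x1 +I* y) - P (x0 +I* y).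
  rewrite (@intgE _ (fun s => P (s +I* y)) _ _ _ hx) //.
  apply: eq_der_on (der_on_comp (@der_on_horizontal y x0 x1) (fun t _ => dP _)) => t _.
  by rewrite mulr1.
have h2 x : 'i * intg (fun s => f (x +I* s)) y0 y1 = P (x +I* y1) - P (x +I* y0).
  have := der_onZ (- 'i) (der_on_comp (@der_on_vertical x y0 y1) (fun t _ => dP _)).
  have ii : 'i * 'i = -1 :> C by rewrite -expr2 sqr_i.
  move=> /(@eq_der_on _ _ _ (fun s => f (x +I* s)) y0 y1) h.
  have {}h := intgE hy (h _); rewrite h; last first.
    by move=> t _; rewrite mulrCA mulNr ii opprK mulr1.
  by rewrite -mulrBr mulrA mulrN ii opprK mul1r.
rewrite /rect_intg !h1 !h2; ring.
Qed.

Lemma cont_on_horizontal (f : C -> C) (y a b : R) :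
  (forall x, a <= x <= b -> contc f (x +I* y)) ->
  cont_on (fun s => f (s +I* y)) a b.
Proof. by move=> h; apply: cont_on_comp h; exact: der_on_cont (@der_on_horizontal _ _ _). Qed.

Lemma cont_on_vertical (f : C -> C) (x a b : R) :
  (forall y, a <= y <= b -> contc f (x +I* y)) ->
  cont_on (fun s => f (x +I* s)) a b.
Proof. by move=> h; apply: cont_on_comp h; exact: der_on_cont (@der_on_vertical _ _ _). Qed.

Lemma rect_intg_split4 (f : C -> C) (x0 x1 y0 y1 m n : R) : x0 <= m <= x1 -> y0 <= n <= y1 ->
  (forall x y, x0 <= x <= x1 -> y0 <= y <= y1 -> contc f (x +I* y)) ->
  rect_intg f x0 x1 y0 y1 = rect_intg f x0 m y0 n + rect_intg f m x1 y0 n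
    + rect_intg f x0 m n y1 + rect_intg f m x1 n y1.
Proof.
move=> /andP[m0 m1] /andP[n0 n1] cf.
have hx := le_trans m0 m1; have hy := le_trans n0 n1.
rewrite {1}/rect_intg.
rewrite (@intg_split _ (fun s => f (s +I* y0)) _ m) //; last first.
  by apply: cont_on_horizontal => x hx'; apply: cf; rewrite ?lexx.
rewrite (@intg_split _ (fun s => f (s +I* y1)) _ m) //; last first.
  by apply: cont_on_horizontal => x hx'; apply: cf; rewrite ?lexx ?andbT.
rewrite (@intg_split _ (fun s => f (x0 +I* s)) _ n) //; last first.
  by apply: cont_on_vertical => x hx'; apply: cf; rewrite ?lexx.
rewrite (@intg_split _ (fun s => f (x1 +I* s)) _ n) //; last first.
  by apply: cont_on_vertical => x hx'; apply: cf; rewrite ?lexx ?andbT.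
rewrite /rect_intg; ring.
Qed.

Lemma rect_intgD (f g : C -> C) (x0 x1 y0 y1 : R) : x0 <= x1 -> y0 <= y1 ->
  (forall x y, x0 <= x <= x1 -> y0 <= y <= y1 -> contc f (x +I* y)) ->
  (forall x y, x0 <= x <= x1 -> y0 <= y <= y1 -> contc g (x +I* y)) ->
  rect_intg (fun z => f z + g z) x0 x1 y0 y1 = rect_intg f x0 x1 y0 y1 + rect_intg g x0 x1 y0 y1.
Proof.
move=> hx hy cf cg; rewrite /rect_intg !intgD //; first ring.
all: try by apply: cont_on_horizontal => x hx'; first [apply: cf | apply: cg]; rewrite ?lexx ?andbT.
all: by apply: cont_on_vertical => x hx'; first [apply: cf | apply: cg]; rewrite ?lexx ?andbT.
Qed.

Lemma rect_intg_bound (f : C -> C) (x0 x1 y0 y1 M : R) : x0 <= x1 -> y0 <= y1 ->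
  (forall x y, x0 <= x <= x1 -> y0 <= y <= y1 -> contc f (x +I* y)) ->
  (forall x y, x0 <= x <= x1 -> y0 <= y <= y1 -> nrm (f (x +I* y)) <= M) ->
  nrm (rect_intg f x0 x1 y0 y1) <= 2 * M * ((x1 - x0) + (y1 - y0)).
Proof.
move=> hx hy cf fM.
have hh y : y0 <= y <= y1 -> nrm (intg (fun s => f (s +I* y)) x0 x1) <= M * (x1 - x0).
  move=> hy'; apply: intg_bound => //; last by move=> t ht; exact: fM.
  by apply: cont_on_horizontal => x hx'; apply: cf.
have hv x : x0 <= x <= x1 -> nrm ('i * intg (fun s => f (x +I* s)) y0 y1) <= M * (y1 - y0).
  move=> hx'; rewrite nrmM nrmi mul1r.
  apply: intg_bound => //; last by move=> t ht; exact: fM.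
  by apply: cont_on_vertical => y hy'; apply: cf.
rewrite /rect_intg; have k1 := hh y0; have k2 := hh y1; have k3 := hv x1; have k4 := hv x0.
rewrite ?lexx ?hx ?hy in k1 k2 k3 k4.
apply: le_trans (nrmB _ _) _; apply: le_trans (lerD (nrmB _ _) (lexx _)) _.
apply: le_trans (lerD (lerD (nrmD _ _) (lexx _)) (lexx _)) _.
have := lerD (lerD (lerD (k1 isT) (k3 isT)) (k2 isT)) (k4 isT).
move=> /le_trans; apply; rewrite le_eqVlt; apply/orP; left; apply/eqP; ring.
Qed.

(** The integral over a rectangle vanishes as soon as [f] is complex
    differentiable at each of its points. *)
Theorem goursat (f : C -> C) (x0 x1 y0 y1 : R) : x0 <= x1 -> y0 <= y1 ->
  (forall x y, x0 <= x <= x1 -> y0 <= y <= y1 -> exists l, hasd f (x +I* y) l) ->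
  rect_intg f x0 x1 y0 y1 = 0.
Proof.
move=> hx hy df.
have cf x y : x0 <= x <= x1 -> y0 <= y <= y1 -> contc f (x +I* y).
  by move=> h1 h2; have [l /hasd_contc] := df x y h1 h2.
apply/nrm0_eq0/eqP; rewrite eq_le nrm_ge0 andbT.
apply/ler_addgt0Pr => e e0; rewrite add0r.
set lx := x1 - x0; set ly := y1 - y0.
have lx0 : 0 <= lx by rewrite subr_ge0.
have ly0 : 0 <= ly by rewrite subr_ge0.
have ex : x1 = x0 + lx by rewrite /lx; ring.
have ey : y1 = y0 + ly by rewrite /ly; ring.
pose P (u v k : R) := nrm (rect_intg f u (u + k * lx) v (v + k * ly)) <= e * k ^+ 2.
have := @subdivision R P x0 y0 lx ly lx0 ly0.
rewrite /P !mul1r -ex -ey expr1n mulr1; apply.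
- move=> u v k k0 h1 h2 h3 h4 p1 p2 p3 p4.
  have kx : 0 <= k / 2 * lx by rewrite mulr_ge0 // divr_ge0 // ltW.
  have ky : 0 <= k / 2 * ly by rewrite mulr_ge0 // divr_ge0 // ltW.
  have e1 : u + k / 2 * lx + k / 2 * lx = u + k * lx by field.
  have e2 : v + k / 2 * ly + k / 2 * ly = v + k * ly by field.
  rewrite e1 e2 in p2 p3 p4 *; rewrite (@rect_intg_split4 f _ _ _ _ (u + k / 2 * lx) (v + k / 2 * ly)).
  + apply: le_trans (nrmD _ _) _; apply: le_trans (lerD (nrmD _ _) (lexx _)) _.
    apply: le_trans (lerD (lerD (nrmD _ _) (lexx _)) (lexx _)) _.
    apply: le_trans (lerD (lerD (lerD p1 p2) p3) p4) _.
    by rewrite le_eqVlt; apply/orP; left; apply/eqP; field.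
  + by rewrite -e1 !lerDl kx.
  + by rewrite -e2 !lerDl ky.
  + move=> x y /andP[g1 g2] /andP[g3 g4]; apply: cf.
      by rewrite (le_trans h1 g1) (le_trans g2 h2).
    by rewrite (le_trans h3 g3) (le_trans g4 h4).
- move=> x y hx' hy'; have [l dl] := df x y hx' hy'.
  set p := x +I* y in dl; set S := lx + ly + 1.
  have S0 : 0 < S by rewrite ltr_wpDl // addr_ge0.
  have e'0 : 0 < e / (2 * S ^+ 2) by rewrite divr_gt0 // mulr_gt0 // exprn_gt0.
  have [d d0 H] := dl _ e'0.
  exists (d / S) => [|u v k k0]; first exact: divr_gt0.
  rewrite ltr_pdivlMr // => kS /andP[ux xu] /andP[vy yv] hu hu' hv hv'.
  (* Near [p], subtract the affine approximation [A]: it has a primitive, so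
     only the error [E] contributes to the integral. *)
  pose A (z : C) : C := (f p - p * l) + l * z.
  pose E (z : C) : C := f z - A z.
  have cA z : contc A z.
    apply: (@hasd_contc _ _ _ (0 + l * 1)).
    by apply: hasdD (hasd_cst _ _) (hasdZ l (hasd_id z)).
  have sub x' y' : u <= x' <= u + k * lx -> v <= y' <= v + k * ly -> contc f (x' +I* y').
    move=> /andP[g1 g2] /andP[g3 g4]; apply: cf.
      by rewrite (le_trans hu g1) (le_trans g2 hu').
    by rewrite (le_trans hv g3) (le_trans g4 hv').
  have kx : u <= u + k * lx by rewrite lerDl mulr_ge0 // ltW.
  have ky : v <= v + k * ly by rewrite lerDl mulr_ge0 // ltW.
  have cE x' y' : u <= x' <= u + k * lx -> v <= y' <= v + k * ly -> contc E (x' +I* y').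
    move=> g1 g2; apply/contcP; apply: continuousB; apply/contcP; [exact: sub|exact: cA].
  have -> : rect_intg f u (u + k * lx) v (v + k * ly) = rect_intg (fun z => A z + E z) u (u + k * lx) v (v + k * ly).
    by rewrite (_ : (fun z => A z + E z) = f) //; apply/funext => z; rewrite /E; ring.
  rewrite rect_intgD //.
  rewrite (@rect_intg_primitive A (fun z => (f p - p * l) * z + l / 2 * (z * z))) //; last first.
    move=> z.
    have -> : A z = (f p - p * l) * 1 + l / 2 * (1 * z + z * 1) by rewrite /A; field.
    exact: hasdD (hasdZ _ (hasd_id z)) (hasdZ _ (hasdM (hasd_id z) (hasd_id z))).
  rewrite add0r.
  apply: le_trans (@rect_intg_bound E _ _ _ _ (e / (2 * S ^+ 2) * (k * S)) kx ky cE _) _.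
    move=> x' y' /andP[g1 g2] /andP[g3 g4].
    have hp : nrm ((x' +I* y') - p) <= k * S.
      apply: le_trans (nrm_le_ReIm _) _; rewrite ReB ImB /=.
      have b1 : `|x' - x| <= k * lx by rewrite ler_norml; apply/andP; split; lra.
      have b2 : `|y' - y| <= k * ly by rewrite ler_norml; apply/andP; split; lra.
      by apply: le_trans (lerD b1 b2) _; rewrite /S !mulrDr mulr1 lerDl ltW.
    have -> : E (x' +I* y') = f (p + ((x' +I* y') - p)) - f p - ((x' +I* y') - p) * l.
      by rewrite subrKC /E /A; ring.
    apply: le_trans (H _ (le_lt_trans hp kS)) _.
    by rewrite ler_wpM2l // ltW.
  have -> : e * k ^+ 2 = 2 * (e / (2 * S ^+ 2) * (k * S)) * (k * S).
    by field; rewrite gt_eqF.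
  apply: ler_wpM2l.
    by rewrite !mulr_ge0 // ?ltW // ?invr_gt0 ?mulr_gt0 // exprn_gt0.
  have -> : u + k * lx - u + (v + k * ly - v) = k * (lx + ly) by ring.
  by rewrite ler_wpM2l // /S ?lerDl // ltW.
Qed.

(** If a holomorphic function takes the same values on the two horizontal
    sides of a rectangle, then its integrals over the vertical sides agree. *)
Lemma goursat_periodic (f : C -> C) (x0 x1 y0 y1 : R) : x0 <= x1 -> y0 <= y1 ->
  (forall x y, x0 <= x <= x1 -> y0 <= y <= y1 -> exists l, hasd f (x +I* y) l) ->
  (forall x, f (x +I* y1) = f (x +I* y0)) ->
  intg (fun t => f (x0 +I* t)) y0 y1 = intg (fun t => f (x1 +I* t)) y0 y1.
Proof.
move=> hx hy df per; have := goursat hx hy df; rewrite /rect_intg.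
rewrite (@eq_intg _ (fun s => f (s +I* y1)) (fun s => f (s +I* y0))) //.
set X := intg _ _ _; set Y := intg _ _ _; set Z := intg _ _ _ => H.
have : 'i * (Y - Z) = 0 by rewrite -[RHS]H; ring.
move=> /eqP; rewrite mulf_eq0 => /orP[/eqP i0|].
  by have := @nrmi R; rewrite i0 nrm0 => /esym/eqP; rewrite oner_eq0.
by rewrite subr_eq0 => /eqP.
Qed.
End Goursat.

(** * Means over circles and Cauchy's coefficient formulas *)

Section Cauchy.
Context {R : realType}.
Local Notation C := (Cplx R).
Local Notation RC t := (t%:C : C).

Let pi2_ge0 : 0 <= 2 * pi :> R. Proof. by rewrite mulr_ge0 // pi_ge0. Qed.
Let pi2_gt0 : 0 < 2 * pi :> R. Proof. by rewrite mulr_gt0 // pi_gt0. Qed.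

(** The mean of a function of the angle over a full turn. *)
Definition cmean (f : R -> C) : C := (RC (2 * pi))^-1 * intg f 0 (2 * pi).

Lemma RC_neq0 (t : R) : (RC t != 0) = (t != 0).
Proof. by rewrite -(rmorph0 (real_complex R)) (inj_eq (@complexI R)). Qed.

Let pi2_neq0 : RC (2 * pi) != 0.
Proof. by rewrite RC_neq0 gt_eqF. Qed.

Local Notation circle_cont f := (cont_on f 0 (2 * pi)).

Lemma cmeanD f g : circle_cont f -> circle_cont g ->
  cmean (fun t => f t + g t) = cmean f + cmean g.
Proof. by move=> cf cg; rewrite /cmean intgD // mulrDr. Qed.

Lemma cmeanZ c f : circle_cont f -> cmean (fun t => c * f t) = c * cmean f.
Proof. by move=> cf; rewrite /cmean intgZ // mulrCA. Qed.

Lemma cmean_lin (a : C) f g h : circle_cont f -> circle_cont g ->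
  (forall t, h t = a * f t + g t) -> cmean h = a * cmean f + cmean g.
Proof.
move=> cf cg hE; rewrite -cmeanZ // -cmeanD //; last exact: cont_onZ.
by congr cmean; apply/funext.
Qed.

Lemma cmean_cst c : cmean (fun=> c) = c.
Proof. by rewrite /cmean intg_cst // subr0 mulKf. Qed.

Lemma eq_cmean f g : (forall t, f t = g t) -> cmean f = cmean g.
Proof. by move=> fg; congr cmean; apply/funext. Qed.

Lemma cmean_bound f M : circle_cont f -> (forall t, nrm (f t) <= M) ->
  nrm (cmean f) <= M.
Proof.
move=> cf fM; rewrite /cmean nrmM nrmV nrmR ger0_norm //.
rewrite ler_pdivrMl // [_ * M]mulrC -[X in M * X]subr0.
by apply: intg_bound.
Qed.

(** The mean value property; at the centre only continuity is required. *)
Lemma mean_value (psi : C -> C) (r : R) : 0 < r -> contc psi 0 ->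
  (forall z : C, 0 < nrm z -> nrm z <= r -> exists l, hasd psi z l) ->
  cmean (fun t => psi (RC r * cis t)) = psi 0.
Proof.
move=> r0 c0 dpsi.
(* In the coordinate [w = log z] circles become vertical segments, and
   Goursat's theorem shows that the mean does not depend on the radius. *)
pose h (w : C) := psi (cexp w).
have hE x y : h ((x +i* y)%C) = psi (RC (expR x) * cis y).
  by rewrite /h cisE.
have nE x y : nrm (cexp ((x +i* y)%C : C)) = expR x by rewrite nrm_cexp.
have dh x y : x <= ln r -> exists l, hasd h ((x +i* y)%C : C) l.
  move=> xr; have [||l hl] := dpsi (cexp ((x +i* y)%C : C)).
  - by rewrite nE expR_gt0.
  - by rewrite nE -[leRHS]lnK ?posrE // ler_expR.
  by exists (cexp ((x +i* y)%C : C) * l); apply: hasd_comp hl; exact: hasd_cexp.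
have const s : s <= ln r ->
   intg (fun t => psi (RC (expR s) * cis t)) 0 (2 * pi) =
   intg (fun t => psi (RC r * cis t)) 0 (2 * pi).
  move=> sr.
  have per x : h ((x +i* (2 * pi))%C) = h ((x +i* 0)%C).
    by rewrite !hE !cisE mulr_natl cos2pi sin2pi cos0 sin0.
  have := goursat_periodic sr pi2_ge0 (fun x y hx _ => dh x y (proj2 (andP hx))) per.
  rewrite (@eq_intg _ _ (fun t => psi (RC (expR s) * cis t))) // => ->.
  by apply: eq_intg => // t _; rewrite hE lnK.
apply/eqP; rewrite -subr_eq0; apply/eqP/nrm0_eq0/eqP.
rewrite eq_le nrm_ge0 andbT; apply/ler_addgt0Pr => e e0; rewrite add0r.
have [d d0 H] := c0 e e0.
(* On a circle of small radius [q] the function is within [e] of [psi 0]. *)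
pose q := Num.min r (d / 2).
have q0 : 0 < q by rewrite lt_min r0 divr_gt0.
have qr : ln q <= ln r by rewrite ler_ln ?posrE // ge_min lexx.
have cc : circle_cont (fun t => psi (RC q * cis t)).
  apply: (@cont_on_comp _ psi (fun t => RC q * cis t)).
    by apply: cont_onZ; exact: cont_on_cexp.
  move=> t _; have [||l /hasd_contc //] := dpsi (RC q * cis t).
    by rewrite nrmM nrm_cis mulr1 nrmR gtr0_norm.
  by rewrite nrmM nrm_cis mulr1 nrmR gtr0_norm // ge_min lexx.
have -> : cmean (fun t => psi (RC r * cis t)) - psi 0 =
   cmean (fun t => psi (RC q * cis t) + - psi 0).
  rewrite cmeanD // ?cmean_cst; last exact: cont_on_cst.
  by rewrite /cmean -(const _ qr) lnK ?posrE.
apply: cmean_bound; first by apply: cont_onD => //; exact: cont_on_cst.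
move=> t; rewrite -[X in psi X]add0r; apply: H.
rewrite nrmM nrm_cis mulr1 nrmR gtr0_norm //.
by rewrite gt_min; apply/orP; right; lra.
Qed.

(** The inverse (and conjugate) of [cis t]. *)
Definition ucis (t : R) : C := cexp (RC t * - 'i).

Lemma cis_ucis t : cis t * ucis t = 1.
Proof. by rewrite /cis /ucis mulrN mulrC cexpN_mul. Qed.

Lemma nrm_ucis t : nrm (ucis t) = 1.
Proof. by have := congr1 nrm (cis_ucis t); rewrite nrmM nrm_cis mul1r nrm1. Qed.

Lemma cont_on_cis a b : cont_on (@cis R) a b.
Proof. exact: cont_on_cexp. Qed.

Lemma cont_on_ucis a b : cont_on ucis a b.
Proof. exact: cont_on_cexp. Qed.

Lemma cmean_cis : cmean (@cis R) = 0.
Proof.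
rewrite /cmean (@intg_cexp _ 'i) ?mulr0 ?cexp2pi //.
exact: imaginary_neq0.
Qed.

Lemma cmean_ucis : cmean ucis = 0.
Proof.
rewrite /cmean (@intg_cexp _ (- 'i)) ?mulr0 ?mulrN ?cexpN ?cexp2pi ?invr1 //.
by rewrite oppr_eq0; exact: imaginary_neq0.
Qed.

Lemma cmean_ucis2 : cmean (fun t => ucis t ^+ 2) = 0.
Proof.
rewrite /cmean (_ : (fun t => _) = (fun t => cexp (RC t * (- 'i + - 'i)))); last first.
  by apply/funext => t; rewrite mulrDr cexpD.
rewrite intg_cexp ?mulr0 //.
  by rewrite -opprD -mulr2n oppr_eq0 mulrn_eq0 negb_or; exact: imaginary_neq0.
by rewrite mulrDr cexpD mulrN cexpN cexp2pi invr1 mulr1.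
Qed.

Section Coefficients.
Variables (phi : C -> C) (r : R).
Hypothesis r0 : 0 < r.
Hypothesis dphi : forall z : C, nrm z <= r -> exists l, hasd phi z l.

Let rc0 : RC r != 0. Proof. by rewrite RC_neq0 gt_eqF. Qed.

Lemma nrm_circle t : nrm (RC r * cis t) = r.
Proof. by rewrite nrmM nrm_cis mulr1 nrmR gtr0_norm. Qed.

Lemma cont_on_circle : circle_cont (fun t => phi (RC r * cis t)).
Proof.
apply: (@cont_on_comp _ phi (fun t => RC r * cis t)).
  by apply: cont_onZ; exact: cont_on_cexp.
by move=> t _; have [|l /hasd_contc //] := dphi (z := RC r * cis t); rewrite nrm_circle.
Qed.

(** Cauchy's formula for the first coefficient: the mean value property for
    [(phi(z) - phi(0)) / z]. *)
Lemma cauchy_coef1 (l : C) : hasd phi 0 l ->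
  cmean (fun t => phi (RC r * cis t) * ucis t) = RC r * l.
Proof.
move=> hl; pose psi (z : C) : C := if z == 0 then l else (phi z - phi 0) / z.
have c0 : contc psi 0.
  move=> e e0; have [d d0 H] := hl e e0; exists d => // h hd.
  rewrite /psi eqxx add0r; have [_|h0] := eqVneq h 0.
    by rewrite subrr nrm0 ltW.
  have -> : (phi h - phi 0) / h - l = (phi (0 + h) - phi 0 - h * l) / h.
    by rewrite add0r; field.
  by rewrite nrmM nrmV ler_pdivrMr ?nrm_gt0 //; apply: H.
have dpsi z : 0 < nrm z -> nrm z <= r -> exists l', hasd psi z l'.
  move=> z0 zr; have [l' h'] := dphi zr.
  rewrite nrm_gt0 in z0.
  have h2 := hasdM (hasdD h' (hasd_cst (- phi 0) z)) (hasdV z0 (hasd_id z)).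
  eexists; apply: (eq_hasd (d := nrm z) _ _ h2); first by rewrite nrm_gt0.
  move=> h hz; rewrite /psi; case: eqP => // E; exfalso.
  have : h = - z by rewrite -[RHS]addr0 -E addKr.
  by move=> hE; rewrite hE nrmN ltxx in hz.
have := mean_value r0 c0 dpsi.
rewrite (_ : psi 0 = l); last by rewrite /psi eqxx.
rewrite (@eq_cmean _ (fun t => (RC r)^-1 * (phi (RC r * cis t) * ucis t)
   + (- phi 0 / RC r) * ucis t)); last first.
  move=> t; have := cis_neq0 t; have := cis_ucis t => e c0'.
  have -> : ucis t = (cis t)^-1 by rewrite -[RHS]mulr1 -e mulKf.
  rewrite /psi ifF; first by field; apply/andP; split; [exact: c0'|exact: rc0].
  by apply/negbTE; rewrite mulf_neq0.
have cp : circle_cont (fun t => phi (RC r * cis t) * ucis t).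
  by apply: cont_onM; [exact: cont_on_circle|exact: cont_on_ucis].
have cu := @cont_on_ucis 0 (2 * pi).
rewrite cmeanD; [|exact: cont_onZ|exact: cont_onZ].
rewrite !cmeanZ // cmean_ucis mulr0 addr0 => <-.
by rewrite mulVKf.
Qed.

(** Cauchy's formula for the second coefficient [m], given as the coefficient
    of an expansion of order 2 at 0. *)
Lemma cauchy_coef2 (l m : C) : hasd phi 0 l ->
  (forall e : R, 0 < e -> exists2 d : R, 0 < d & forall h : C, nrm h < d ->
     nrm (phi h - phi 0 - h * l - h ^+ 2 * m) <= e * nrm h ^+ 2) ->
  cmean (fun t => phi (RC r * cis t) * ucis t ^+ 2) = RC r ^+ 2 * m.
Proof.
move=> hl hm; pose psi (z : C) : C := if z == 0 then m else (phi z - phi 0 - z * l) / z ^+ 2.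
have c0 : contc psi 0.
  move=> e e0; have [d d0 H] := hm e e0; exists d => // h hd.
  rewrite /psi eqxx add0r; have [_|h0] := eqVneq h 0.
    by rewrite subrr nrm0 ltW.
  have -> : (phi h - phi 0 - h * l) / h ^+ 2 - m = (phi h - phi 0 - h * l - h ^+ 2 * m) / h ^+ 2.
    by field.
  by rewrite nrmM nrmV ler_pdivrMr ?nrmX ?exprn_gt0 ?nrm_gt0 //; apply: H.
have dpsi z : 0 < nrm z -> nrm z <= r -> exists l', hasd psi z l'.
  move=> z0 zr; have [l' h'] := dphi zr.
  rewrite nrm_gt0 in z0.
  have z20 : z * z != 0 by rewrite mulf_neq0.
  have h2 := hasdM (hasdD (hasdD h' (hasd_cst (- phi 0) z)) (hasdZ (- l) (hasd_id z)))
     (hasdV (f := fun x => x * x) z20 (hasdM (hasd_id z) (hasd_id z))).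
  eexists; apply: (eq_hasd (d := nrm z) _ _ h2); first by rewrite nrm_gt0.
  move=> h hz; rewrite /psi; case: eqP => [E|_]; last by rewrite expr2 mulNr [l * _]mulrC.
  have : h = - z by rewrite -[RHS]addr0 -E addKr.
  by move=> hE; rewrite hE nrmN ltxx in hz.
have := mean_value r0 c0 dpsi.
rewrite (_ : psi 0 = m); last by rewrite /psi eqxx.
rewrite (@eq_cmean _ (fun t => (RC r ^+ 2)^-1 * (phi (RC r * cis t) * ucis t ^+ 2)
   + ((- phi 0 / RC r ^+ 2) * ucis t ^+ 2 + (- l / RC r) * ucis t))); last first.
  move=> t; have := cis_neq0 t; have := cis_ucis t => e c0'.
  have -> : ucis t = (cis t)^-1 by rewrite -[RHS]mulr1 -e mulKf.
  rewrite /psi ifF; first by field; apply/andP; split; [exact: c0'|exact: rc0].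
  by apply/negbTE; rewrite mulf_neq0.
have cu := @cont_on_ucis 0 (2 * pi).
have cu2 : circle_cont (fun t => ucis t ^+ 2) by apply: cont_onM.
have cp : circle_cont (fun t => phi (RC r * cis t) * ucis t ^+ 2).
  by apply: cont_onM => //; exact: cont_on_circle.
rewrite cmeanD; [|exact: cont_onZ|by apply: cont_onD; exact: cont_onZ].
rewrite cmeanD; [|exact: cont_onZ|exact: cont_onZ].
rewrite !cmeanZ // cmean_ucis cmean_ucis2 !mulr0 !addr0 => <-.
by rewrite mulVKf // expf_neq0.
Qed.
End Coefficients.
End Cauchy.

(** * Directional derivatives of holomorphic functions *)

Section HolomorphicDerivative.
Context {R : realType} {V : normedModType R[i]}.
Local Notation C := (Cplx R).
Local Notation RC t := (t%:C : C).
Implicit Types (f : V -> C) (x y v w : V).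

(** The restriction of a differentiable function to a complex line. *)
Lemma line_hasd f x v (z : C) : differentiable f (x + z *: v) ->
  hasd (fun q : C => f (x + q *: v)) z ('D_v f (x + z *: v)).
Proof.
move=> df e e0; set y := x + z *: v in df *.
have A0 : 0 < 1 + nrm v by rewrite ltr_pwDl // nrm_ge0.
have [|_ /gt0_real[d d0 ->] H] := differentiable_eps df (_ : 0 < (e / (1 + nrm v))%:C).
  by rewrite ltcR divr_gt0.
exists (d / (1 + nrm v)); first exact: divr_gt0.
move=> h; rewrite ltr_pdivlMr // => hd.
have hv : nrm (h *: v) <= nrm h * (1 + nrm v).
  by rewrite nrmZ ler_wpM2l ?nrm_ge0 // lerDr.
have := H (h *: v); rewrite nrm_lt => /(_ (le_lt_trans hv hd)).
rewrite !nrmE -rmorphM /= lecR linearZ /= -deriveE //.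
have -> : y + h *: v = x + (z + h) *: v by rewrite /y scalerDl addrA.
move=> /le_trans; apply.
have -> : e * nrm h = e / (1 + nrm v) * (nrm h * (1 + nrm v)) by field; rewrite gt_eqF.
by rewrite ler_wpM2l // divr_ge0 // ltW.
Qed.

Section CenterFormula.
Variables (f : V -> C) (v : V) (r : R).
Hypothesis r0 : (0 : R) < r.

(** [f] is differentiable on the closed disk of radius [r] and centre [x] in
    the complex direction [v]. *)
Definition disk_in x := forall z : C, nrm z <= r -> differentiable f (x + z *: v).

Lemma cont_on_circle_line x : disk_in x ->
  cont_on (fun t => f (x + (RC r * cis t) *: v)) 0 (2 * pi).
Proof.
move=> hx; apply: (@cont_on_circle _ (fun q : C => f (x + q *: v)) r r0).
by move=> z zr; exists ('D_v f (x + z *: v)); apply: line_hasd; apply: hx.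
Qed.

Lemma cmean_derive x : disk_in x ->
  cmean (fun t => f (x + (RC r * cis t) *: v) * ucis t) = RC r * 'D_v f x.
Proof.
move=> hx; have d (z : C) : nrm z <= r -> hasd (fun q : C => f (x + q *: v)) z ('D_v f (x + z *: v)).
  by move=> zr; apply: line_hasd; apply: hx.
rewrite (@cauchy_coef1 _ (fun q : C => f (x + q *: v)) r r0 _ ('D_v f x)) //.
  by move=> z /d; exists ('D_v f (x + z *: v)).
by have := d 0; rewrite nrm0 scale0r addr0; apply; apply: ltW.
Qed.

Lemma cauchy_estimate x (M : R) : disk_in x ->
  (forall t, nrm (f (x + (RC r * cis t) *: v)) <= M) -> nrm ('D_v f x) <= M / r.
Proof.
move=> hx fM; rewrite ler_pdivlMr // mulrC.
have -> : r * nrm ('D_v f x) = nrm (RC r * 'D_v f x) by rewrite nrmM nrmR gtr0_norm.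
rewrite -cmean_derive //; apply: cmean_bound.
  by apply: cont_onM; [exact: cont_on_circle_line|exact: cont_on_ucis].
by move=> t; rewrite nrmM nrm_ucis mulr1.
Qed.

(** Cauchy's estimate for the difference of the derivatives at two points. *)
Lemma cauchy_estimate2 x y (M : R) : disk_in x -> disk_in y ->
  (forall t, nrm (f (y + (RC r * cis t) *: v) - f (x + (RC r * cis t) *: v)) <= M) ->
  nrm ('D_v f y - 'D_v f x) <= M / r.
Proof.
move=> hx hy fM; rewrite ler_pdivlMr // mulrC.
have -> : r * nrm ('D_v f y - 'D_v f x) = nrm (RC r * ('D_v f y - 'D_v f x)).
  by rewrite nrmM nrmR gtr0_norm.
have cx : cont_on (fun t => f (x + (RC r * cis t) *: v) * ucis t) 0 (2 * pi).
  by apply: cont_onM; [exact: cont_on_circle_line|exact: cont_on_ucis].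
have cy : cont_on (fun t => f (y + (RC r * cis t) *: v) * ucis t) 0 (2 * pi).
  by apply: cont_onM; [exact: cont_on_circle_line|exact: cont_on_ucis].
have -> : RC r * ('D_v f y - 'D_v f x) =
   cmean (fun t => f (y + (RC r * cis t) *: v) * ucis t +
                   -1 * (f (x + (RC r * cis t) *: v) * ucis t)).
  rewrite (cmeanD cy (cont_onZ _ cx)) (cmeanZ _ cx) mulrBr -mulN1r.
  congr (_ + _ * _); [exact: esym (cmean_derive hy)|exact: esym (cmean_derive hx)].
apply: cmean_bound; first by apply: cont_onD => //; exact: cont_onZ.
move=> t; apply: le_trans (fM t); rewrite mulN1r -mulrBl nrmM nrm_ucis mulr1 //.
Qed.
End CenterFormula.

(** The mean value inequality along a segment. *)
Lemma segment_bound f x v (K : R) :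
  (forall t : R, 0 <= t <= 1 -> differentiable f (x + RC t *: v)) ->
  (forall t : R, 0 <= t <= 1 -> nrm ('D_v f (x + RC t *: v)) <= K) ->
  nrm (f (x + v) - f x) <= K.
Proof.
move=> df hK.
have dl : der_on (fun t => RC t : C) (fun=> 1) 0 1.
  have := @der_on_lin R 0 1 0 1; by under eq_fun do rewrite add0r mulr1.
have := der_on_comp (P := fun q : C => f (x + q *: v))
  (p := fun t => 'D_v f (x + RC t *: v)) dl.
move=> H; have {}H := H (fun t ht => line_hasd (df t ht)).
have := der_on_bound ler01 H; rewrite scale1r scale0r addr0 subr0 => /(_ K).
by rewrite mulr1; apply => t /hK; rewrite mulr1.
Qed.

Section Local.
Variables (f : V -> C) (x0 : V) (s M : R).
Hypothesis s0 : (0 : R) < s.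
Hypothesis df : forall y, nrm (y - x0) < 4 * s -> differentiable f y.
Hypothesis fM : forall y, nrm (y - x0) < 4 * s -> nrm (f y) <= M.

Let M0 : 0 <= M.
Proof. by apply: le_trans (nrm_ge0 _) (fM (y := x0) _); rewrite subrr nrm0 mulr_gt0. Qed.

Let K := M * 2 / s.
Let K0 : 0 <= K. Proof. by rewrite /K divr_ge0 ?mulr_ge0 // ltW. Qed.

(* The vectors [q *: v] with [nrm q <= rad v] have norm at most [s / 2]. *)
Let rad v := s / (2 * nrm v).

Let rad_gt0 v : v != 0 -> 0 < rad v.
Proof. by move=> v0; rewrite /rad divr_gt0 // mulr_gt0 // nrm_gt0. Qed.

Let rad_nrm v (z : C) : v != 0 -> nrm z <= rad v -> nrm (z *: v) <= s / 2.
Proof.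
move=> v0 hz; rewrite nrmZ.
have -> : s / 2 = rad v * nrm v by rewrite /rad; field; rewrite gt_eqF // nrm_gt0.
by rewrite ler_wpM2r // nrm_ge0.
Qed.

Let in_ball y w (a b c : R) : nrm (y - x0) < a -> nrm w <= b -> a + b <= c ->
  nrm (y + w - x0) < c.
Proof.
move=> ya wb abc; rewrite addrAC; apply: le_lt_trans (nrmD _ _) _.
by apply: lt_le_trans abc; apply: ltr_leD.
Qed.

Lemma local_derive_bound y v : nrm (y - x0) < 3 * s ->
  nrm ('D_v f y) <= K * nrm v.
Proof.
move=> hy; have [->|v0] := eqVneq v 0; first by rewrite derive0 !nrm0 mulr0.
have ib (z : C) : nrm z <= rad v -> nrm (y + z *: v - x0) < 4 * s.
  by move=> hz; apply: in_ball hy (rad_nrm v0 hz) _; have := s0; lra.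
have -> : K * nrm v = M / rad v by rewrite /K /rad; field; rewrite !gt_eqF // nrm_gt0.
apply: cauchy_estimate; first exact: rad_gt0.
- by move=> z /ib /df.
- move=> t; apply: fM; apply: ib.
  by rewrite nrm_circle // rad_gt0.
Qed.

Let convex y v (t c : R) : nrm (y - x0) < c -> nrm (y + v - x0) < c -> 0 <= t <= 1 ->
  nrm (y + RC t *: v - x0) < c.
Proof.
move=> h1 h2 /andP[t0 t1].
have -> : y + RC t *: v - x0 = RC (1 - t) *: (y - x0) + RC t *: (y + v - x0).
  have -> : y + v - x0 = (y - x0) + v by rewrite addrAC.
  by rewrite [LHS]addrAC rmorphB /= scalerBl scale1r (scalerDr _ _ v) addrA subrK.
apply: le_lt_trans (nrmD _ _) _; rewrite !nrmZ !nrmR !ger0_norm ?subr_ge0 //.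
have [->|tn1] := eqVneq t 1; first by rewrite subrr mul0r add0r mul1r.
have -> : c = (1 - t) * c + t * c by ring.
apply: ltr_leD; last by rewrite ler_wpM2l // ltW.
by rewrite ltr_pM2l // subr_gt0 lt_neqAle tn1.
Qed.

Lemma local_lipschitz y v : nrm (y - x0) < 3 * s -> nrm (y + v - x0) < 3 * s ->
  nrm (f (y + v) - f y) <= K * nrm v.
Proof.
move=> h1 h2; apply: segment_bound => t ht.
- apply: df; apply: lt_trans (convex h1 h2 ht) _; rewrite ltr_pM2r //; have := s0; lra.
- by apply: local_derive_bound; apply: convex.
Qed.

Let K2 := K * 2 / s.
Let K20 : 0 <= K2.
Proof. by apply: divr_ge0; [apply: mulr_ge0; [exact: K0|]|exact: ltW]. Qed.

Lemma local_derive_lipschitz y w v : nrm (y - x0) < 2 * s -> nrm (y + w - x0) < 2 * s ->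
  nrm ('D_v f (y + w) - 'D_v f y) <= K2 * nrm w * nrm v.
Proof.
move=> h1 h2; have [->|v0] := eqVneq v 0.
  by rewrite !derive0 subrr !nrm0 mulr0.
have ib y' (z : C) : nrm (y' - x0) < 2 * s -> nrm z <= rad v -> nrm (y' + z *: v - x0) < 3 * s.
  by move=> hy hz; apply: in_ball hy (rad_nrm v0 hz) _; have := s0; lra.
have l34 : 3 * s < 4 * s by rewrite ltr_pM2r //; have := s0; lra.
have -> : K2 * nrm w * nrm v = K * nrm w / rad v.
  by rewrite /K2 /rad; field; rewrite !gt_eqF // nrm_gt0.
apply: cauchy_estimate2; first exact: rad_gt0.
- by move=> z /(ib _ _ h1) h; apply: df; apply: lt_trans l34.
- by move=> z /(ib _ _ h2) h; apply: df; apply: lt_trans l34.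
- move=> t; have hz : nrm (RC (rad v) * cis t) <= rad v by rewrite nrm_circle // rad_gt0.
  rewrite [y + w + _]addrAC; apply: local_lipschitz; first exact: ib.
  by rewrite [y + _ + w]addrAC; apply: ib.
Qed.

(** A uniform second order estimate of the remainder. *)
Lemma local_taylor y v : nrm (y - x0) < 2 * s -> nrm (y + v - x0) < 2 * s ->
  nrm (f (y + v) - f y - 'D_v f y) <= K2 * nrm v ^+ 2.
Proof.
move=> h1 h2.
have l24 : 2 * s < 4 * s by rewrite ltr_pM2r //; have := s0; lra.
have dl : der_on (fun t => RC t : C) (fun=> 1) 0 1.
  have := @der_on_lin R 0 1 0 1; by under eq_fun do rewrite add0r mulr1.
have := der_on_comp (P := fun q : C => f (y + q *: v))
  (p := fun t => 'D_v f (y + RC t *: v)) dl.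
move=> H; have {}H := H (fun t ht => line_hasd (df (lt_trans (convex h1 h2 ht) l24))).
have := der_on_bound ler01 (der_onD H (@der_on_lin R 0 (- 'D_v f y) 0 1)).
move=> /(_ (K2 * nrm v ^+ 2)).
rewrite !add0r scale1r scale0r addr0 subr0 mulr1 mul0r addr0 mul1r addrAC.
apply => t ht; rewrite mulr1.
apply: le_trans (local_derive_lipschitz v h1 (convex h1 h2 ht)) _.
rewrite expr2 mulrA ler_wpM2r ?nrm_ge0 // ler_wpM2l // nrmZ nrmR.
rewrite ler_piMl ?nrm_ge0 //; case/andP: ht => t0 t1; rewrite ger0_norm //.
Qed.

(** Differentiation of Cauchy's formula under the integral sign. *)
Lemma local_differentiable_derive e : differentiable (fun w => 'D_e f w) x0.
Proof.
pose r := s / (2 * (1 + nrm e)).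
have A0 : 0 < 1 + nrm e by rewrite ltr_pwDl // nrm_ge0.
have r0 : 0 < r by rewrite /r divr_gt0 // mulr_gt0.
have rc0 : RC r != 0 by rewrite RC_neq0 gt_eqF.
have re (z : C) : nrm z <= r -> nrm (z *: e) <= s / 2.
  move=> hz; rewrite nrmZ.
  have -> : s / 2 = r * (1 + nrm e) by rewrite /r; field; rewrite gt_eqF.
  by apply: ler_pM; rewrite ?nrm_ge0 // lerDr.
pose p t := x0 + (RC r * cis t) *: e.
have pb t : nrm (p t - x0) <= s / 2.
  by rewrite /p addrAC subrr add0r; apply: re; rewrite nrm_circle.
have s12 : s / 2 < s by have := s0; lra.
have lin y : nrm (y - x0) < 4 * s -> forall a u v, 'D_(a *: u + v) f y = a * 'D_u f y + 'D_v f y.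
  by move=> hy a u v; rewrite !deriveE ?linearP //; apply: df.
have cD v : cont_on (fun t => 'D_v f (p t)) 0 (2 * pi).
  apply: (@cont_on_comp _ (fun q : C => 'D_v f (x0 + q *: e)) (fun t => RC r * cis t)).
    by apply: cont_onZ; exact: cont_on_cis.
  move=> t _ eps eps0; set q := RC r * cis t.
  pose B := 1 + K2 * nrm e * nrm v.
  have B0 : 0 < B.
    rewrite ltr_pwDl //; apply: mulr_ge0; last exact: nrm_ge0.
    by apply: mulr_ge0; [exact: K20|exact: nrm_ge0].
  exists (Num.min r (eps / B)); first by rewrite lt_min r0 divr_gt0.
  move=> h; rewrite lt_min => /andP[hr]; rewrite ltr_pdivlMr // => hB.
  have h1 : nrm (x0 + q *: e - x0) < s.
    exact: le_lt_trans (pb t) s12.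
  rewrite scalerDl addrA; apply: le_trans (local_derive_lipschitz _ _ _) _.
  - apply: lt_trans h1 _; have := s0; lra.
  - by apply: in_ball h1 (re _ (ltW hr)) _; have := s0; lra.
  - rewrite nrmZ; apply: le_trans (ltW hB).
    have -> : K2 * (nrm h * nrm e) * nrm v = nrm h * (K2 * nrm e * nrm v) by ring.
    by rewrite ler_wpM2l ?nrm_ge0 // /B lerDr.
have cDu v : cont_on (fun t => 'D_v f (p t) * ucis t) 0 (2 * pi).
  by apply: cont_onM => //; exact: cont_on_ucis.
(* The candidate for the differential at [x0]: the mean over the circle
   of the differentials of [f] in the direction [v]. *)
pose L v : C := (RC r)^-1 * cmean (fun t => 'D_v f (p t) * ucis t).
have p4 t : nrm (p t - x0) < 4 * s.
  by apply: le_lt_trans (pb t) _; have := s0; lra.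
have linL : linear L.
  move=> a u v; rewrite /L.
  have E t : 'D_(a *: u + v) f (p t) * ucis t =
     a * ('D_u f (p t) * ucis t) + 'D_v f (p t) * ucis t.
    by rewrite (lin _ (p4 t)) mulrDl -mulrA.
  apply: etrans (congr1 (fun q => (RC r)^-1 * q) (cmean_lin (cDu u) (cDu v) E)) _.
  by rewrite mulrDr mulrCA.
pose LM := GRing.isLinear.Build _ _ _ _ _ linL.
pose LL : {linear V -> C} := HB.pack L LM.
have Lb v : nrm (L v) <= K / r * nrm v.
  rewrite /L nrmM nrmV nrmR gtr0_norm // mulrAC ler_pdivrMl // mulrCA mulfV ?gt_eqF // mulr1.
  apply: cmean_bound => // t; rewrite nrmM nrm_ucis mulr1.
  apply: local_derive_bound; apply: le_lt_trans (pb t) _; have := s0; lra.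
have cL : continuous LL.
  move=> z; apply/contcP => eps eps0.
  pose B := 1 + K / r; have B0 : 0 < B by rewrite ltr_pwDl // divr_ge0 // ltW.
  exists (eps / B); first exact: divr_gt0.
  move=> h; rewrite ltr_pdivlMr // => hB; rewrite -linearB /= addrAC subrr add0r.
  apply: le_trans (Lb h) _; apply: le_trans (ltW hB).
  by rewrite mulrC ler_wpM2l ?nrm_ge0 // /B lerDr.
apply: (proj1 (eps_differentiable cL _)) => _ /gt0_real[eps eps0 ->].
pose B := 1 + K2 / r; have B0 : 0 < B by rewrite ltr_pwDl // divr_ge0 // ltW.
exists (Num.min s (eps / B))%:C; first by rewrite ltcR lt_min s0 divr_gt0.
move=> h; rewrite nrm_lt lt_min => /andP[hs]; rewrite ltr_pdivlMr // => hB.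
rewrite !nrmE -rmorphM /= lecR.
have hin (z : C) : nrm z <= r -> nrm (x0 + h + z *: e - x0) < 2 * s.
  move=> hz; have h1 : nrm (x0 + h - x0) < s by rewrite addrAC subrr add0r.
  by apply: in_ball h1 (re _ hz) _; have := s0; lra.
have xin (z : C) : nrm z <= r -> nrm (x0 + z *: e - x0) < 2 * s.
  move=> hz; have h1 : nrm (x0 - x0) < s by rewrite subrr nrm0.
  by apply: in_ball h1 (re _ hz) _; have := s0; lra.
have l24 : 2 * s < 4 * s by rewrite ltr_pM2r //; have := s0; lra.
have d1 : disk_in f e r (x0 + h) by move=> z /hin hz; apply: df; apply: lt_trans l24.
have d2 : disk_in f e r x0 by move=> z /xin hz; apply: df; apply: lt_trans l24.
pose g1 t := f (x0 + h + (RC r * cis t) *: e) * ucis t.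
pose g2 t := f (p t) * ucis t.
pose g3 t := 'D_h f (p t) * ucis t.
have c1 : cont_on g1 0 (2 * pi).
  by apply: cont_onM; [exact: cont_on_circle_line|exact: cont_on_ucis].
have c2 : cont_on g2 0 (2 * pi).
  by apply: cont_onM; [exact: cont_on_circle_line|exact: cont_on_ucis].
have c3 : cont_on g3 0 (2 * pi) by exact: cDu.
(* By Cauchy's formula the remainder is the mean of the remainders of [f]
   at the points of the circle. *)
have -> : 'D_e f (x0 + h) - 'D_e f x0 - L h = (RC r)^-1 *
   cmean (fun t => g1 t + (-1 * g2 t + -1 * g3 t)).
  rewrite (cmeanD c1 (cont_onD (cont_onZ _ c2) (cont_onZ _ c3))).
  rewrite (cmeanD (cont_onZ _ c2) (cont_onZ _ c3)) (cmeanZ _ c2) (cmeanZ _ c3).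
  have -> : cmean g1 = RC r * 'D_e f (x0 + h) by exact: cmean_derive.
  have -> : cmean g2 = RC r * 'D_e f x0 by exact: cmean_derive.
  have -> : L h = (RC r)^-1 * cmean g3 by [].
  by move: ('D_e f _) ('D_e f _) (cmean _) => a b c; field; exact: rc0.
rewrite nrmM nrmV nrmR gtr0_norm // ler_pdivrMl //.
have -> : r * (eps * nrm h) = r * eps * nrm h by ring.
apply: (@le_trans _ _ (K2 * nrm h ^+ 2)).
  apply: cmean_bound.
    by apply: cont_onD c1 (cont_onD (cont_onZ _ c2) (cont_onZ _ c3)).
  move=> t; have -> : g1 t + (-1 * g2 t + -1 * g3 t) =
    (f (p t + h) - f (p t) - 'D_h f (p t)) * ucis t.
    rewrite /g1 /g2 /g3 /p [x0 + h + _]addrAC.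
    by move: (f _) (f _) ('D_h f _) (ucis t) => a b c g; ring.
  rewrite nrmM nrm_ucis mulr1.
  apply: local_taylor; first by apply: xin; rewrite nrm_circle.
  by rewrite /p [x0 + _ + h]addrAC; apply: hin; rewrite nrm_circle.
rewrite expr2 mulrA ler_wpM2r ?nrm_ge0 //.
have : K2 / r * nrm h <= eps.
  apply: le_trans (ltW hB); rewrite mulrC ler_wpM2l ?nrm_ge0 // /B lerDr //.
by rewrite mulrAC ler_pdivrMr // [eps * r]mulrC.
Qed.
End Local.

(** The directional derivatives of a function that is complex differentiable
    on an open set are complex differentiable on that set. *)
Theorem holomorphic_derive (A : set V) f e : open A -> holomorphic_on A f ->
  holomorphic_on A (fun w => 'D_e f w).
Proof.
move=> oA hf x Ax.
have /nbhs_normP[_ /= /gt0_real[a a0 ->] aA] : nbhs x A by exact: open_nbhs_nbhs.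
have [d d0 H] := (proj2 (contcP f x) (differentiable_continuous (hf x Ax))) 1 ltr01.
pose s := Num.min a d / 4.
have s0 : 0 < s by rewrite divr_gt0 // lt_min a0.
have s4 : 4 * s = Num.min a d by rewrite /s; field.
apply: (@local_differentiable_derive f x s (nrm (f x) + 1) s0).
- move=> y; rewrite s4 lt_min => /andP[ya _]; apply: hf; apply: aA.
  by rewrite /= nrm_lt nrmBC.
- move=> y; rewrite s4 lt_min => /andP[_ /H]; rewrite subrKC => h.
  have -> : f y = f x + (f y - f x) by rewrite subrKC.
  by apply: le_trans (nrmD _ _) _; rewrite lerD2l.
Qed.
End HolomorphicDerivative.

(** * Coefficients of Schwarz functions *)

Section Schwarz.
Context {R : realType}.
Local Notation C := (Cplx R).
Local Notation RC t := (t%:C : C).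
Local Notation D := (fun f : C -> C => (fun z => 'D_1 f z)).

(** Taylor's formula of order 2 at 0. *)
Lemma taylor2 (phi dphi : C -> C) (r : R) (m : C) : 0 < r ->
  (forall z : C, nrm z < r -> hasd phi z (dphi z)) -> hasd dphi 0 m ->
  forall e : R, 0 < e -> exists2 d : R, 0 < d & forall h : C, nrm h < d ->
     nrm (phi h - phi 0 - h * dphi 0 - h ^+ 2 * (m / 2)) <= e * nrm h ^+ 2.
Proof.
move=> r0 hphi hm e e0; have [d d0 H] := hm e e0.
exists (Num.min r d); first by rewrite lt_min r0.
move=> h; rewrite lt_min => /andP[hr hd].
have dl : der_on (fun t => RC t * h) (fun=> h) 0 1.
  have := @der_on_lin R 0 h 0 1; by under eq_fun do rewrite add0r.
have small t : 0 <= t <= 1 -> nrm (RC t * h) <= nrm h.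
  move=> /andP[t0 t1]; rewrite nrmM nrmR ger0_norm //.
  by rewrite ler_piMl // nrm_ge0.
have dG := der_on_comp dl (fun t ht => hphi _ (le_lt_trans (small t ht) hr)).
have dQ (z : C) : hasd (fun q => - (dphi 0) * q + - (m / 2) * (q * q)) z (- dphi 0 - m * z).
  have -> : - dphi 0 - m * z = - (dphi 0) * 1 + - (m / 2) * (1 * z + z * 1) by field.
  by apply: hasdD (hasdZ _ (hasd_id _)) (hasdZ _ (hasdM (hasd_id _) (hasd_id _))).
have dH := der_onD dG (der_on_comp dl (fun t _ => dQ (RC t * h))).
have := der_on_bound ler01 dH.
move=> /(_ (e * nrm h ^+ 2)); rewrite subr0 mulr1.
have -> : phi (1%:C * h) + (- dphi 0 * (1%:C * h) + - (m / 2) * (1%:C * h * (1%:C * h))) -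
    (phi (0%:C * h) + (- dphi 0 * (0%:C * h) + - (m / 2) * (0%:C * h * (0%:C * h)))) =
   phi h - phi 0 - h * dphi 0 - h ^+ 2 * (m / 2).
  by rewrite mul1r !mul0r; ring.
apply=> t ht.
have -> : dphi (t%:C * h) * h + (- dphi 0 - m * (t%:C * h)) * h =
  (dphi (0 + t%:C * h) - dphi 0 - (t%:C * h) * m) * h by rewrite add0r; ring.
rewrite nrmM expr2 mulrA ler_wpM2r ?nrm_ge0 //.
apply: le_trans (H _ (le_lt_trans (small t ht) hd)) _.
by rewrite ler_wpM2l ?(ltW e0) // small.
Qed.

Lemma open_nrm_lt (r : R) : open [set z : C | nrm z < r].
Proof.
rewrite openE => z /= zr.
suff h : \forall w \near (z : C), nrm (w : C) < r by exact: h.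
apply/nbhs_normP.
exists (r - nrm z)%:C; first by rewrite /= ltcR subr_gt0.
move=> w /=; rewrite nrm_lt nrmBC => h.
have -> : w = z + (w - z) by rewrite subrKC.
by apply: le_lt_trans (nrmD _ _) _; rewrite -ltrBrDl.
Qed.

Lemma disk_nbhd (q : C) : nrm q < 1 ->
  exists2 d : R, 0 < d & forall h : C, nrm h < d -> nrm (q + h) < 1.
Proof.
move=> q1; exists (1 - nrm q); first by rewrite subr_gt0.
by move=> h hh; apply: le_lt_trans (nrmD _ _) _; rewrite -ltrBrDl.
Qed.

Lemma holomorphic_derive1 (A : set C) (f : C -> C) : open A -> holomorphic_on A f ->
  holomorphic_on A (D f).
Proof. exact: holomorphic_derive. Qed.

Lemma cmean_Re_ge0 (f : R -> C) : cont_on f 0 (2 * pi) ->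
  (forall t, 0 <= complex.Re (f t)) -> 0 <= complex.Re (cmean f).
Proof.
move=> cf f0; have pi0 : 0 <= 2 * pi :> R by rewrite mulr_ge0 // pi_ge0.
have [F dF] := primitive_exists pi0 cf.
rewrite /cmean (intgE pi0 dF) -fmorphV ReRM ReB mulr_ge0 ?invr_ge0 // subr_ge0.
exact: der_on_Re_ge0 dF _.
Qed.

Lemma mul_conj (z : C) : z * (z^*)%C = RC (nrm z ^+ 2).
Proof.
rewrite nrm_sqr; case: z => a b.
by apply/eqP; rewrite eq_complex /=; apply/andP; split; apply/eqP; ring.
Qed.

Lemma Re_conj (z : C) : RC (2 * complex.Re z) = z + (z^*)%C.
Proof.
case: z => a b; apply/eqP; rewrite eq_complex /=.
by apply/andP; split; apply/eqP; ring.
Qed.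

Lemma conj_cis t : ((cis t)^*)%C = (cis t)^-1 :> C.
Proof.
apply: (mulfI (cis_neq0 t)); rewrite mul_conj nrm_cis expr1n.
by rewrite mulfV // cis_neq0.
Qed.

Lemma ucisE t : ucis t = (cis t)^-1 :> C.
Proof. by apply: (mulfI (cis_neq0 t)); rewrite cis_ucis mulfV // cis_neq0. Qed.

(** Pointwise form of Bessel's identity. For [u] on the unit circle, [K] has
    real part [|X|^2 - |H|^2 + |G|^2]; it is affine in [H], so its mean over
    the circle is computable when [H] has known coefficients. *)
Lemma bessel_identity (x y a b H u : C) (r : R) : u != 0 -> (u^*)%C = u^-1 ->
  let K := x * (x^*)%C + y * (y^*)%C * RC r ^+ 2 + a * (a^*)%C + b * (b^*)%C
    + (2 * ((x^*)%C * y * RC r + (a^*)%C * b) * u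
    + (- (2 * (a^*)%C) * (H * u^-1) + - (2 * (b^*)%C) * (H * u^-1 ^+ 2))) in
  let X := x + y * (RC r * u) in let G := H - a * u - b * u ^+ 2 in
  K + (K^*)%C = 2 * (X * (X^*)%C - H * (H^*)%C + G * (G^*)%C).
Proof.
move=> u0 uc /=.
have cD (z w : C) : ((z + w)^*)%C = (z^*)%C + (w^*)%C by exact: rmorphD.
have cM (z w : C) : ((z * w)^*)%C = (z^*)%C * (w^*)%C by exact: rmorphM.
have cN (z : C) : ((- z)^*)%C = - (z^*)%C by exact: rmorphN.
have cX (z : C) n : ((z ^+ n)^*)%C = (z^*)%C ^+ n by exact: rmorphXn.
have cV (z : C) : ((z^-1)^*)%C = (z^*)%C^-1 by exact: conjc_inv.
have cK (z : C) : ((z^*)^*)%C = z by exact: conjcK.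
have cr : ((RC r)^*)%C = RC r by exact: conjc_real.
have c2 : ((2 : C)^*)%C = 2 by exact: conjc_nat.
rewrite !(cD, cM, cN, cX, cV, cK, cr, c2, uc) invrK.
by move: (x^*)%C (y^*)%C (a^*)%C (b^*)%C (H^*)%C => xc yc ac bc Hc; field.
Qed.

(** Bessel's inequality for the coefficients [l], [m] of order 1 and 2 of [h],
    on a circle where [h] is dominated by the polynomial [x + y z]. *)
Lemma bessel2 (h : C -> C) (x y l m : C) (r : R) : 0 < r ->
  (forall z : C, nrm z <= r -> exists l', hasd h z l') -> hasd h 0 l ->
  (forall e : R, 0 < e -> exists2 d : R, 0 < d & forall z : C, nrm z < d ->
     nrm (h z - h 0 - z * l - z ^+ 2 * m) <= e * nrm z ^+ 2) ->
  (forall z : C, nrm z <= r -> nrm (h z) <= nrm (x + y * z)) ->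
  nrm l ^+ 2 * r ^+ 2 + nrm m ^+ 2 * r ^+ 4 <= nrm x ^+ 2 + nrm y ^+ 2 * r ^+ 2.
Proof.
move=> r0 dh hl hm hb.
pose a : C := RC r * l; pose b : C := RC r ^+ 2 * m.
pose H t := h (RC r * cis t).
have e1 := cauchy_coef1 r0 dh hl; have e2 := cauchy_coef2 r0 dh hl hm.
have cH : cont_on H 0 (2 * pi) by exact: (cont_on_circle r0 dh).
pose k0 : C := x * (x^*)%C + y * (y^*)%C * RC r ^+ 2 + a * (a^*)%C + b * (b^*)%C.
pose K t := k0 + (2 * ((x^*)%C * y * RC r + (a^*)%C * b) * cis t
   + (- (2 * (a^*)%C) * (H t * ucis t) + - (2 * (b^*)%C) * (H t * ucis t ^+ 2))).
have cu := @cont_on_ucis R 0 (2 * pi).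
have cc := @cont_on_cis R 0 (2 * pi).
have c1 : cont_on (fun t => H t * ucis t) 0 (2 * pi) by exact: cont_onM.
have c2 : cont_on (fun t => H t * ucis t ^+ 2) 0 (2 * pi).
  by apply: cont_onM => //; apply: cont_onM.
have cK : cont_on K 0 (2 * pi).
  apply: cont_onD; first exact: cont_on_cst.
  apply: cont_onD; first exact: cont_onZ.
  by apply: cont_onD; apply: cont_onZ.
have KE : cmean K = k0 - 2 * (a * (a^*)%C) - 2 * (b * (b^*)%C).
  rewrite /K cmeanD ?cmean_cst; [|exact: cont_on_cst|]; last first.
    apply: cont_onD; first exact: cont_onZ.
    by apply: cont_onD; apply: cont_onZ.
  rewrite cmeanD; [|exact: cont_onZ|by apply: cont_onD; apply: cont_onZ].
  rewrite cmeanD; [|exact: cont_onZ|exact: cont_onZ].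
  rewrite !cmeanZ // cmean_cis /H e1 e2 -/a -/b.
  by move: (a^*)%C (b^*)%C => ac bc; ring.
(* The real part of [K] is [|x + y z|^2 - |h|^2 + |h - a u - b u^2|^2] with
   [z = r u] and [u = cis t], which is nonnegative on the circle. *)
have Kpos t : 0 <= complex.Re (K t).
  rewrite -(pmulr_rge0 _ (ltr0Sn R 1)).
  have -> : 2 * complex.Re (K t) = 2 * (nrm (x + y * (RC r * cis t)) ^+ 2
     - nrm (H t) ^+ 2 + nrm (H t - a * cis t - b * cis t ^+ 2) ^+ 2).
    pose X := x + y * (RC r * cis t); pose G := H t - a * cis t - b * cis t ^+ 2.
    have E : K t + ((K t)^*)%C = 2 * (X * (X^*)%C - H t * ((H t)^*)%C + G * (G^*)%C).
      by rewrite /K ucisE; apply: bessel_identity; [exact: cis_neq0|exact: conj_cis].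
    apply: complexI; rewrite Re_conj E !mul_conj.
    have RCl (p q s : R) : RC (2 * (p - q + s)) = 2 * (RC p - RC q + RC s).
      by rewrite [LHS]rmorphM [X in _ * X]rmorphD [X in _ * (X + _)]rmorphB /= rmorph_nat.
    exact/esym/RCl.
  rewrite mulr_ge0 // addr_ge0 ?sqr_ge0 // subr_ge0 lerXn2r ?nnegrE ?nrm_ge0 //.
  by apply: hb; rewrite nrm_circle.
have := cmean_Re_ge0 cK Kpos; rewrite KE /k0 !mul_conj.
have hn (w : C) (n : nat) : RC r ^+ n = RC (r ^+ n) by rewrite rmorphXn.
have -> : RC (nrm x ^+ 2) + RC (nrm y ^+ 2) * RC r ^+ 2 + RC (nrm a ^+ 2) + RC (nrm b ^+ 2)
   - 2 * RC (nrm a ^+ 2) - 2 * RC (nrm b ^+ 2) =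
   RC (nrm x ^+ 2 + nrm y ^+ 2 * r ^+ 2 - nrm a ^+ 2 - nrm b ^+ 2).
  rewrite [in RHS]rmorphB [in RHS]rmorphB [in RHS]rmorphD [in RHS]rmorphM [in RHS]rmorphXn /=.
  ring.
have na : nrm a = r * nrm l by rewrite /a nrmM nrmR gtr0_norm.
have nb : nrm b = r ^+ 2 * nrm m by rewrite /b nrmM nrmX nrmR gtr0_norm.
rewrite /= na nb => H1.
have -> : nrm l ^+ 2 * r ^+ 2 = (r * nrm l) ^+ 2 by ring.
have -> : nrm m ^+ 2 * r ^+ 4 = (r ^+ 2 * nrm m) ^+ 2 by ring.
by move: H1; set p := (r * _) ^+ 2; set q := (r ^+ 2 * _) ^+ 2; lra.
Qed.

(** Passage to the limit of radius 1 in Bessel's inequality. *)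
Lemma le_at_radius1 (A B X Y : R) : 0 <= A -> 0 <= B -> 0 <= Y ->
  (forall r : R, 0 < r -> r < 1 -> A * r ^+ 2 + B * r ^+ 4 <= X + Y * r ^+ 2) ->
  A + B <= X + Y.
Proof.
move=> A0 B0 Y0 H; apply/ler_addgt0Pr => e e0.
pose d := Num.min (2^-1) (e / (4 * (A + B + 1))).
have S0 : 0 < A + B + 1 by rewrite ltr_wpDl // addr_ge0.
have d0 : 0 < d by rewrite lt_min invr_gt0 ltr0n divr_gt0 // mulr_gt0.
have d1 : d <= 2^-1 by rewrite ge_min lexx.
have d2 : 4 * (A + B + 1) * d <= e.
  by rewrite mulrC -ler_pdivlMr ?mulr_gt0 // ge_min lexx orbT.
have r0 : 0 < 1 - d by lra.
have r1 : 1 - d < 1 by lra.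
have := H _ r0 r1; set r := 1 - d in r0 r1 *.
have r2 : r ^+ 2 <= 1 by rewrite expr_le1 // ltW.
have r2' : 1 - 2 * d <= r ^+ 2.
  have : 0 <= d ^+ 2 by rewrite sqr_ge0.
  rewrite /r; have -> : (1 - d) ^+ 2 = 1 - 2 * d + d ^+ 2 by ring.
  lra.
have r4 : 1 - 4 * d <= r ^+ 4.
  have -> : r ^+ 4 = r ^+ 2 * r ^+ 2 by ring.
  apply: (@le_trans _ _ ((1 - 2 * d) * (1 - 2 * d))).
    have : 0 <= d ^+ 2 by rewrite sqr_ge0.
    have -> : (1 - 2 * d) * (1 - 2 * d) = 1 - 4 * d + 4 * d ^+ 2 by ring.
    lra.
  by apply: ler_pM => //; lra.
have a1 := ler_wpM2l A0 r2'; have a2 := ler_wpM2l B0 r4; have a3 := ler_wpM2l Y0 r2.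
have a4 : 0 <= A * d by rewrite mulr_ge0 // ltW.
rewrite mulr1 in a3.
have a5 : A * (1 - 2 * d) = A - 2 * (A * d) by ring.
have a6 : B * (1 - 4 * d) = B - 4 * (B * d) by ring.
have a7 : 4 * (A + B + 1) * d = 4 * (A * d) + 4 * (B * d) + 4 * d by ring.
lra.
Qed.

(** The inequality holds for the quadratic form at every [t]; the best choice
    is [t = a c / (1 - a^2)]. *)
Lemma coef_bound_real (a c : R) : 0 <= a -> 0 <= c ->
  (forall t : R, 0 <= t -> a ^+ 2 + (c + t * a) ^+ 2 <= 1 + t ^+ 2) ->
  c <= 1 - a ^+ 2.
Proof.
move=> a0 c0 H; have := H 0 (lexx _); rewrite mul0r addr0 expr0n /= addr0 => h0.
set d := 1 - a ^+ 2; have c2d : c ^+ 2 <= d by rewrite /d; lra.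
have d0 : 0 <= d by apply: le_trans c2d; rewrite sqr_ge0.
have [dz|dn] := eqVneq d 0.
  have : c ^+ 2 <= 0 by rewrite -dz.
  rewrite exprn_even_le0 //= => /eqP ->; by rewrite dz.
have dp : 0 < d by rewrite lt_neqAle eq_sym dn.
have t0 : 0 <= a * c / d by rewrite divr_ge0 // mulr_ge0.
have := H _ t0; have aE : a ^+ 2 = 1 - d by rewrite /d; ring.
have -> : a ^+ 2 + (c + a * c / d * a) ^+ 2 = 1 - d + (c / d) ^+ 2.
  rewrite -aE; congr (_ + _ ^+ 2).
  have -> : c + a * c / d * a = (c * (d + a ^+ 2)) / d by field.
  by rewrite aE; field.
have -> : (a * c / d) ^+ 2 = (1 - d) * (c / d) ^+ 2 by rewrite -aE; field.
move=> h; have h3 : d * (c / d) ^+ 2 <= d.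
  have : (1 - d) * (c / d) ^+ 2 = (c / d) ^+ 2 - d * (c / d) ^+ 2 by ring.
  lra.
have h4 : (c / d) ^+ 2 <= 1 by rewrite -(ler_pM2l dp) mulr1.
rewrite expr_le1 ?divr_ge0 // in h4.
by rewrite ler_pdivrMr // mul1r in h4.
Qed.

(** The second coefficient [c2] of a holomorphic function on the unit disk
    that is bounded by 1 and vanishes at 0. *)
Theorem schwarz_coef (om : C -> C) (c2 : C) : holomorphic_on (@unit_disk R) om ->
  om 0 = 0 -> (forall z : C, nrm z < 1 -> nrm (om z) <= 1) ->
  hasd (D om) 0 (2 * c2) -> nrm c2 <= 1 - nrm ('D_1 om 0) ^+ 2.
Proof.
move=> hom om0 om1 hc2.
set c1 : C := 'D_1 om 0.
have hd (z : C) : nrm z < 1 -> hasd om z ('D_1 om z).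
  move=> zr; apply: differentiable_hasd; apply: hom.
  by rewrite /unit_disk /= (_ : (1 : R[i]) = (1 : R)%:C) // nrm_lt.
(* The coefficients of order 1 and 2 of [om(z) (x + y z)] are [x c1] and
   [x c2 + y c1]. *)
have key (x y : C) : nrm (x * c1) ^+ 2 + nrm (x * c2 + y * c1) ^+ 2 <= nrm x ^+ 2 + nrm y ^+ 2.
  pose h (z : C) : C := om z * (x + y * z).
  have dl (z : C) : hasd (fun z => x + y * z) z y.
    by have := hasdD (hasd_cst x z) (hasdZ y (hasd_id z)); rewrite add0r mulr1.
  pose dh (z : C) : C := 'D_1 om z * (x + y * z) + om z * y.
  have hh (z : C) : nrm z < 1 -> hasd h z (dh z) by move=> /hd /hasdM; exact.
  have dh0 : dh 0 = x * c1 by rewrite /dh om0 mulr0 addr0 mul0r addr0 mulrC.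
  have hdh : hasd dh 0 (2 * (x * c2 + y * c1)).
    have h0 : nrm (0 : C) < 1 by rewrite nrm0.
    have := hasdD (hasdM hc2 (dl 0)) (hasdM (hd 0 h0) (hasd_cst y 0)).
    by rewrite mulr0 addr0 mulr0 addr0 -/c1; congr hasd; ring.
  have ht := taylor2 ltr01 hh hdh.
  apply: le_at_radius1; rewrite ?sqr_ge0 // => r r0 r1.
  apply: (@bessel2 h x y (x * c1) (x * c2 + y * c1) r r0).
  - by move=> z zr; exists (dh z); apply: hh; apply: le_lt_trans r1.
  - by rewrite -dh0; apply: hh; rewrite nrm0.
  - move=> e /ht[d d0 H]; exists d => // z /H; rewrite dh0.
    by rewrite (_ : 2 * (x * c2 + y * c1) / 2 = x * c2 + y * c1) //; field.
  - move=> z zr; rewrite /h nrmM ler_piMl ?nrm_ge0 // om1 //.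
    exact: le_lt_trans r1.
have [p1 p1n p1E] := polar c1; have [p2 p2n p2E] := polar c2.
apply: coef_bound_real; rewrite ?nrm_ge0 // => t t0.
have p10 : p1 != 0 by rewrite -nrm_gt0 p1n.
(* Choose the argument of [y] so that [c2] and [y c1] are aligned. *)
have := key 1 (RC t * (p2 / p1)); rewrite !mul1r nrm1 expr1n.
rewrite [nrm (RC t * _)]nrmM nrmR ger0_norm // nrmM nrmV p1n p2n invr1 !mulr1.
rewrite (_ : c2 + _ = RC (nrm c2 + t * nrm c1) * p2); last first.
  by rewrite {1}p2E {1}p1E rmorphD rmorphM /=; field.
by rewrite nrmM p2n mulr1 nrmR ger0_norm // addr_ge0 ?mulr_ge0 ?nrm_ge0.
Qed.
End Schwarz.

(** * Euler's identity for the Minkowski functional *)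

Section Euler.
Context {R : realType} {n : nat}.
Local Notation C := (Cplx R).
Local Notation RC t := (t%:C : C).
Local Notation V := 'cV[C]_n.

(** [l] is the strict derivative of [rho] at [z] in the real direction [u]:
    the difference quotients tend to [l] as the base point tends to [z] and
    the increment to 0. Unlike plain directional derivatives, strict ones are
    additive in the direction. *)
Definition strict_deriv (rho : V -> R) (z u : V) (l : R) :=
  forall e : R, 0 < e -> exists2 d : R, 0 < d & forall (w : V) (t : R),
    nrm (w - z) < d -> `|t| < d ->
    `|rho (w + RC t *: u) - rho w - t * l| <= e * `|t|.

Lemma strict_deriv0 rho z : strict_deriv rho z 0 0.
Proof.
move=> e e0; exists 1 => // w t _ _.
by rewrite scaler0 addr0 subrr mulr0 subr0 normr0 mulr_ge0 // ltW.
Qed.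

Lemma strict_derivD rho z u v l m : strict_deriv rho z u l ->
  strict_deriv rho z v m -> strict_deriv rho z (u + v) (l + m).
Proof.
move=> hu hv e e0; have e20 : 0 < e / 2 by rewrite divr_gt0.
have [d1 d10 H1] := hu _ e20; have [d2 d20 H2] := hv _ e20.
have A0 : 0 < 2 * (1 + nrm u) by rewrite mulr_gt0 // ltr_pwDl // nrm_ge0.
exists (Num.min d1 (Num.min (d2 / 2) (d2 / (2 * (1 + nrm u))))).
  by rewrite !lt_min d10 !divr_gt0.
move=> w t; rewrite !lt_min => /andP[w1 /andP[w2 _]] /andP[t1 /andP[t2 t3]].
rewrite ltr_pdivlMr // in t3.
have tu : nrm (RC t *: u) <= d2 / 2.
  rewrite nrmZ nrmR; have : `|t| * nrm u <= `|t| * (1 + nrm u).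
    by rewrite ler_wpM2l // lerDr.
  have e1 : `|t| * (2 * (1 + nrm u)) = 2 * (`|t| * (1 + nrm u)) by ring.
  by rewrite e1 in t3; lra.
have h1 := H1 w t w1 t1.
have h2 : `|rho (w + RC t *: u + RC t *: v) - rho (w + RC t *: u) - t * m| <= e / 2 * `|t|.
  apply: H2; last by lra.
  rewrite addrAC; apply: le_lt_trans (nrmD _ _) _.
  by move: w2 tu; lra.
rewrite scalerDr addrA.
have -> : rho (w + RC t *: u + RC t *: v) - rho w - t * (l + m) =
  (rho (w + RC t *: u + RC t *: v) - rho (w + RC t *: u) - t * m)
  + (rho (w + RC t *: u) - rho w - t * l) by ring.
apply: le_trans (ler_normD _ _) _.
have -> : e * `|t| = e / 2 * `|t| + e / 2 * `|t| by field.
exact: lerD.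
Qed.

Lemma strict_derivZ rho z u l (a : R) : strict_deriv rho z u l ->
  strict_deriv rho z (RC a *: u) (a * l).
Proof.
move=> hu e e0; have A0 : 0 < 1 + `|a| by rewrite ltr_pwDl.
have [d d0 H] := hu (e / (1 + `|a|)) (divr_gt0 e0 A0).
exists (Num.min d (d / (1 + `|a|))); first by rewrite lt_min d0 divr_gt0.
move=> w t; rewrite !lt_min => /andP[w1 _] /andP[_]; rewrite ltr_pdivlMr // => t1.
have ta : `|t * a| <= `|t| * (1 + `|a|) by rewrite normrM ler_wpM2l // lerDr.
have := H w (t * a) w1 (le_lt_trans ta t1).
rewrite scalerA rmorphM /= mulrA => /le_trans; apply.
have -> : e * `|t| = e / (1 + `|a|) * (`|t| * (1 + `|a|)) by field; rewrite gt_eqF.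
by rewrite ler_wpM2l // divr_ge0 // ltW.
Qed.

Lemma strict_deriv_sum rho z (I : finType) (u : I -> V) (l : I -> R) :
  (forall i, strict_deriv rho z (u i) (l i)) ->
  strict_deriv rho z (\sum_i u i) (\sum_i l i).
Proof.
move=> h; elim/big_ind2: _ => //; first exact: strict_deriv0.
by move=> u1 l1 u2 l2; exact: strict_derivD.
Qed.

Lemma C1_along_line rho (w v : V) (t : R) :
  C1_along v rho (w + RC t *: v) ->
  forall e : R, 0 < e -> exists2 d : R, 0 < d & forall u : R, `|u - t| < d ->
    `|rho (w + RC u *: v) - rho (w + RC t *: v)
      - (u - t) * real_deriv v rho (w + RC t *: v)| <= e * `|u - t|.
Proof.
move=> [/derivable1_diffP df _] e e0.
pose phi (s : R) := rho (w + RC t *: v + RC s *: v).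
have [d d0 H] := differentiable_eps (f := phi) df e0; exists d => // u /H.
have -> : phi (0 + (u - t)) = rho (w + RC u *: v).
  by rewrite /phi add0r -addrA -scalerDl -rmorphD /= subrKC.
have -> : phi 0 = rho (w + RC t *: v) by rewrite /phi scale0r addr0.
by rewrite (congr1 (fun g => g (u - t)) (diff1E df)).
Qed.

(** A continuous directional derivative is strict. *)
Lemma C1_strict_deriv rho z v : z != 0 ->
  (forall w, w != 0 -> C1_along v rho w) ->
  strict_deriv rho z v (real_deriv v rho z).
Proof.
move=> z0 hC e e0; set l := real_deriv v rho z.
have [_ /cvgrPdist_le /(_ e e0) /nbhs_normP[_ /= /gt0_real[d1 d10 ->] H1]] := hC z z0.
pose d := Num.min d1 (nrm z).
have d0 : 0 < d by rewrite lt_min d10 nrm_gt0.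
have H w : nrm (w - z) < d -> w != 0 /\ `|real_deriv v rho w - l| <= e.
  rewrite lt_min => /andP[w1 w2]; split.
    by apply/eqP => w0; rewrite w0 sub0r nrmN ltxx in w2.
  by rewrite distrC; apply: H1; rewrite /= nrm_lt nrmBC.
have A0 : 0 < 1 + nrm v by rewrite ltr_pwDl // nrm_ge0.
(* It suffices to treat [0 <= t]: a negative increment from [w] is a
   positive one from [w + t v]. *)
have pos w t : 0 <= t -> nrm (w - z) + t * nrm v < d ->
    `|rho (w + RC t *: v) - rho w - t * l| <= e * `|t|.
  move=> t0 hw.
  have near s : 0 <= s <= t -> nrm (w + RC s *: v - z) < d.
    move=> /andP[s0 st]; rewrite addrAC; apply: le_lt_trans (nrmD _ _) _.
    apply: le_lt_trans hw; rewrite lerD2l nrmZ nrmR ger0_norm //.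
    by rewrite ler_wpM2r // nrm_ge0.
  have dF : der_on (fun s => RC (rho (w + RC s *: v) - s * l))
      (fun s => RC (real_deriv v rho (w + RC s *: v) - l)) 0 t.
    move=> s /near /H[ws0 _] e1 e10.
    have [d2 d20 H2] := C1_along_line (hC _ ws0) e10.
    have alg (a b c k u1 s1 : R) :
      a - u1 * k - (b - s1 * k) - (u1 - s1) * (c - k) = a - b - (u1 - s1) * c by ring.
    by exists d2 => // u _ /H2; rewrite -!rmorphB -rmorphM -rmorphB /= nrmR alg.
  have := der_on_bound t0 dF (M := e); rewrite -rmorphB /= nrmR !subr0.
  rewrite scale0r addr0 mul0r subr0 [`|t|]ger0_norm // => h.
  have -> : rho (w + RC t *: v) - rho w - t * l = rho (w + RC t *: v) - t * l - rho w by ring.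
  by apply: h => s /near /H[_ hs]; rewrite nrmR.
exists (Num.min (d / 4) (d / (4 * (1 + nrm v)))).
  by rewrite lt_min !divr_gt0 // mulr_gt0.
move=> w t; rewrite !lt_min => /andP[w1 _] /andP[_]; rewrite ltr_pdivlMr ?mulr_gt0 //.
move=> t1.
have tv : `|t| * nrm v <= d / 4.
  have : `|t| * nrm v <= `|t| * (1 + nrm v) by rewrite ler_wpM2l // lerDr.
  have e1 : `|t| * (4 * (1 + nrm v)) = 4 * (`|t| * (1 + nrm v)) by ring.
  by rewrite e1 in t1; lra.
have [t0|t0] := leP 0 t.
  by apply: pos => //; move: tv; rewrite ger0_norm //; lra.
have tN : 0 <= - t by rewrite oppr_ge0 ltW.
have := pos (w + RC t *: v) (- t) tN.
rewrite normrN rmorphN /= scaleNr addrK => h.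
rewrite -normrN.
have -> : - (rho (w + RC t *: v) - rho w - t * l) = rho w - rho (w + RC t *: v) - - t * l by ring.
apply: h; rewrite addrAC.
have h1 : nrm (w - z + RC t *: v) <= nrm (w - z) + `|t| * nrm v.
  by apply: le_trans (nrmD _ _) _; rewrite nrmZ nrmR.
move: h1 tv; rewrite (ltr0_norm t0); lra.
Qed.

(** Decomposition of a vector in the real basis [e_j], [i e_j]. *)
Lemma coord_decomp (z : V) : z = \sum_j (RC (complex.Re (z j 0)) *: delta_mx j 0
  + RC (complex.Im (z j 0)) *: ('i *: delta_mx j 0)).
Proof.
rewrite {1}[z]matrix_sum_delta; apply: eq_bigr => j _.
rewrite big_ord1 scalerA -scalerDl; congr (_ *: _).
by rewrite {1}[z j 0]complexE; congr (_ + _); exact: mulrC.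
Qed.

Lemma coord_decomp_i (z : V) : 'i *: z = \sum_j (RC (- complex.Im (z j 0)) *: delta_mx j 0
  + RC (complex.Re (z j 0)) *: ('i *: delta_mx j 0)).
Proof.
rewrite {1}[z]matrix_sum_delta scaler_sumr; apply: eq_bigr => j _.
rewrite big_ord1 !scalerA -scalerDl; congr (_ *: _).
case: (z j 0) => a b.
by apply/eqP; rewrite eq_complex /=; apply/andP; split; apply/eqP; ring.
Qed.

(** Euler's identity for the Minkowski functional. The real direction [z]
    yields the real part and, since [rho] is invariant under rotations, the
    direction [i z] yields a vanishing imaginary part. *)
Lemma euler_wirtinger (rho : V -> R) (z : V) : C1_off_origin rho -> z != 0 ->
  (forall (t : C) z, (rho (t *: z))%:C = `|t| * (rho z)%:C) ->
  2 * (wirtinger rho z *m z) 0 0 = (rho z)%:C.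
Proof.
move=> hC z0 hom.
have rhoZ (t : C) w : rho (t *: w) = nrm t * rho w.
  by apply: complexI; rewrite hom nrmE rmorphM.
pose p j := real_deriv (delta_mx j 0) rho z.
pose q j := real_deriv ('i *: delta_mx j 0) rho z.
have sp j : strict_deriv rho z (delta_mx j 0) (p j).
  by apply: C1_strict_deriv => // w w0; have [] := hC w w0 j.
have sq j : strict_deriv rho z ('i *: delta_mx j 0) (q j).
  by apply: C1_strict_deriv => // w w0; have [] := hC w w0 j.
have s1 : strict_deriv rho z z (\sum_j (complex.Re (z j 0) * p j + complex.Im (z j 0) * q j)).
  rewrite {2}(coord_decomp z); apply: strict_deriv_sum => j.
  by apply: strict_derivD; apply: strict_derivZ.
have s2 : strict_deriv rho z ('i *: z)
   (\sum_j (- complex.Im (z j 0) * p j + complex.Re (z j 0) * q j)).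
  rewrite (coord_decomp_i z); apply: strict_deriv_sum => j.
  by apply: strict_derivD; apply: strict_derivZ.
set l1 := (X in strict_deriv rho z z X) in s1.
set l2 := (X in strict_deriv rho z ('i *: z) X) in s2.
(* Along [z], [rho (z + t z) = (1 + t) rho z] for [0 <= t]. *)
have E1 : l1 = rho z.
  apply/eqP; rewrite -subr_eq0 -normr_eq0 eq_le normr_ge0 andbT.
  apply/ler_addgt0Pr => e e0; rewrite add0r.
  have [d d0 H] := s1 e e0; pose t := Num.min (d / 2) (2^-1).
  have t0 : 0 < t by rewrite lt_min; apply/andP; split; [exact: divr_gt0|rewrite invr_gt0].
  have td : `|t| < d.
    rewrite gtr0_norm // gt_min; apply/orP; left; lra.
  have := H z t _ td; rewrite subrr nrm0 => /(_ d0).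
  have -> : z + RC t *: z = RC (1 + t) *: z by rewrite rmorphD /= scalerDl scale1r.
  have n1 : `|1 + t| = 1 + t.
    by apply: ger0_norm; apply: addr_ge0 => //; exact: ltW.
  rewrite rhoZ nrmR n1.
  have -> : (1 + t) * rho z - rho z - t * l1 = t * (rho z - l1) by ring.
  by rewrite normrM mulrC ler_pM2r ?normr_gt0 ?gt_eqF // distrC.
(* Along [i z], [rho (z + t i z) = |1 + i t| rho z], and
   [|1 + i t| - 1 <= t^2]. *)
have E2 : l2 = 0.
  apply/eqP; rewrite -normr_eq0 eq_le normr_ge0 andbT.
  apply/ler_addgt0Pr => e e0; rewrite add0r.
  have e20 : 0 < e / 2 by rewrite divr_gt0.
  have [d d0 H] := s2 _ e20.
  have A0 : 0 < 1 + `|rho z| by rewrite ltr_pwDl.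
  pose t := Num.min (d / 2) (e / (2 * (1 + `|rho z|))).
  have t0 : 0 < t by rewrite lt_min !divr_gt0 // mulr_gt0.
  have td : `|t| < d.
    rewrite gtr0_norm // gt_min; apply/orP; left; lra.
  have t2 : t * (1 + `|rho z|) <= e / 2.
    rewrite -ler_pdivlMr // ge_min; apply/orP; right.
    by rewrite le_eqVlt; apply/orP; left; apply/eqP; field; rewrite gt_eqF.
  have := H z t _ td; rewrite subrr nrm0 => /(_ d0).
  have -> : z + RC t *: ('i *: z) = (1 + RC t * 'i) *: z by rewrite scalerDl scale1r scalerA.
  rewrite rhoZ; set N := nrm _.
  have N2 : N ^+ 2 = 1 + t ^+ 2.
    rewrite /N nrm_sqr ReD ImD ReRM ImRM /=; ring.
  have N1 : 1 <= N <= 1 + t ^+ 2.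
    have N0 : 0 <= N by exact: nrm_ge0.
    have tt : 0 <= t ^+ 2 by rewrite sqr_ge0.
    apply/andP; split.
      by rewrite -(@ler_pXn2r _ 2) ?nnegrE // N2 expr1n lerDl.
    rewrite -(@ler_pXn2r _ 2) ?nnegrE ?addr_ge0 // N2.
    have -> : (1 + t ^+ 2) ^+ 2 = 1 + t ^+ 2 + (t ^+ 2 + (t ^+ 2) ^+ 2) by ring.
    by rewrite lerDl addr_ge0 // sqr_ge0.
  move=> h; have h1 : `|(N - 1) * rho z| <= t ^+ 2 * `|rho z|.
    rewrite normrM ler_wpM2r // ger0_norm; case/andP: N1; lra.
  have h2 : `|t * l2| <= e / 2 * t + t ^+ 2 * `|rho z|.
    have -> : t * l2 = (N - 1) * rho z - (N * rho z - rho z - t * l2) by ring.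
    rewrite (gtr0_norm t0) in h.
    by apply: le_trans (ler_normB _ _) _; rewrite addrC; apply: lerD.
  rewrite normrM (gtr0_norm t0) in h2.
  have h3 : t * `|l2| <= t * (e / 2 + t * `|rho z|).
    by apply: le_trans h2 _; rewrite le_eqVlt; apply/orP; left; apply/eqP; ring.
  rewrite ler_pM2l // in h3; apply: le_trans h3 _.
  have : t * `|rho z| <= t * (1 + `|rho z|) by rewrite ler_wpM2l ?lerDr // ltW.
  by move: t2; lra.
have -> : 2 * (wirtinger rho z *m z) 0 0 = RC l1 - 'i * RC l2.
  have alg (P Q : R) (w : C) : 2 * ((RC P - 'i * RC Q) / 2 * w) =
     RC (complex.Re w * P + complex.Im w * Q)
     - 'i * RC (- complex.Im w * P + complex.Re w * Q).
    have -> : 2 * ((RC P - 'i * RC Q) / 2 * w) = (RC P - 'i * RC Q) * w by field.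
    case: w => u v; apply/eqP; rewrite eq_complex /=.
    by apply/andP; split; apply/eqP; ring.
  rewrite mxE mulr_sumr /l1 /l2 !rmorph_sum /= mulr_sumr -sumrB.
  by apply: eq_bigr => j _; rewrite mxE; exact: alg.
by rewrite E1 E2 mulr0 subr0.
Qed.
End Euler.

(** * Jacobian and Fréchet derivatives of a radial mapping *)

Section Radial.
Context {R : realType} {n : nat}.
Local Notation C := (Cplx R).
Local Notation RC t := (t%:C : C).
Local Notation V := 'cV[C]_n.

Lemma derive_line (f : V -> C) (x v : V) (l : C) : differentiable f x ->
  hasd (fun q : C => f (x + q *: v)) 0 l -> 'D_v f x = l.
Proof.
move=> df h; have df0 : differentiable f (x + 0 *: v) by rewrite scale0r addr0.
by rewrite -(hasd_unique (line_hasd df0) h) scale0r addr0.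
Qed.

Lemma differentiable_entry (i : 'I_n) (x : V) : differentiable (fun w : V => w i 0) x.
Proof. exact: differentiable_coord. Qed.

Lemma derive_mul_coord (g : V -> C) (i : 'I_n) (x v : V) : differentiable g x ->
  'D_v (fun w : V => g w * w i 0) x = 'D_v g x * x i 0 + g x * v i 0.
Proof.
move=> dg; apply: derive_line; first by apply: differentiableM => //; exact: differentiable_entry.
have dg0 : differentiable g (x + 0 *: v) by rewrite scale0r addr0.
have h1 := line_hasd dg0.
have h2 : hasd (fun q : C => (x + q *: v) i 0) 0 (v i 0).
  have := hasdD (hasd_cst (x i 0) 0) (hasdM (hasd_id 0) (hasd_cst (v i 0) 0)).
  rewrite mulr0 addr0 mul1r add0r.
  by apply: (eq_hasd ltr01) => h _; rewrite !mxE.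
by have := hasdM h1 h2; rewrite !scale0r !addr0.
Qed.

Lemma radial_coordE (g : V -> C) (i : 'I_n) :
  (fun w => radial g w i 0) = (fun w : V => g w * w i 0).
Proof. by apply/funext => w; rewrite /radial mxE. Qed.

Lemma derive_decomp (f : V -> C) (x v : V) : differentiable f x ->
  'D_v f x = \sum_j 'D_(delta_mx j 0) f x * v j 0.
Proof.
move=> df; rewrite deriveE // {1}[v]matrix_sum_delta linear_sum.
apply: eq_bigr => j _; rewrite big_ord1 linearZ /= deriveE //.
exact: mulrC.
Qed.

Lemma derive_scale (f : V -> C) (x v : V) (c : C) : differentiable f x ->
  'D_(c *: v) f x = c * 'D_v f x.
Proof. by move=> df; rewrite !deriveE // linearZ. Qed.

Lemma jacobian_radial_mul (g : V -> C) (z u : V) : differentiable g z ->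
  cjacobian (radial g) z *m u = g z *: u + 'D_u g z *: z.
Proof.
move=> dg; apply/matrixP => i k; rewrite (ord1 k) !mxE.
rewrite (derive_decomp u dg) mulr_suml.
have -> : g z * u i 0 = \sum_j (g z * (i == j)%:R * u j 0).
  rewrite (bigD1 i) //= eqxx mulr1 big1 ?addr0 // => j ji.
  by rewrite eq_sym (negbTE ji) mulr0 mul0r.
rewrite -big_split /=; apply: eq_bigr => j _.
rewrite mxE /partial radial_coordE derive_mul_coord // mxE eqxx andbT.
by move: ('D_(_) g z) (g z) => a b; ring.
Qed.

Lemma jacobian_radial_self (g : V -> C) (z : V) : differentiable g z ->
  cjacobian (radial g) z *m z = (g z + 'D_z g z) *: z.
Proof. by move=> dg; rewrite jacobian_radial_mul // scalerDl. Qed.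

(** For [G = radial g], the vector [J_G^-1(z) G(z)] is a multiple of [z]. *)
Lemma radial_pullback (g : V -> C) (z : V) : differentiable g z -> z != 0 ->
  cjacobian (radial g) z \in unitmx ->
  g z + 'D_z g z != 0 /\
  invmx (cjacobian (radial g) z) *m radial g z = (g z / (g z + 'D_z g z)) *: z.
Proof.
move=> dg z0 uJ; have := jacobian_radial_self dg.
set J := cjacobian _ _ in uJ *; set l := _ + _ => Jz.
have l0 : l != 0.
  apply/eqP => l0; rewrite l0 scale0r in Jz; case/eqP: z0.
  by rewrite -[LHS](mulKmx uJ) Jz mulmx0.
split => //; rewrite /radial -scalemxAr -(scalerA (g z)); congr (_ *: _).
by rewrite -{1}[z](scalerK l0) -Jz -scalemxAr mulKmx.
Qed.

Section FrechetLine.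
Variables (A : set V) (f : V -> C) (z : V).
Hypothesis oA : open A.
Hypothesis hf : holomorphic_on A f.

(** The sum of all partial derivatives of order [k] of [f] at [w], contracted
    with [k] copies of the fixed vector [z]. *)
Definition dsum (k : nat) (w : V) : C :=
  \sum_(p : k.-tuple 'I_n) foldr (@partial R n) f p w * \prod_(j <- p) z j 0.

Lemma holomorphic_partials (p : seq 'I_n) : holomorphic_on A (foldr (@partial R n) f p).
Proof. by elim: p => //= j p IH; exact: holomorphic_derive. Qed.

Lemma dsum0 w : dsum 0 w = f w.
Proof.
rewrite /dsum (bigD1 [tuple]) //= big_nil mulr1 big1 ?addr0 // => p /eqP[].
exact: tuple0.
Qed.

Lemma dsumS k w : A w ->
  dsum k.+1 w = \sum_(p : k.-tuple 'I_n) 'D_z (foldr (@partial R n) f p) w * \prod_(j <- p) z j 0.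
Proof.
move=> Aw; rewrite /dsum.
rewrite (reindex (fun jp : 'I_n * k.-tuple 'I_n => [tuple of jp.1 :: jp.2])) /=; last first.
  exists (fun p => (thead p, [tuple of behead p])) => [[j p]|p] _ /=.
    by rewrite theadE; congr (_, _); exact: val_inj.
  by rewrite -tuple_eta.
rewrite -(pair_bigA _ (fun j (p : k.-tuple 'I_n) =>
  partial j (foldr (@partial R n) f p) w * \prod_(i <- j :: p) z i 0)) /=.
rewrite exchange_big /=; apply: eq_bigr => p _.
rewrite (derive_decomp z (@holomorphic_partials p w Aw)) mulr_suml.
by apply: eq_bigr => j _; rewrite big_cons mulrA.
Qed.

Lemma hasd_sum (I : finType) (F : I -> C -> C) (d : I -> C) (q : C) :
  (forall i, hasd (F i) q (d i)) -> hasd (fun x => \sum_i F i x) q (\sum_i d i).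
Proof.
move=> h; rewrite (_ : (fun x => _) = \sum_i F i); last by apply/funext => x; rewrite fct_sumE.
elim/big_ind2: _ => //; first exact: hasd_cst.
by move=> ? ? ? ?; exact: hasdD.
Qed.

(** Along the line through [z], [dsum k.+1] is the derivative of [dsum k]. *)
Lemma hasd_dsum k (q : C) : A (q *: z) ->
  hasd (fun q => dsum k (q *: z)) q (dsum k.+1 (q *: z)).
Proof.
move=> Aq; rewrite dsumS //; apply: hasd_sum => p.
have dp : differentiable (foldr (@partial R n) f p) (0 + q *: z).
  by rewrite add0r; exact: holomorphic_partials.
have := hasdM (line_hasd dp) (hasd_cst (\prod_(j <- p) z j 0) q).
rewrite mulr0 addr0 add0r.
by under eq_fun do rewrite add0r.
Qed.
End FrechetLine.

Lemma holomorphic_radial_coord (A : set V) (g : V -> C) (i : 'I_n) :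
  holomorphic_on A g -> holomorphic_on A (fun w => radial g w i 0).
Proof.
move=> hg w Aw; rewrite radial_coordE; apply: differentiableM; first exact: hg.
exact: differentiable_entry.
Qed.

Local Notation D := (fun f : C -> C => (fun z => 'D_1 f z)).

(** The second and third Fréchet derivatives at 0 of [w g(w)] in the direction
    [z] are read off the one-variable function [gam q = g(q z)] and its
    successive derivatives [g1], [g2], [g3]. *)
Lemma frechet_radial (A : set V) (g : V -> C) (z : V) (gam g1 g2 g3 : C -> C) :
  open A -> holomorphic_on A g ->
  (forall q : C, nrm q < 1 -> A (q *: z)) ->
  (forall q : C, nrm q < 1 -> gam q = g (q *: z)) ->
  (forall q : C, nrm q < 1 -> hasd gam q (g1 q)) ->
  (forall q : C, nrm q < 1 -> hasd g1 q (g2 q)) ->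
  (forall q : C, nrm q < 1 -> hasd g2 q (g3 q)) ->
  frechet0 2 (radial g) z = (2 * g1 0) *: z /\
  frechet0 3 (radial g) z = (3 * g2 0) *: z.
Proof.
move=> oA hg zA gE h1 h2 h3.
have key (i : 'I_n) : dsum (fun w => radial g w i 0) z 2 0 = 2 * g1 0 * z i 0 /\
    dsum (fun w => radial g w i 0) z 3 0 = 3 * g2 0 * z i 0.
  set f := fun w => radial g w i 0; set c := z i 0.
  have hf : holomorphic_on A f by exact: holomorphic_radial_coord.
  (* On the line the [i]-th coordinate of the mapping is [q gam(q) z_i];
     differentiate it three times. *)
  have e0 (q : C) : nrm q < 1 -> dsum f z 0 (q *: z) = q * gam q * c.
    by move=> q1; rewrite dsum0 /f /radial !mxE gE // mulrCA mulrA.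
  have e1 (q : C) : nrm q < 1 -> dsum f z 1 (q *: z) = (gam q + q * g1 q) * c.
    move=> q1; have [d d0 hd] := disk_nbhd q1.
    apply: hasd_unique (hasd_dsum oA hf 0 (zA _ q1)) _.
    have := hasdM (hasdM (hasd_id q) (h1 q q1)) (hasd_cst c q).
    rewrite mulr0 addr0 mul1r; apply: (eq_hasd d0) => h /hd hh.
    by rewrite e0.
  have e2 (q : C) : nrm q < 1 -> dsum f z 2 (q *: z) = (2 * g1 q + q * g2 q) * c.
    move=> q1; have [d d0 hd] := disk_nbhd q1.
    apply: hasd_unique (hasd_dsum oA hf 1 (zA _ q1)) _.
    have := hasdM (hasdD (h1 q q1) (hasdM (hasd_id q) (h2 q q1))) (hasd_cst c q).
    have -> : (g1 q + (1 * g1 q + q * g2 q)) * c + (gam q + q * g1 q) * 0 = (2 * g1 q + q * g2 q) * c by ring.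
    by apply: (eq_hasd d0) => h /hd hh; rewrite e1.
  have e3 : dsum f z 3 (0 *: z) = 3 * g2 0 * c.
    have q1 : nrm (0 : C) < 1 by rewrite nrm0.
    have [d d0 hd] := disk_nbhd q1.
    apply: hasd_unique (hasd_dsum oA hf 2 (zA _ q1)) _.
    have := hasdM (hasdD (hasdZ 2 (h2 0 q1)) (hasdM (hasd_id 0) (h3 0 q1))) (hasd_cst c 0).
    have -> : (2 * g2 0 + (1 * g2 0 + 0 * g3 0)) * c + (2 * g1 0 + 0 * g2 0) * 0 = 3 * g2 0 * c by ring.
    by apply: (eq_hasd d0) => h /hd hh; rewrite e2.
  have := e2 0; rewrite nrm0 scale0r mul0r addr0 => /(_ ltr01) ->.
  by split => //; rewrite -e3 scale0r.
by split; apply/matrixP => i k; rewrite (ord1 k) !mxE; have [] := key i.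
Qed.

Lemma frechet0_scale (F : V -> V) k (c : C) (z : V) :
  frechet0 k F (c *: z) = c ^+ k *: frechet0 k F z.
Proof.
apply/matrixP => i j; rewrite !mxE mulr_sumr; apply: eq_bigr => p _.
rewrite mulrCA; congr (_ * _).
rewrite -{2}(size_tuple p); elim: (tval p) => [|a s IH].
  by rewrite !big_nil mulr1.
by rewrite !big_cons IH mxE exprS /=; ring.
Qed.

End Radial.

(** * Coefficient comparison and the determinant estimate *)

Section CoefficientComparison.
Context {R : realType}.
Local Notation C := (Cplx R).
Local Notation RC t := (t%:C : C).
Local Notation D := (fun f : C -> C => (fun z => 'D_1 f z)).

Lemma unit_diskE (z : C) : @unit_disk R z = (nrm z < 1) :> Prop.
Proof. by rewrite /unit_disk /= (_ : (1 : R[i]) = (1 : R)%:C) // nrm_lt. Qed.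

Lemma open_unit_disk : open (@unit_disk R).
Proof.
rewrite (_ : @unit_disk R = [set z : C | nrm z < 1]); first exact: open_nrm_lt.
by apply/funext => z; rewrite unit_diskE.
Qed.

Lemma holomorphic_hasd (f : C -> C) : holomorphic_on (@unit_disk R) f ->
  forall z : C, nrm z < 1 -> hasd f z ('D_1 f z).
Proof.
by move=> hf z z1; apply: differentiable_hasd; apply: hf; rewrite unit_diskE.
Qed.

(** Coefficient comparison in [gam + z gam' = q gam]. *)
Lemma log_derivative_coef (gam g1 g2 g3 q q1 : C -> C) (q2 : C) :
  (forall z : C, nrm z < 1 -> hasd gam z (g1 z)) ->
  (forall z : C, nrm z < 1 -> hasd g1 z (g2 z)) ->
  (forall z : C, nrm z < 1 -> hasd g2 z (g3 z)) ->
  (forall z : C, nrm z < 1 -> hasd q z (q1 z)) -> hasd q1 0 q2 ->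
  (forall z : C, nrm z < 1 -> gam z + z * g1 z = q z * gam z) -> gam 0 = 1 ->
  g1 0 = q1 0 /\ 2 * g2 0 = q2 + 2 * q1 0 ^+ 2.
Proof.
move=> h1 h2 h3 hq hq2 E gam0.
have n0 : nrm (0 : C) < 1 by rewrite nrm0.
have q0 : q 0 = 1 by have := E 0 n0; rewrite mul0r addr0 gam0 mulr1.
have E1 (z : C) : nrm z < 1 -> g1 z + (1 * g1 z + z * g2 z) = q1 z * gam z + q z * g1 z.
  move=> z1; have [d d0 hd] := disk_nbhd z1.
  apply: hasd_unique (hasdD (h1 z z1) (hasdM (hasd_id z) (h2 z z1))) _.
  by apply: (eq_hasd d0) (hasdM (hq z z1) (h1 z z1)) => h /hd hh; rewrite E.
have e1 : g1 0 = q1 0.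
  have := E1 0 n0; rewrite q0 gam0 mul0r addr0 !mul1r mulr1.
  by move=> /addIr.
split => //.
have [d d0 hd] := disk_nbhd n0.
have E2 : g2 0 + ((0 * g1 0 + 1 * g2 0) + (1 * g2 0 + 0 * g3 0)) =
   (q2 * gam 0 + q1 0 * g1 0) + (q1 0 * g1 0 + q 0 * g2 0).
  apply: hasd_unique.
    exact: hasdD (h2 0 n0) (hasdD (hasdM (hasd_cst 1 0) (h2 0 n0)) (hasdM (hasd_id 0) (h3 0 n0))).
  apply: (eq_hasd d0) (hasdD (hasdM hq2 (h1 0 n0)) (hasdM (hq 0 n0) (h2 0 n0))) => h /hd hh.
  by rewrite E1.
rewrite q0 gam0 e1 in E2.
apply: (addIr (g2 0)).
have -> : 2 * g2 0 + g2 0 = g2 0 + (0 * q1 0 + 1 * g2 0 + (1 * g2 0 + 0 * g3 0)) by ring.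
rewrite E2; ring.
Qed.

(** The left-hand side is the modulus of the symmetric Toeplitz determinant
    with first row [1, b2, b3]. *)
Lemma determinant_bound (B1 B2 : R) (c1 c2 b2 b3 : C) : 0 < B1 ->
  B1 - B1 ^+ 2 <= B2 -> B2 <= 3 * B1 ^+ 2 - B1 ->
  nrm c2 <= 1 - nrm c1 ^+ 2 ->
  b2 = RC B1 * c1 -> b3 = (RC B1 * c2 + RC (B2 + B1 ^+ 2) * c1 ^+ 2) / 2 ->
  nrm (2 * b2 ^+ 2 * b3 - b3 ^+ 2 - 2 * b2 ^+ 2 + 1) <=
  1 + 2 * B1 ^+ 2 + (3 * B1 ^+ 2 - B2) * (B2 + B1 ^+ 2) / 4.
Proof.
move=> B0 lo up hc b2E b3E.
set a := nrm c1 in hc *.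
have a0 : 0 <= a by exact: nrm_ge0.
have a2 : a ^+ 2 <= 1 by have := nrm_ge0 c2; lra.
have a20 : 0 <= a ^+ 2 by rewrite sqr_ge0.
have n2 : nrm (2 : C) = 2.
  have e2 : (2 : C) = RC 2 by rewrite rmorph_nat.
  by rewrite e2 nrmR ger0_norm.
have half (w : C) : nrm (w / 2) = nrm w / 2 by rewrite nrmM nrmV n2.
(* Since [|c2| <= 1 - |c1|^2] and [B1 <= m], the expression is at most
   [m (1 - |c1|^2) + m |c1|^2]. *)
have FS (m : R) : B1 <= m -> forall s : R, `|s| = m ->
    nrm (RC B1 * c2 + RC s * c1 ^+ 2) <= m.
  move=> Bm s sm; apply: le_trans (nrmD _ _) _.
  rewrite [nrm (RC B1 * _)]nrmM [nrm (RC s * _)]nrmM nrmX !nrmR sm (gtr0_norm B0) -/a.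
  have h1 : B1 * nrm c2 <= B1 * (1 - a ^+ 2) by rewrite ler_wpM2l // ltW.
  have h2 : B1 * (1 - a ^+ 2) <= m * (1 - a ^+ 2) by rewrite ler_wpM2r // subr_ge0.
  have h3 : m * (1 - a ^+ 2) + m * a ^+ 2 = m by ring.
  by move: h1 h2 h3; set x1 := B1 * _; set x2 := B1 * _; set x3 := m * _; set x4 := m * _; lra.
have hm1 : B1 <= B2 + B1 ^+ 2 by lra.
have hm2 : B1 <= 3 * B1 ^+ 2 - B2 by lra.
have k1 : nrm b3 <= (B2 + B1 ^+ 2) / 2.
  rewrite b3E half ler_pM2r ?invr_gt0 //; apply: FS hm1 _ _.
  by rewrite ger0_norm //; lra.
have k2 : nrm (2 * b2 ^+ 2 - b3) <= (3 * B1 ^+ 2 - B2) / 2.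
  have -> : 2 * b2 ^+ 2 - b3 = (- (RC B1 * c2 + RC (- (3 * B1 ^+ 2 - B2)) * c1 ^+ 2)) / 2.
    rewrite b2E b3E.
    have -> : RC (- (3 * B1 ^+ 2 - B2)) = RC B2 - 3 * RC B1 ^+ 2.
      by rewrite opprB rmorphB rmorphM rmorphXn /= rmorph_nat.
    have -> : RC (B2 + B1 ^+ 2) = RC B2 + RC B1 ^+ 2 by rewrite rmorphD rmorphXn.
    by move: (RC B1) (RC B2) => x y; field.
  rewrite half nrmN ler_pM2r ?invr_gt0 //; apply: FS hm2 _ _.
  by rewrite normrN ger0_norm //; lra.
have k3 : nrm b2 ^+ 2 <= B1 ^+ 2.
  rewrite b2E nrmM nrmR (gtr0_norm B0) exprMn -/a ler_piMr ?sqr_ge0 //.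
have -> : 2 * b2 ^+ 2 * b3 - b3 ^+ 2 - 2 * b2 ^+ 2 + 1 =
   1 + (- (2 * b2 ^+ 2)) + b3 * (2 * b2 ^+ 2 - b3) by ring.
apply: le_trans (nrmD _ _) _; apply: le_trans (lerD (nrmD _ _) (lexx _)) _.
rewrite nrm1 nrmN (nrmM 2 (b2 ^+ 2)) (nrmM b3) n2 nrmX.
have -> : (3 * B1 ^+ 2 - B2) * (B2 + B1 ^+ 2) / 4 =
  (B2 + B1 ^+ 2) / 2 * ((3 * B1 ^+ 2 - B2) / 2) by field.
apply: lerD; first by rewrite lerD2l ler_pM2l.
by apply: ler_pM => //; exact: nrm_ge0.
Qed.
End CoefficientComparison.

(** * The upper bound *)

Section UpperBound.
Context {R : realType} {n : nat}.
Local Notation C := (Cplx R).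
Local Notation RC t := (t%:C : C).
Local Notation V := 'cV[C]_n.
Local Notation D := (fun f : C -> C => (fun z => 'D_1 f z)).
Variables (Omega : set V) (rho : V -> R).
Hypothesis hOmega : bounded_starlike_circular_domain Omega.
Hypothesis hrho : minkowski_functional Omega rho.
Hypothesis hrhoC1 : C1_off_origin rho.

Lemma minkowski_scale (t : C) w : rho (t *: w) = nrm t * rho w.
Proof.
by case: hrho => _ _ _ hom _; apply: complexI; rewrite hom nrmE rmorphM.
Qed.

Lemma minkowski_gt0 w : w != 0 -> 0 < rho w.
Proof.
case: hrho => _ r0 rz _ _ w0; rewrite lt0r r0 andbT.
by apply/eqP => /rz w0'; rewrite w0' eqxx in w0.
Qed.

Lemma OmegaE w : Omega w = (rho w < 1) :> Prop.
Proof. by case: hrho => _ _ _ _ ->. Qed.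

Lemma open_Omega : open Omega.
Proof. by case: hOmega. Qed.

Lemma minkowski_euler w : w != 0 -> 2 * (wirtinger rho w *m w) 0 0 = (rho w)%:C.
Proof.
by move=> w0; apply: euler_wirtinger => //; case: hrho.
Qed.

(** The positive multiple of [z] on the boundary [rho = 1]. *)
Definition bdry (z : V) : V := (RC (rho z))^-1 *: z.

Lemma bdry_rho z : z != 0 -> rho (bdry z) = 1.
Proof.
move=> z0; have r0 := minkowski_gt0 z0.
by rewrite minkowski_scale nrmV nrmR gtr0_norm // mulVf // gt_eqF.
Qed.

Lemma bdry_scale z : z != 0 -> RC (rho z) *: bdry z = z.
Proof.
move=> z0; have r0 := minkowski_gt0 z0.
by rewrite /bdry scalerA divff ?scale1r // RC_neq0 gt_eqF.
Qed.

Lemma disk_Omega z (q : C) : rho z = 1 -> nrm q < 1 -> Omega (q *: z).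
Proof. by move=> r1 q1; rewrite OmegaE minkowski_scale r1 mulr1. Qed.

Section Slice.
Variable g : V -> C.
Hypothesis hg : holomorphic_on Omega g.

(** The restriction of [g] to the complex line through [z]. *)
Definition slice (z : V) (q : C) : C := g (q *: z).

Lemma hasd_slice z (q : C) : Omega (q *: z) ->
  hasd (slice z) q ('D_z g (q *: z)).
Proof.
move=> hq; have dg : differentiable g (0 + q *: z) by rewrite add0r; apply: hg.
have := line_hasd dg; rewrite add0r.
by under eq_fun do rewrite add0r.
Qed.

Lemma holomorphic_slice z : rho z = 1 -> holomorphic_on (@unit_disk R) (slice z).
Proof.
move=> r1 q; rewrite unit_diskE => q1.
by have [] := hasd_differentiable (hasd_slice (disk_Omega r1 q1)).
Qed.

(** In terms of the slice normalised by [rho = 1], the coefficients [b_2] and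
    [b_3] are its Taylor coefficients of order 1 and 2. *)
Lemma coef_b_slice z : z != 0 ->
  coef_b rho (radial g) 2 z = 'D_1 (slice (bdry z)) 0 /\
  coef_b rho (radial g) 3 z = 'D_1 (D (slice (bdry z))) 0 / 2.
Proof.
move=> z0; set u := bdry z.
have r1 : rho u = 1 by exact: bdry_rho.
have rz := minkowski_gt0 z0.
have rcz : RC (rho z) != 0 by rewrite RC_neq0 gt_eqF.
have h0 := holomorphic_slice r1.
have h1 := holomorphic_derive1 open_unit_disk h0.
have h2 := holomorphic_derive1 open_unit_disk h1.
have [f2 f3] := frechet_radial open_Omega hg (fun q q1 => disk_Omega r1 q1)
  (fun q _ => erefl) (holomorphic_hasd h0) (holomorphic_hasd h1) (holomorphic_hasd h2).
have cb (k : nat) (c : C) : frechet0 k.+1 (radial g) u = c *: u ->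
    coef_b rho (radial g) k.+1 z = c / (k.+1)`!%:R.
  move=> fk; rewrite /coef_b.
  have -> : frechet0 k.+1 (radial g) z = (RC (rho z) ^+ k * c) *: z.
    transitivity (frechet0 k.+1 (radial g) (RC (rho z) *: u)).
      by rewrite bdry_scale.
    transitivity ((RC (rho z) ^+ k * c) *: (RC (rho z) *: u)).
      by rewrite frechet0_scale fk !scalerA exprS; congr (_ *: _); ring.
    by rewrite bdry_scale.
  have -> : 2 * (wirtinger rho z *m ((RC (rho z) ^+ k * c) *: z)) 0 0 =
     RC (rho z) ^+ k * c * (2 * (wirtinger rho z *m z) 0 0).
    by rewrite -scalemxAr mxE mulrCA.
  rewrite (minkowski_euler z0) exprS.
  have f0 : (k.+1)`!%:R != 0 :> C by rewrite pnatr_eq0 -lt0n fact_gt0.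
  have rk0 : RC (rho z) ^+ k != 0 by rewrite expf_neq0.
  move: rcz rk0 f0; move: (RC (rho z) ^+ k) (RC (rho z)) ((k.+1)`!%:R) => x y w.
  by move=> *; field; do ?[apply/andP; split].
rewrite (cb 1%N _ f2) (cb 2%N _ f3).
split; first by rewrite (_ : (2`!)%:R = 2) // mulrC mulKf // pnatr_eq0.
by rewrite (_ : (3`!)%:R = 6 :> C) //; field.
Qed.
End Slice.

Variable Phi : C -> C.
Hypothesis hPhi : biholomorphic_onto_image (@unit_disk R) Phi.
Hypothesis hPhi0 : Phi 0 = 1.
Hypothesis hPhiRe : forall zeta, @unit_disk R zeta -> 0 < complex.Re (Phi zeta).

(** By the radial form of the pullback and Euler's identity, membership in the
    class says that [1 + Dg(z) z / g(z)] has values in the range of [Phi]. *)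
Lemma admissible_log_derivative g z : admissible Omega rho Phi g -> Omega z -> z != 0 ->
  g z != 0 /\ (Phi @` @unit_disk R) (1 + 'D_z g z / g z).
Proof.
move=> [hg _ uJ [_ _ _ hM]] Oz z0.
have dg : differentiable g z by exact: hg.
have [l0 pE] := radial_pullback dg z0 (uJ z Oz).
have := hM z Oz z0; rewrite pE -scalemxAr mxE mulrCA (minkowski_euler z0).
have rz : RC (rho z) != 0 by rewrite RC_neq0 gt_eqF // minkowski_gt0.
have [gz|gz] := eqVneq (g z) 0.
  rewrite gz mul0r mul0r invr0 mulr0 => -[u uU Pu].
  by have := hPhiRe uU; rewrite Pu /= ltxx.
split => //.
suff <- : (rho z)%:C / (g z / (g z + 'D_z g z) * (rho z)%:C) = 1 + 'D_z g z / g z by [].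
move: rz gz l0; move: (g z) ('D_z g z) (RC (rho z)) => a b c c0 a0 ab0.
by field; do ?[apply/andP; split].
Qed.

Lemma upper_bound g z (B1 B2 : R) : admissible Omega rho Phi g -> z != 0 ->
  0 < B1 -> 'D_1 Phi 0 = RC B1 -> 'D_1 (D Phi) 0 = RC (2 * B2) ->
  B1 - B1 ^+ 2 <= B2 -> B2 <= 3 * B1 ^+ 2 - B1 ->
  forall b2 b3 : C, b2 = coef_b rho (radial g) 2 z ->
  b3 = coef_b rho (radial g) 3 z ->
  nrm (2 * b2 ^+ 2 * b3 - b3 ^+ 2 - 2 * b2 ^+ 2 + 1) <=
  1 + 2 * B1 ^+ 2 + (3 * B1 ^+ 2 - B2) * (B2 + B1 ^+ 2) / 4.
Proof.
move=> adm z0 B10 P1E P2E lo up b2 b3 b2D b3D.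
have [hg g01 _ _] := adm.
set u := bdry z; have r1 : rho u = 1 by exact: bdry_rho.
have u0 : u != 0.
  by apply/eqP => u0; case: hrho => _ _ rz _ _; have := proj2 (rz u) u0; rewrite r1 => /eqP; rewrite oner_eq0.
have [b2E b3E] := coef_b_slice hg z0; rewrite -/u -?b2D -?b3D in b2E b3E.
set gam := slice g u in b2E b3E.
have h0 : holomorphic_on (@unit_disk R) gam := holomorphic_slice hg r1.
have h1 := holomorphic_derive1 open_unit_disk h0.
have h2 := holomorphic_derive1 open_unit_disk h1.
pose g1 := D gam; pose g2 := D g1.
have n0 : nrm (0 : C) < 1 by rewrite nrm0.
have gam0 : gam 0 = 1 by rewrite /gam /slice scale0r.
(* [q] is the function [1 + Dg(z) z / g(z)] along the slice; it takes values
   in the range of [Phi]. *)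
pose q (w : C) : C := 1 + w * (g1 w / gam w).
have qP (w : C) : nrm w < 1 -> gam w != 0 /\ (Phi @` @unit_disk R) (q w).
  move=> w1; have [->|w0] := eqVneq w 0.
    rewrite gam0 oner_eq0; split => //; exists 0; last by rewrite hPhi0 /q mul0r addr0.
    by rewrite unit_diskE.
  have Ow : Omega (w *: u) by exact: disk_Omega.
  have wu0 : w *: u != 0 by rewrite scaler_eq0 negb_or w0 u0.
  have [gw] := admissible_log_derivative adm Ow wu0.
  have dg : differentiable g (w *: u) by exact: hg.
  rewrite derive_scale // -mulrA.
  have -> : 'D_u g (w *: u) = g1 w.
    exact: hasd_unique (hasd_slice hg Ow) (holomorphic_hasd h0 w1).
  by split.
case: hPhi => hP [h [oPhi hh hK]].
(* [om] is the Schwarz function with [q = Phi o om]. *)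
pose om (w : C) : C := h (q w).
have omP (w : C) : nrm w < 1 -> nrm (om w) < 1 /\ Phi (om w) = q w.
  move=> /qP[_ [v vU vE]]; rewrite /om -vE hK //; split => //.
  by rewrite -unit_diskE.
have hq (w : C) : nrm w < 1 -> exists l, hasd q w l.
  move=> w1; have [gw _] := qP w w1.
  eexists; apply: hasdD (hasd_cst 1 w) (hasdM (hasd_id w) _).
  exact: hasdM (holomorphic_hasd h1 w1) (hasdV gw (holomorphic_hasd h0 w1)).
have hom : holomorphic_on (@unit_disk R) om.
  move=> w; rewrite unit_diskE => w1; have [l ql] := hq w w1.
  have hq' := differentiable_hasd (hh (q w) (proj2 (qP w w1))).
  by have [] := hasd_differentiable (hasd_comp ql hq').
have om0 : om 0 = 0.
  rewrite /om /q mul0r addr0 -hPhi0 hK //.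
  by rewrite unit_diskE.
have hom1 := holomorphic_derive1 open_unit_disk hom.
pose c1 := 'D_1 om 0; pose c2 := 'D_1 (D om) 0 / 2.
have hc2 : hasd (D om) 0 (2 * c2).
  by have := holomorphic_hasd hom1 n0; rewrite /c2 mulrC divfK // pnatr_eq0.
have cc : nrm c2 <= 1 - nrm c1 ^+ 2.
  by apply: schwarz_coef => // w /omP[/ltW].
have hP1 := holomorphic_derive1 open_unit_disk hP.
(* The derivatives of [q] at 0 in terms of those of [om] and [Phi]. *)
pose q1 (w : C) : C := 'D_1 om w * 'D_1 Phi (om w).
have hq1 (w : C) : nrm w < 1 -> hasd q w (q1 w).
  move=> w1; have [d d0 hd] := disk_nbhd w1.
  have [omw _] := omP w w1.
  apply: (eq_hasd d0) (hasd_comp (holomorphic_hasd hom w1) (holomorphic_hasd hP omw)) => k /hd /omP[_ ->] //.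
have om0n : nrm (om 0) < 1 by rewrite om0.
have hq2 := hasdM hc2 (hasd_comp (holomorphic_hasd hom n0) (holomorphic_hasd hP1 om0n)).
have E (w : C) : nrm w < 1 -> gam w + w * g1 w = q w * gam w.
  by move=> w1; have [gw _] := qP w w1; rewrite /q; field.
have [e1 e2] := log_derivative_coef (holomorphic_hasd h0) (holomorphic_hasd h1) (holomorphic_hasd h2) hq1 hq2 E gam0.
have e1' : 'D_1 gam 0 = c1 * RC B1 by rewrite e1 /q1 om0 P1E.
have b2E' : b2 = RC B1 * c1 := etrans b2E (etrans e1' (mulrC _ _)).
apply: (determinant_bound B10 lo up cc b2E').
have e2' : 2 * 'D_1 (D gam) 0 = 2 * c2 * RC B1 + c1 * (c1 * RC (2 * B2)) + 2 * (c1 * RC B1) ^+ 2.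
  by rewrite e2 /q1 om0 P1E P2E.
have half (w : C) : w / 2 = 2 * w / 2 / 2 by field.
apply: etrans b3E (etrans (half _) (etrans (congr1 (fun w => w / 2 / 2) e2') _)).
have -> : RC (2 * B2) = 2 * RC B2 by rewrite rmorphM /= rmorph_nat.
have -> : RC (B2 + B1 ^+ 2) = RC B2 + RC B1 ^+ 2 by rewrite rmorphD rmorphXn.
by move: (c1) (c2) (RC B1) (RC B2) => x y a b; field.
Qed.
End UpperBound.

(** * Primitives on the unit disk *)

Section DiskPrimitive.
Context {R : realType}.
Local Notation C := (Cplx R).
Local Notation RC t := (t%:C : C).
Local Notation D := (fun f : C -> C => (fun z => 'D_1 f z)).

Lemma derive_along (f : C -> C) (x h : C) : differentiable f x -> 'D_h f x = h * 'D_1 f x.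
Proof.
move=> df; rewrite !deriveE // -[h in LHS]mulr1.
exact: (linearZ_LR ('d f x) h 1).
Qed.

Lemma segment_in_disk (z : C) (t : R) : nrm z < 1 -> 0 <= t <= 1 -> nrm (RC t * z) < 1.
Proof.
move=> z1 /andP[t0 t1]; rewrite nrmM nrmR ger0_norm //; apply: le_lt_trans z1.
by rewrite ler_piMl // nrm_ge0.
Qed.

(** A holomorphic function on the unit disk is bounded on a tube of positive
    width around the segment from 0 to any point of the disk. *)
Lemma radius_tube (k : C -> C) (z : C) : holomorphic_on (@unit_disk R) k -> nrm z < 1 ->
  exists s : R, exists2 M : R, 0 < s & forall t, 0 <= t <= 1 ->
    forall w : C, nrm (w - RC t * z) < s -> nrm w < 1 /\ nrm (k w) <= M.
Proof.
move=> hk z1.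
pose P (u v l : R) := exists s : R, exists2 M : R, 0 < s & forall t, u <= t <= u + l ->
    forall w : C, nrm (w - RC t * z) < s -> nrm w < 1 /\ nrm (k w) <= M.
have := @subdivision R P 0 0 1 0 ler01 (lexx _); rewrite /P add0r; apply.
- move=> u v l l0 _ _ _ _ [s1 [M1 s10 H1]] [s2 [M2 s20 H2]] _ _.
  exists (Num.min s1 s2); exists (Num.max M1 M2); first by rewrite lt_min s10.
  rewrite mulr1 in H2; move=> t /andP[t1 t2] w; rewrite lt_min => /andP[w1 w2].
  have [tm|tm] := leP t (u + l / 2).
    have [|g1 g2] := H1 t _ w w1; first by rewrite t1.
    by split => //; rewrite le_max g2.
  have [|g1 g2] := H2 t _ w w2.
    by rewrite (ltW tm) /= -addrA -splitr.
  by split => //; rewrite le_max g2 orbT.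
- move=> t v; rewrite add0r => t01 _.
  have tz := segment_in_disk z1 t01.
  have [d1 d10 H1] := disk_nbhd tz.
  have [d2 d20 H2] := hasd_contc (holomorphic_hasd hk tz) ltr01.
  pose s := Num.min d1 d2 / 2.
  have s0 : 0 < s by rewrite divr_gt0 // lt_min d10.
  exists s => // u _ l l0 ls /andP[ut tu] _ _ _ _ _; exists s; exists (nrm (k (RC t * z)) + 1) => //.
  move=> t' /andP[ut' tu'] w hw; rewrite mulr1 in tu.
  have hw' : nrm (w - RC t * z) < Num.min d1 d2.
    have -> : w - RC t * z = (w - RC t' * z) + RC (t' - t) * z by rewrite rmorphB /=; ring.
    apply: le_lt_trans (nrmD _ _) _; rewrite nrmM nrmR.
    have h1 : `|t' - t| * nrm z <= l.
      have h2 : `|t' - t| <= l by rewrite ler_norml; apply/andP; split; lra.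
      by apply: le_trans h2; rewrite ler_piMr // ltW.
    have -> : Num.min d1 d2 = s + s by rewrite /s; field.
    by move: hw h1 ls; lra.
  move: hw'; rewrite lt_min => /andP[/H1 w1 /H2 w2]; move: w1 w2; rewrite subrKC => w1 w2.
  split => //; have -> : k w = (k w - k (RC t * z)) + k (RC t * z) by rewrite subrK.
  by apply: le_trans (nrmD _ _) _; rewrite addrC lerD2l.
Qed.

Section Primitive.
Variable k : C -> C.
Hypothesis hk : holomorphic_on (@unit_disk R) k.

(** The mean of [k] over the segment from 0 to [z]; [z * avg z] is the integral
    of [k] along that segment. *)
Let avg (z : C) : C := intg (fun t => k (RC t * z)) 0 1.
(** The derivative of [avg], by differentiation under the integral sign. *)
Let davg (z : C) : C := intg (fun t => RC t * 'D_1 k (RC t * z)) 0 1.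

Let hk1 := holomorphic_derive1 open_unit_disk hk.

Let RC_curve : der_on (fun t => RC t : C) (fun=> 1) 0 1.
Proof. by have := @der_on_lin R 0 1 0 1; under eq_fun do rewrite add0r mulr1. Qed.

Let cont_ray (f : C -> C) (z : C) : holomorphic_on (@unit_disk R) f -> nrm z < 1 ->
  cont_on (fun t => f (RC t * z)) 0 1.
Proof.
move=> hf z1; apply: (@cont_on_comp R f (fun t => RC t * z)).
  by apply: cont_onM; [exact: der_on_cont RC_curve|exact: cont_on_cst].
by move=> t t01; apply: hasd_contc (holomorphic_hasd hf (segment_in_disk z1 t01)).
Qed.

Let cont_tray (z : C) : nrm z < 1 -> cont_on (fun t => RC t * 'D_1 k (RC t * z)) 0 1.
Proof.
move=> z1; apply: cont_onM; first exact: der_on_cont RC_curve.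
exact: cont_ray hk1 z1.
Qed.

Let hasd_avg (z : C) : nrm z < 1 -> hasd avg z (davg z).
Proof.
move=> z1 e e0; have [s [M s0 H]] := radius_tube hk z1.
(* The remainder of [k] at [t z] is [O(|h|^2)] uniformly in [t], by
   [local_taylor] on the tube. *)
pose s' := s / 4; have s'0 : 0 < s' by rewrite divr_gt0.
have s4 : 4 * s' = s by rewrite /s'; field.
pose B := M * 2 / s' * 2 / s'.
have A0 : 0 < 1 + `|B| by rewrite ltr_pwDl.
have [d0 d00 Hd0] := disk_nbhd z1.
exists (Num.min d0 (Num.min s' (e / (1 + `|B|)))).
  by rewrite !lt_min d00 s'0 divr_gt0.
move=> h; rewrite !lt_min => /andP[hd /andP[hs]]; rewrite ltr_pdivlMr // => hB.
have zh := Hd0 h hd.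
have -> : avg (z + h) - avg z - h * davg z = intg (fun t => k (RC t * (z + h)) +
   (-1 * k (RC t * z) + - h * (RC t * 'D_1 k (RC t * z)))) 0 1.
  have c1 := cont_ray hk zh; have c2 := cont_ray hk z1; have c3 := cont_tray z1.
  rewrite (intgD ler01 c1 (cont_onD (cont_onZ _ c2) (cont_onZ _ c3))).
  rewrite (intgD ler01 (cont_onZ _ c2) (cont_onZ _ c3)) (intgZ _ ler01 c2) (intgZ _ ler01 c3).
  rewrite -/(avg _) -/(avg _) -/(davg _).
  by move: (avg _) (avg _) (davg _) => a b c; ring.
apply: (@le_trans _ _ (`|B| * nrm h ^+ 2 * (1 - 0))); last first.
  rewrite subr0 mulr1 expr2 mulrA ler_wpM2r ?nrm_ge0 //.
  apply: le_trans (ltW hB); rewrite mulrC ler_wpM2l ?nrm_ge0 // lerDr //.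
apply: intg_bound => //.
  apply: cont_onD; first exact: cont_ray.
  by apply: cont_onD; apply: cont_onZ; [exact: cont_ray|exact: cont_tray].
move=> t t01; have {}H := H t t01.
have df (y : C) : nrm (y - RC t * z) < 4 * s' -> differentiable k y.
  by rewrite s4 => /H[y1 _]; apply: hk; rewrite unit_diskE.
have fM (y : C) : nrm (y - RC t * z) < 4 * s' -> nrm (k y) <= M.
  by rewrite s4 => /H[].
have th : nrm (RC t * h) <= nrm h.
  by case/andP: t01 => t0 t1; rewrite nrmM nrmR ger0_norm // ler_piMl // nrm_ge0.
have := @local_taylor R C k (RC t * z) s' M s'0 df fM (RC t * z) (RC t * h).
rewrite subrr nrm0 mulr_gt0 // => /(_ isT).
have -> : RC t * z + RC t * h - RC t * z = RC t * h by ring.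
have hs2 : nrm (RC t * h) < 2 * s' by apply: le_lt_trans th _; move: hs s'0; lra.
move=> /(_ hs2) T.
have dk : differentiable k (RC t * z).
  by apply: df; rewrite subrr nrm0 mulr_gt0.
rewrite derive_along // in T; rewrite mulrDr.
have -> : k (RC t * z + RC t * h) + (-1 * k (RC t * z) + - h * (RC t * 'D_1 k (RC t * z))) =
   k (RC t * z + RC t * h) - k (RC t * z) - RC t * h * 'D_1 k (RC t * z).
  by move: (k _) (k _) ('D_1 k _) => a b c; ring.
apply: le_trans T _; rewrite -/B.
apply: ler_pM; rewrite ?exprn_ge0 ?nrm_ge0 ?ler_norm //; last first.
  by rewrite lerXn2r ?nnegrE ?nrm_ge0.
have M0 : 0 <= M by apply: le_trans (nrm_ge0 _) (fM (RC t * z) _); rewrite subrr nrm0 mulr_gt0.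
by rewrite /B !(divr_ge0, mulr_ge0) // ltW.
Qed.

(** The integrand [k(t z) + z t k'(t z)] is the derivative of [t k(t z)]. *)
Let avg_davg (z : C) : nrm z < 1 -> avg z + z * davg z = k z.
Proof.
move=> z1; rewrite /avg /davg.
rewrite -(intgZ _ ler01 (cont_tray z1)) -(intgD ler01 (cont_ray hk z1) (cont_onZ _ (cont_tray z1))).
have hq (t : R) : 0 <= t <= 1 -> hasd (fun q : C => q * k (q * z)) (RC t)
    (1 * k (RC t * z) + RC t * ((1 * z + RC t * 0) * 'D_1 k (RC t * z))).
  move=> t01.
  have hl : hasd (fun q : C => q * z) (RC t) (1 * z + RC t * 0).
    exact: hasdM (hasd_id _) (hasd_cst z _).
  exact: hasdM (hasd_id _) (hasd_comp hl (holomorphic_hasd hk (segment_in_disk z1 t01))).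
have dd := eq_der_on (g := fun t => k (RC t * z) + z * (RC t * 'D_1 k (RC t * z))) _
   (der_on_comp RC_curve hq).
have {}dd := dd _; rewrite (intgE ler01 (dd _)).
  by rewrite !mul1r mul0r subr0.
move=> t _; move: (k _) ('D_1 k _) => a b; ring.
Qed.

Lemma disk_primitive : exists2 P : C -> C, P 0 = 0 &
  forall z : C, nrm z < 1 -> hasd P z (k z).
Proof.
exists (fun z => z * avg z); first by rewrite mul0r.
move=> z z1; have := hasdM (hasd_id z) (hasd_avg z1).
by rewrite mul1r avg_davg.
Qed.
End Primitive.

(** A zero-free solution of [E' = k E] on the disk: the exponential of a
    primitive of [k]. *)
Lemma exp_primitive (k : C -> C) : holomorphic_on (@unit_disk R) k ->
  exists E : C -> C, [/\ E 0 = 1, forall z, E z != 0 &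
    forall z : C, nrm z < 1 -> hasd E z (k z * E z)].
Proof.
move=> /disk_primitive[P P0 dP]; exists (fun z => cexp (P z)); split.
- by rewrite P0 cexp0.
- by move=> z; exact: cexp_neq0.
- by move=> z /dP h; exact: hasd_comp h (hasd_cexp _).
Qed.

(** The singularity of [(phi(z) - phi(0)) / z] at 0 is removable. *)
Lemma holomorphic_quotient (phi : C -> C) : holomorphic_on (@unit_disk R) phi ->
  exists2 k : C -> C, holomorphic_on (@unit_disk R) k &
    forall z, z * k z = phi z - phi 0.
Proof.
move=> hphi; have n0 : nrm (0 : C) < 1 by rewrite nrm0.
pose k (z : C) : C := if z == 0 then 'D_1 phi 0 else (phi z - phi 0) / z.
exists k; last first.
  by move=> z; rewrite /k; case: eqP => [->|/eqP z0]; [rewrite mul0r subrr|rewrite mulrC divfK].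
move=> z; rewrite unit_diskE => z1.
suff [l hl] : exists l, hasd k z l by have [] := hasd_differentiable hl.
have [->|z0] := eqVneq z 0.
  have hphi1 := holomorphic_derive1 open_unit_disk hphi.
  exists ('D_1 (D phi) 0 / 2) => e e0.
  have [d d0 H] := taylor2 ltr01 (holomorphic_hasd hphi) (holomorphic_hasd hphi1 n0) e0.
  exists d => // h hd; rewrite add0r /k eqxx.
  have [->|h0] := eqVneq h 0; first by rewrite subrr mul0r subrr nrm0 mulr0.
  have -> : (phi h - phi 0) / h - 'D_1 phi 0 - h * ('D_1 (D phi) 0 / 2) =
    (phi h - phi 0 - h * 'D_1 phi 0 - h ^+ 2 * ('D_1 (D phi) 0 / 2)) / h.
    by move: (phi h) (phi 0) ('D_1 phi 0) ('D_1 (D phi) 0) => a b c g; field.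
  rewrite nrmM nrmV ler_pdivrMr ?nrm_gt0 //.
  by apply: le_trans (H h hd) _; rewrite expr2 mulrA.
have h2 := hasdM (hasdD (holomorphic_hasd hphi z1) (hasd_cst (- phi 0) z)) (hasdV z0 (hasd_id z)).
eexists; apply: (eq_hasd (d := nrm z) _ _ h2); first by rewrite nrm_gt0.
move=> h hz; rewrite /k; case: eqP => // E; exfalso.
have : h = - z by rewrite -[RHS]addr0 -E addKr.
by move=> hE; rewrite hE nrmN ltxx in hz.
Qed.
End DiskPrimitive.

(** * A coordinate functional dominated by the Minkowski functional *)

Section SupportingFunctional.
Context {R : realType} {n : nat}.
Local Notation C := (Cplx R).
Local Notation RC t := (t%:C : C).
Local Notation V := 'cV[C]_n.

Lemma nrm_coord (z : V) j : nrm (z j 0) <= nrm z.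
Proof.
apply/ler_addgt0Pr => e e0.
have : ball (0 : V) (nrm z + e)%:C z.
  by rewrite -ball_normE /= sub0r normrN nrm_lt ltrDl.
move=> [_ /(_ j 0)]; rewrite -ball_normE /= mxE sub0r normrN.
by rewrite (nrm_lt (z j 0 : C)) => /ltW.
Qed.

Lemma nrm_coord_lt (z : V) (e : R) : 0 < e -> (forall j, nrm (z j 0) < e) -> nrm z < e.
Proof.
move=> e0 h; rewrite -nrm_lt -[`|z|]normrN -[- z]sub0r.
suff : ball (0 : V) e%:C z by rewrite -ball_normE.
split; first by rewrite ltcR.
move=> i j; rewrite (ord1 j) -ball_normE /= mxE sub0r normrN.
by rewrite (nrm_lt (z i 0 : C)).
Qed.

(** The identification of R^(2n) with C^n, used to obtain compactness of
    closed bounded sets. *)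
Definition of_real (v : 'rV[R]_(n + n)) : V :=
  \col_j ((v 0 (lshift n j) +i* v 0 (rshift n j))%C : C).

Lemma of_real_onto (z : V) : exists v, of_real v = z.
Proof.
exists (row_mx (\row_j complex.Re (z j 0)) (\row_j complex.Im (z j 0))).
apply/matrixP => i j; rewrite (ord1 j) mxE row_mxEl row_mxEr !mxE.
by case: (z i 0).
Qed.

Lemma of_real_coord v w j : nrm ((of_real v - of_real w) j 0) <=
  `|v 0 (lshift n j) - w 0 (lshift n j)| + `|v 0 (rshift n j) - w 0 (rshift n j)|.
Proof. by rewrite !mxE; apply: le_trans (nrm_le_ReIm _) _; rewrite ReB ImB. Qed.

Lemma of_real_near (v : 'rV[R]_(n + n)) (e : R) : 0 < e ->
  \forall w \near v, nrm (of_real v - of_real w) < e.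
Proof.
move=> e0; have e20 : 0 < e / 2 by rewrite divr_gt0.
apply/nbhs_ballP; exists (e / 2) => // w [_ vw]; apply: nrm_coord_lt => // j.
apply: le_lt_trans (of_real_coord _ _ _) _; rewrite [e]splitr.
have := vw 0 (lshift n j); have := vw 0 (rshift n j).
by rewrite -!ball_normE /= => h1 h2; apply: ltrD.
Qed.

Lemma of_real_continuous : continuous of_real.
Proof.
move=> v; apply/(@cvgrPdist_lt _ _ _ (nbhs v) (nbhs_filter v)) => _ /gt0_real[e e0 ->].
by move: (of_real_near v e0); apply: (@filterS _ _ (nbhs_filter v)) => w; rewrite nrm_lt.
Qed.

Lemma nrm_lipschitz (z w : C) : `|nrm z - nrm w| <= nrm (z - w).
Proof.
rewrite ler_norml; apply/andP; split.
  rewrite lerBrDl lerBlDr nrmBC; apply: le_trans (nrmD _ _).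
  by rewrite addrC subrK.
by rewrite lerBlDr; apply: le_trans (nrmD _ _); rewrite subrK.
Qed.

Variables (Omega : set V) (rho : V -> R).
Hypothesis hOmega : bounded_starlike_circular_domain Omega.
Hypothesis hrho : minkowski_functional Omega rho.

(** The coordinate function indexed by [i0], normalised by its maximum on
    the compact set [rho = 1], is dominated by [rho] and attains it. *)
Lemma supporting_functional (i0 : 'I_n) : exists2 a : C,
  (forall z : V, nrm (z i0 0 * a) <= rho z) & exists2 u : V, rho u = 1 & u i0 0 * a = 1.
Proof.
have scal := minkowski_scale hrho; have pos := minkowski_gt0 hrho.
pose A := [set v | rho (of_real v) = 1].
pose f (v : 'rV[R]_(n + n)) := nrm (of_real v i0 0).
have norm1 (z : V) : z != 0 -> exists2 v, A v & of_real v = (RC (rho z))^-1 *: z.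
  move=> z0; have [v vE] := of_real_onto ((RC (rho z))^-1 *: z).
  by exists v => //; rewrite /A /= vE; exact: (bdry_rho hrho).
have rc : continuous (rho \o of_real).
  move=> v; apply: continuous_comp; first exact: of_real_continuous.
  by case: hrho => + _ _ _ _; apply.
have fc : continuous f.
  move=> v; apply/(@cvgrPdist_lt _ _ _ (nbhs v) (nbhs_filter v)) => e e0.
  move: (of_real_near v e0); apply: (@filterS _ _ (nbhs_filter v)) => w hw.
  apply: le_lt_trans (nrm_lipschitz _ _) _.
  apply: le_lt_trans hw; have := nrm_coord (of_real v - of_real w) i0.
  by rewrite !mxE.
have clA : closed A.
  have -> : A = (rho \o of_real) @^-1` [set 1] by [].
  by apply: preimage_closed; [move=> v _; exact: rc|exact: closed_eq].
(* [A] is bounded because half of each of its points lies in the bounded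
   set [Omega]. *)
have bA : bounded_set A.
  have [m hm] : exists m : R, forall z, Omega z -> nrm z <= m.
    case: hOmega => _ _ /ex_strict_bound_gt0[_ /gt0_real[m _ ->] HM] _ _.
    by exists m => z /HM /=; rewrite nrm_lt => /ltW.
  exists (2 * m); split; first exact: num_real.
  move=> y my v Av /=; apply: le_trans (ltW my).
  have hv : nrm (of_real v) <= 2 * m.
    have : Omega (RC (2^-1) *: of_real v).
      rewrite (OmegaE hrho) scal nrmR Av mulr1 ger0_norm ?invr_ge0 //.
      by rewrite invf_lt1 // ltr1n.
    by move=> /hm; rewrite nrmZ nrmR ger0_norm ?invr_ge0 // ler_pdivrMl.
  rewrite [`|v|]mx_normrE; apply: bigmax_le => [|[i j] _ /=].
    by apply: le_trans hv; exact: nrm_ge0.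
  rewrite (ord1 i); case: (split_ordP j) => k ->.
    apply: le_trans (le_trans (nrm_coord (of_real v) k) hv).
    by rewrite mxE; have := Re_le_nrm ((v 0 (lshift n k) +i* v 0 (rshift n k))%C : C).
  apply: le_trans (le_trans (nrm_coord (of_real v) k) hv).
  by rewrite mxE; have := Im_le_nrm ((v 0 (lshift n k) +i* v 0 (rshift n k))%C : C).
pose e0 : V := delta_mx i0 0.
have e00 : e0 i0 0 = 1 by rewrite mxE !eqxx.
have e0n : e0 != 0.
  by apply/eqP => h; move: e00; rewrite h mxE => /esym/eqP; rewrite oner_eq0.
have [v0 Av0 v0E] := norm1 e0 e0n.
(* [c] maximises the modulus of the coordinate on [rho = 1]. *)
have [c Ac cmax] := compact_EVT_max (ex_intro _ v0 Av0)
  (bounded_closed_compact bA clA) (continuous_subspaceT fc).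
have fc0 : 0 < f c.
  apply: lt_le_trans (cmax v0 (mem_set Av0)).
  rewrite /f v0E mxE e00 mulr1 nrmV nrmR invr_gt0 gtr0_norm; exact: pos.
have [p p1 pE] := polar (of_real c i0 0); rewrite -/(f c) in pE.
have p0 : p != 0 by rewrite -nrm_gt0 p1.
have rf : RC (f c) != 0 by rewrite RC_neq0 gt_eqF.
exists (RC (f c) * p)^-1; last first.
  exists (of_real c); first by move: Ac; rewrite inE.
  by rewrite pE mulfV // mulf_neq0.
move=> z; rewrite nrmM nrmV nrmM p1 mulr1 nrmR (gtr0_norm fc0) ler_pdivrMr //.
have [->|z0] := eqVneq z 0.
  rewrite mxE nrm0; apply: mulr_ge0; last exact: ltW.
  by case: hrho => _ + _ _ _; apply.
have [v Av vE] := norm1 z z0.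
have := cmax v (mem_set Av); rewrite /f vE mxE nrmM nrmV nrmR.
by rewrite gtr0_norm ?pos // ler_pdivrMl ?pos.
Qed.
End SupportingFunctional.

(** * The extremal mapping *)

Section NearEqual.
Context {R : realType} {V W : normedModType R[i]}.

(** Differentiability at [x] depends only on the values near [x]. *)
Lemma differentiable_on_open (A : set V) (f f' : V -> W) x : open A -> A x ->
  (forall y, A y -> f y = f' y) -> differentiable f x -> differentiable f' x.
Proof.
move=> oA Ax ff' df.
have /nbhs_normP[_ /= /gt0_real[a a0 ->] aA] : nbhs x A by exact: open_nbhs_nbhs.
apply: (proj1 (eps_differentiable (L := 'd f x) (diff_continuous df) _)) => e e0.
have [_ /gt0_real[d d0 ->] H] := differentiable_eps df e0.
exists (Num.min a d)%:C; first by rewrite ltcR lt_min a0.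
move=> h; rewrite nrm_lt lt_min => /andP[ha hd].
rewrite -(ff' x Ax) -ff'; first by apply: H; rewrite nrm_lt.
by apply: aA; rewrite /= nrm_lt opprD addNKr nrmN.
Qed.
End NearEqual.

Section Extremal.
Context {R : realType} {n : nat}.
Local Notation C := (Cplx R).
Local Notation RC t := (t%:C : C).
Local Notation V := 'cV[C]_n.
Local Notation D := (fun f : C -> C => (fun z => 'D_1 f z)).
Variables (Omega : set V) (rho : V -> R).
Hypothesis hOmega : bounded_starlike_circular_domain Omega.
Hypothesis hOmega0 : Omega 0.
Hypothesis hrho : minkowski_functional Omega rho.
Hypothesis hrhoC1 : C1_off_origin rho.
Variable Phi : C -> C.
Hypothesis hPhi : holomorphic_on (@unit_disk R) Phi.
Hypothesis hPhi0 : Phi 0 = 1.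
Hypothesis hPhiRe : forall zeta, @unit_disk R zeta -> 0 < complex.Re (Phi zeta).
Variables (i0 : 'I_n) (a : C).
(** The linear form whose composition with [E] is extremal. *)
Let T (z : V) : C := z i0 0 * a.
Hypothesis hT : forall z : V, nrm (T z) <= rho z.
Variables (k E : C -> C).
Hypothesis hk : forall z : C, z * k z = Phi ('i%R * z) - 1.
Hypothesis E0 : E 0 = 1.
Hypothesis E_neq0 : forall z, E z != 0.
Hypothesis hE : forall z : C, nrm z < 1 -> hasd E z (k z * E z).

Let g (z : V) : C := E (T z).
(** The value of [1 + Dg(z) z / g(z)] at [z], see [extremal_radial_derive]. *)
Let F (z : V) : C := Phi ('i%R * T z).

Lemma form_along_line (z v : V) (q : C) : T (z + q *: v) = T z + q * T v.
Proof. by rewrite /T !mxE; ring. Qed.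

Lemma form_disk z : Omega z -> nrm (T z) < 1.
Proof. by rewrite (OmegaE hrho) => h; apply: le_lt_trans h. Qed.

Lemma iform_disk z : Omega z -> @unit_disk R ('i%R * T z).
Proof. by move=> /form_disk h; rewrite unit_diskE nrmM nrmi mul1r. Qed.

Lemma form_differentiable z : differentiable T z.
Proof. by apply: differentiableM; [exact: differentiable_entry|exact: differentiable_cst]. Qed.

Lemma extremal_F_neq0 z : Omega z -> F z != 0.
Proof.
move=> /iform_disk h; apply/eqP => F0.
by have := hPhiRe h; rewrite -/(F z) F0 /= ltxx.
Qed.

Lemma extremal_holomorphic : holomorphic_on Omega g.
Proof.
move=> z Oz; have [dE _] := hasd_differentiable (hE (form_disk Oz)).
exact: (@differentiable_comp _ _ _ _ T E z (form_differentiable z) dE).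
Qed.

Lemma extremal_F_differentiable z : Omega z -> differentiable F z.
Proof.
move=> Oz; have dT : differentiable (fun w : V => 'i%R * T w : C) z.
  by apply: differentiableM; [exact: differentiable_cst|exact: form_differentiable].
exact: (@differentiable_comp _ _ _ _ (fun w : V => 'i%R * T w : C) Phi z dT (hPhi (iform_disk Oz))).
Qed.

Lemma extremal_derive z v : Omega z -> 'D_v g z = T v * (k (T z) * g z).
Proof.
move=> Oz; apply: derive_line; first exact: extremal_holomorphic.
have h1 : hasd (fun q : C => T z + q * T v) 0 (T v).
  have := hasdD (hasd_cst (T z) 0) (hasdM (hasd_id 0) (hasd_cst (T v) 0)).
  by rewrite mulr0 addr0 mul1r add0r.
have hE0 : hasd E (T z + 0 * T v) (k (T z) * g z).
  by rewrite mul0r addr0; apply: hE; apply: form_disk.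
have := hasd_comp h1 hE0; apply: (eq_hasd ltr01) => h _.
by rewrite /g form_along_line.
Qed.

(** The equation [w E'(w) = (Phi(i w) - 1) E(w)] along the complex line
    through [z]. *)
Lemma extremal_radial_derive z : Omega z -> g z + 'D_z g z = g z * F z.
Proof.
move=> Oz; rewrite extremal_derive // mulrA hk -/(F z).
by move: (g z) (F z) => x y; ring.
Qed.

(** If [J u = 0], then applying [T] gives [g(z) F(z) T(u) = 0], hence
    [T(u) = 0], and then [J u] reduces to [g(z) u]. *)
Lemma extremal_unitmx z : Omega z -> cjacobian (radial g) z \in unitmx.
Proof.
move=> Oz; have dg := extremal_holomorphic Oz.
have gz : g z != 0 by exact: E_neq0.
rewrite -unitmx_tr -row_free_unit; apply: inj_row_free => v hv.
have Ju : cjacobian (radial g) z *m v^T = 0.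
  by apply: trmx_inj; rewrite trmx_mul trmxK hv trmx0.
rewrite jacobian_radial_mul // in Ju.
set u := v^T in Ju; set l := 'D_u g z in Ju.
have lE : l = T u * (k (T z) * g z) by exact: extremal_derive.
(* Apply [T] to the equation [g(z) u + (Dg(z) u) z = 0]. *)
have Tu : T u = 0.
  have : T (g z *: u + l *: z) = 0 by rewrite Ju /T mxE mul0r.
  have -> : T (g z *: u + l *: z) = g z * F z * T u.
    have -> : T (g z *: u + l *: z) = g z * T u + l * T z by rewrite /T !mxE; ring.
    have := extremal_radial_derive Oz; rewrite extremal_derive // => <-.
    by rewrite lE; move: (g z) (T z) (T u) (k (T z)) => x y w b; ring.
  move=> /eqP; rewrite mulf_eq0 mulf_eq0 (negbTE gz) (negbTE (extremal_F_neq0 Oz)) /=.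
  by move=> /eqP.
have u0 : u = 0.
  move: Ju; rewrite lE Tu mul0r scale0r addr0 => /eqP.
  by rewrite scaler_eq0 (negbTE gz) => /eqP.
by rewrite -[v]trmxK -/u u0 trmx0.
Qed.

Lemma extremal_pullback z : Omega z ->
  invmx (cjacobian (radial g) z) *m radial g z = (F z)^-1 *: z.
Proof.
move=> Oz; have [->|z0] := eqVneq z 0.
  by rewrite /radial !scaler0 mulmx0.
have [_ ->] := radial_pullback (extremal_holomorphic Oz) z0 (extremal_unitmx Oz).
rewrite extremal_radial_derive // invfM mulrA mulfV ?mul1r //; exact: E_neq0.
Qed.

Lemma extremal_Finv_differentiable z : Omega z -> differentiable (fun w => (F w)^-1) z.
Proof.
by move=> Oz; apply: differentiableV; [exact: extremal_F_differentiable|exact: extremal_F_neq0].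
Qed.

Lemma extremal_class_M :
  class_M Omega rho Phi (fun z => invmx (cjacobian (radial g) z) *m radial g z).
Proof.
have oO : open Omega by case: hOmega.
split.
- move=> z Oz; apply: (differentiable_on_open oO Oz (f := fun w => (F w)^-1 *: w)).
    by move=> w Ow; rewrite extremal_pullback.
  have -> : (fun w : V => (F w)^-1 *: w) =
     \sum_(j < n) (fun w : V => ((F w)^-1 * w j 0) *: (delta_mx j 0 : V)).
    apply/funext => w; rewrite fct_sumE {2}[w]matrix_sum_delta scaler_sumr.
    by apply: eq_bigr => j _; rewrite big_ord1 scalerA.
  apply: differentiable_sum => j; apply: differentiableZl.
  by apply: differentiableM; [exact: extremal_Finv_differentiable|exact: differentiable_entry].
- by rewrite extremal_pullback // scaler0.
- apply/matrixP => i j; rewrite !mxE /partial.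
  pose f (w : V) : C := (F w)^-1 * w i 0.
  have fE w : Omega w -> f w = (invmx (cjacobian (radial g) w) *m radial g w) i 0.
    by move=> Ow; rewrite extremal_pullback // mxE.
  have df : differentiable f 0.
    by apply: differentiableM; [exact: extremal_Finv_differentiable|exact: differentiable_entry].
  have df' := differentiable_on_open oO hOmega0 fE df.
  have /nbhs_normP[_ /= /gt0_real[d d0 ->] dO] : nbhs (0 : V) Omega by exact: open_nbhs_nbhs.
  transitivity ('D_(delta_mx j 0) f 0).
    apply: derive_line df' _.
    have df0 : differentiable f (0 + 0 *: (delta_mx j 0 : V)) by rewrite scale0r addr0.
    have := line_hasd df0; rewrite scale0r addr0.
    have A0 : 0 < 1 + nrm (delta_mx j 0 : V) by rewrite ltr_pwDl // nrm_ge0.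
    apply: (eq_hasd (divr_gt0 d0 A0)) => h; rewrite ltr_pdivlMr // => hh.
    apply: fE; apply: dO; rewrite /= nrm_lt sub0r nrmN !add0r nrmZ.
    by apply: le_lt_trans hh; rewrite ler_wpM2l ?nrm_ge0 // lerDr.
  rewrite derive_mul_coord; last exact: extremal_Finv_differentiable.
  rewrite !mxE mulr0 add0r /F /T mxE mul0r mulr0 hPhi0 invr1 mul1r eqxx andbT.
  by [].
- move=> z Oz z0; rewrite extremal_pullback // -scalemxAr mxE mulrCA (minkowski_euler hrho hrhoC1 z0).
  have rz : RC (rho z) != 0 by rewrite RC_neq0 gt_eqF // (minkowski_gt0 hrho).
  exists ('i%R * T z); first exact: iform_disk.
  rewrite -/(F z); have := extremal_F_neq0 Oz; move: rz.
  move: (F z) (RC (rho z)) => x y y0 x0; field.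
  by apply/andP.
Qed.

Lemma extremal_admissible : admissible Omega rho Phi g.
Proof.
split; [exact: extremal_holomorphic| |exact: extremal_unitmx|exact: extremal_class_M].
by rewrite /g /T mxE mul0r E0.
Qed.

(** On the slice through [u] the function is [E], with [b_2 = i B1] and
    [b_3 = - (B2 + B1^2) / 2]. Any point of the slice other than the origin
    will do; [z = u / 2] lies in the domain. *)
Lemma extremal_value (u : V) (B1 B2 : R) : rho u = 1 -> T u = 1 ->
  'D_1 Phi 0 = RC B1 -> 'D_1 (D Phi) 0 = RC (2 * B2) ->
  let z := RC (2^-1) *: u in
  let b3 := coef_b rho (radial g) 3 z in
  let b2 := coef_b rho (radial g) 2 z in
  [/\ Omega z, z != 0 & 2 * b2 ^+ 2 * b3 - b3 ^+ 2 - 2 * b2 ^+ 2 + 1 =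
   RC (1 + 2 * B1 ^+ 2 + (3 * B1 ^+ 2 - B2) * (B2 + B1 ^+ 2) / 4)].
Proof.
move=> ru Tu P1E P2E z b3 b2.
have u0 : u != 0.
  apply/eqP => u0; case: hrho => _ _ rz _ _; have := proj2 (rz u) u0.
  by rewrite ru => /eqP; rewrite oner_eq0.
have h20 : RC (2^-1) != 0 by rewrite RC_neq0 invr_eq0 pnatr_eq0.
have z0 : z != 0 by rewrite scaler_eq0 negb_or h20.
have rz : rho z = 2^-1.
  by rewrite (minkowski_scale hrho) ru mulr1 nrmR ger0_norm // invr_ge0.
have Oz : Omega z by rewrite (OmegaE hrho) rz invf_lt1 // ltr1n.
split => //.
have [b2E b3E] := coef_b_slice hOmega hrho hrhoC1 extremal_holomorphic z0.
have bu : bdry rho z = u by rewrite /bdry rz /z scalerA mulVf // scale1r.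
have sE : slice g (bdry rho z) = E.
  rewrite bu; apply/funext => q; rewrite /slice /g.
  by have := form_along_line 0 u q; rewrite add0r Tu mulr1 {2}/T mxE mul0r add0r => ->.
rewrite sE in b2E b3E.
have hEh : holomorphic_on (@unit_disk R) E.
  move=> q; rewrite unit_diskE => q1.
  by have [] := hasd_differentiable (hE q1).
have hE1 := holomorphic_derive1 open_unit_disk hEh.
have hE2 := holomorphic_derive1 open_unit_disk hE1.
have hP1 := holomorphic_derive1 open_unit_disk hPhi.
have n0 : nrm (0 : C) < 1 by rewrite nrm0.
have hi (q : C) : hasd (fun w : C => 'i%R * w) q 'i%R.
  by have := hasdZ 'i%R (hasd_id q); rewrite mulr1.
have iq (q : C) : nrm q < 1 -> nrm ('i%R * q : C) < 1 by rewrite nrmM nrmi mul1r.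
pose Q (q : C) : C := Phi ('i%R * q).
pose Q1 (q : C) : C := 'i%R * 'D_1 Phi ('i%R * q).
have hQ (q : C) : nrm q < 1 -> hasd Q q (Q1 q).
  by move=> q1; exact: hasd_comp (hi q) (holomorphic_hasd hPhi (iq q q1)).
have hQ1 : hasd Q1 0 ('i%R * ('i%R * 'D_1 (D Phi) ('i%R * 0))).
  by apply: hasdZ; exact: hasd_comp (hi 0) (holomorphic_hasd hP1 (iq 0 n0)).
have ode (q : C) : nrm q < 1 -> E q + q * 'D_1 E q = Q q * E q.
  move=> q1; have -> : 'D_1 E q = k q * E q.
    by have [_] := hasd_differentiable (hE q1).
  by rewrite mulrA hk -/(Q q); move: (E q) (Q q) => x y; ring.
have [e1 e2] := log_derivative_coef (holomorphic_hasd hEh) (holomorphic_hasd hE1) (holomorphic_hasd hE2) hQ hQ1 ode E0.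
have ii : 'i%R ^+ 2 = -1 :> C by exact: sqr_i.
have b2v : b2 = 'i%R * RC B1 by rewrite /b2 b2E e1 /Q1 mulr0 P1E.
have b3v : b3 = - (RC B2 + RC B1 ^+ 2) / 2.
  have half (w : C) : w / 2 = 2 * w / 2 / 2 by field.
  apply: etrans b3E (etrans (half _) (etrans (congr1 (fun w => w / 2 / 2) e2) _)).
  rewrite /Q1 mulr0 P1E P2E exprMn ii mulrA -expr2 ii.
  have -> : RC (2 * B2) = 2 * RC B2 by rewrite rmorphM /= rmorph_nat.
  by move: (RC B1) (RC B2) => x y; field.
rewrite b2v b3v exprMn ii.
have -> : RC (1 + 2 * B1 ^+ 2 + (3 * B1 ^+ 2 - B2) * (B2 + B1 ^+ 2) / 4) =
  1 + 2 * RC B1 ^+ 2 + (3 * RC B1 ^+ 2 - RC B2) * (RC B2 + RC B1 ^+ 2) / 4.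
  by field.
by move: (RC B1) (RC B2) => x y; field.
Qed.
End Extremal.

(** * The sharp estimate *)

Lemma bound_ge0 (R : realType) (B1 B2 : R) : 0 < B1 ->
  B1 - B1 ^+ 2 <= B2 -> B2 <= 3 * B1 ^+ 2 - B1 ->
  0 <= 1 + 2 * B1 ^+ 2 + (3 * B1 ^+ 2 - B2) * (B2 + B1 ^+ 2) / 4.
Proof.
move=> B10 lo up; have s2 : 0 <= B1 ^+ 2 by rewrite sqr_ge0.
rewrite !addr_ge0 ?ler01 ?mulr_ge0 ?invr_ge0 ?ler0n //; lra.
Qed.

Unset Implicit Arguments.
Set Strict Implicit.
Set Printing Implicit Defensive.

Theorem theorem3p2 (R : realType) (n : nat) (hn : (0 < n)%N)
    (Omega : set 'cV[Cplx R]_n) (rho : 'cV[Cplx R]_n -> R)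
    (hOmega : bounded_starlike_circular_domain Omega)
    (hOmega0 : Omega 0)
    (hrho : minkowski_functional Omega rho)
    (hrhoC1 : C1_off_origin rho)
    (Phi : Cplx R -> Cplx R)
    (hPhi : biholomorphic_onto_image (@unit_disk R) Phi)
    (hPhi0 : Phi 0 = 1)
    (hPhi1 : 0 < derive1 Phi 0)
    (hPhi2 : derive1n 2 Phi 0 \is Num.real)
    (hPhiRe : forall zeta, @unit_disk R zeta -> 0 < complex.Re (Phi zeta))
    (hlow : 2 * derive1 Phi 0 - 2 * (derive1 Phi 0) ^+ 2 <= derive1n 2 Phi 0)
    (hupp : derive1n 2 Phi 0 <= 6 * (derive1 Phi 0) ^+ 2 - 2 * derive1 Phi 0) :
  let bound : Cplx R :=
    1 + 2 * (derive1 Phi 0) ^+ 2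
    + (derive1 Phi 0) ^+ 2 / 4
      * (3 * derive1 Phi 0 - derive1n 2 Phi 0 / (2 * derive1 Phi 0))
      * (derive1n 2 Phi 0 / (2 * derive1 Phi 0) + derive1 Phi 0) in
  let quantity (g : 'cV[Cplx R]_n -> Cplx R) (z : 'cV[Cplx R]_n) : Cplx R :=
    let b3 := coef_b rho (radial g) 3 z in
    let b2 := coef_b rho (radial g) 2 z in
    `|2 * b2 ^+ 2 * b3 - b3 ^+ 2 - 2 * b2 ^+ 2 + 1| in
  (forall g : 'cV[Cplx R]_n -> Cplx R, admissible Omega rho Phi g ->
     forall z, Omega z -> z != 0 -> quantity g z <= bound)
  /\
  (exists g : 'cV[Cplx R]_n -> Cplx R, admissible Omega rho Phi g /\
     exists z, [/\ Omega z, z != 0 & quantity g z = bound]).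
Proof.
move=> bound quantity.
have [B1 B10 P1] := gt0_real hPhi1.
pose B2 : R := complex.Re (derive1n 2 Phi 0) / 2.
have P2 : derive1n 2 Phi 0 = (2 * B2)%:C.
  by rewrite /B2 mulrC divfK ?pnatr_eq0 // RRe_real.
have P1E : 'D_1 Phi 0 = B1%:C by rewrite -P1 derive1E.
have D2 : derive1n 2 Phi 0 = 'D_1 (fun z => 'D_1 Phi z) 0.
  have -> : (fun z => 'D_1 Phi z) = derive1 Phi.
    by apply/funext => z; exact: esym (derive1E Phi z).
  exact: (derive1E (derive1 Phi) 0).
have P2E := etrans (esym D2) P2.
have boundE : bound = (1 + 2 * B1 ^+ 2
    + (3 * B1 ^+ 2 - B2) * (B2 + B1 ^+ 2) / 4)%:C.
  have b0 : (B1%:C : Cplx R) != 0 by rewrite RC_neq0 gt_eqF.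
  by rewrite /bound P1 P2; field.
have lo : B1 - B1 ^+ 2 <= B2.
  move: hlow; rewrite P1 P2.
  have -> : 2 * B1%:C - 2 * B1%:C ^+ 2 = (2 * B1 - 2 * B1 ^+ 2)%:C :> Cplx R by ring.
  by rewrite lecR; lra.
have up : B2 <= 3 * B1 ^+ 2 - B1.
  move: hupp; rewrite P1 P2.
  have -> : 6 * B1%:C ^+ 2 - 2 * B1%:C = (6 * B1 ^+ 2 - 2 * B1)%:C :> Cplx R by ring.
  by rewrite lecR; lra.
split.
  move=> g adm z Oz z0; rewrite boundE.
  have := upper_bound hOmega hrho hrhoC1 hPhi hPhi0 hPhiRe adm z0 B10 P1E P2E lo up
    erefl erefl.
  by rewrite -nrm_le.
have [hPhiH _] := hPhi.
have [a aT [u ru uT]] := supporting_functional hOmega hrho (Ordinal hn).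
pose phi (w : Cplx R) : Cplx R := Phi ('i%R * w).
have hphi : holomorphic_on (@unit_disk R) phi.
  move=> w; rewrite unit_diskE => w1.
  have iw : nrm ('i%R * w : Cplx R) < 1 by rewrite nrmM nrmi mul1r.
  have hi := hasdZ 'i%R (hasd_id w).
  by have [] := hasd_differentiable (hasd_comp hi (holomorphic_hasd hPhiH iw)).
have [k hk kE] := holomorphic_quotient hphi.
have [E [E0 En0 hE]] := exp_primitive hk.
have {}kE w : w * k w = Phi ('i%R * w) - 1 by rewrite kE /phi mulr0 hPhi0.
exists (fun z => E (z (Ordinal hn) 0 * a)); split.
  exact: (extremal_admissible hOmega hOmega0 hrho hrhoC1 hPhiH hPhi0 hPhiRe aT kE E0 En0 hE).
have [Oz z0 value] :=
  extremal_value hOmega hrho hrhoC1 hPhiH aT kE E0 hE ru uT P1E P2E.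
exists ((2^-1)%:C *: u); split; [exact: Oz | exact: z0 |].
have modulusE (x : Cplx R) : `|x| = (nrm x)%:C := nrmE x.
rewrite /quantity; cbv zeta; rewrite value modulusE nrmR ger0_norm.
  by rewrite boundE.
exact: bound_ge0 B10 lo up.
Qed.
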